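(* For every cuspidal function $m\in C^\infty(G)$ that has compact support modulo $Z(G)$, there exists a polynomial $\beta\in\mathbb{N}[t]$ such that for every $x\in G^{rss}$, setting $i_0=\beta(ov_{G^{rss}}(x))$, we have $\mathcal{A}_i(m)(x)=\mathcal{A}_{i_0}(m)(x)$ for every integer $i>i_0$.
   Context: $F$ is a non-Archimedean local field of arbitrary characteristic, $O_F$ its ring of integers, $\mathrm{val}$ the normalized valuation. $G=\mathrm{GL}_n(F)$, $Z(G)$ its center, $G^{ad}=G/Z(G)$. For $x\in G$, $ov_G(x)=\max\big(\max_{i,j}(-\mathrm{val}(x_{ij})),\mathrm{val}(\det x)\big)$, $G_i=\{x: ov_G(x)\le i\}$, $(G^{ad})_i$ its image in $G^{ad}$. $\Delta(x)$ is the discriminant of the characteristic polynomial, $G^{rss}=\{\Delta\ne0\}$, $ov_{G^{rss}}(x)=\max(ov_G(x),\mathrm{val}\Delta(x))$. $\mu_{G^{ad}}$ is the Haar measure on $G^{ad}$ (quotient of the Haar measure of $G$ giving $\mathrm{GL}_n(O_F)$ measure 1 by that of $Z(G)\cong F^\times$ giving $O_F^\times$ measure 1). For $f\in C^\infty(G)$, $\mathcal{A}_i(f)(x)=\int_{(G^{ad})_i}f(gxg^{-1})\,d\mu_{G^{ad}}(g)$. A function $f\in C^\infty(G)$ is cuspidal if for the unipotent radical $U$ of every proper parabolic subgroup of $G$ and every $x\in G$, the function $u\mapsto f(ux)$ on $U$ is compactly supported and has integral $0$ with respect to a Haar measure of $U$. *)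

(* Defs.v *)
From HB Require Import structures.
From mathcomp Require Import all_boot all_order all_algebra.
From mathcomp Require Import all_classical all_reals all_analysis.
From mathcomp Require Import complex.
Set Implicit Arguments. Unset Strict Implicit. Unset Printing Implicit Defensive.
Import Order.TTheory GRing.Theory Num.Theory.
Import numFieldNormedType.Exports.
Local Open Scope classical_set_scope.
Local Open Scope ring_scope.

(* alias of M_n(F) carrying a pointedType instance (needed by
   g_sigma_algebraType); it is definitionally 'M[F]_n *)
Definition MxP (F : fieldType) (n : nat) : Type := 'M[F]_n.
HB.instance Definition _ (F : fieldType) (n : nat) := Choice.on (MxP F n).
HB.instance Definition _ (F : fieldType) (n : nat) :=
  isPointed.Build (MxP F n) (0 : 'M[F]_n)%R.

Section LocalField.
Variables (F : fieldType) (val : F -> int).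

(* "a and b are congruent modulo p^k" : a = b or val (a - b) >= k
   (convention val 0 = +oo) *)
Definition vclose (k : int) (a b : F) : Prop := a = b \/ k <= val (a - b).

Definition in_OF (a : F) : Prop := a = 0 \/ 0 <= val a.

Definition is_local_field : Prop :=
  [/\ (forall x y, x != 0 -> y != 0 -> val (x * y) = val x + val y),
      (forall x y, x != 0 -> y != 0 -> x + y != 0 ->
         Num.min (val x) (val y) <= val (x + y)),
      (exists pi : F, pi != 0 /\ val pi = 1),
      (exists s : seq F, (forall r, r \in s -> in_OF r) /\
         forall a, in_OF a -> exists2 r, r \in s & vclose 1 a r) &
      (forall u : nat -> F,
         (forall k : int, exists N, forall p q, (N <= p)%N -> (N <= q)%N ->
            vclose k (u p) (u q)) ->
         exists l, forall k : int, exists N, forall p, (N <= p)%N ->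
            vclose k (u p) l)].

Variable n : nat.
Local Notation Mat := 'M[F]_n.

Definition mx_ball (a : Mat) (k : int) : set Mat :=
  [set y | forall i j, vclose k (y i j) (a i j)].

Definition mx_balls : set (set (MxP F n)) :=
  [set B | exists a k, B = mx_ball a k].

(* M_n(F) with its Borel sigma-algebra (generated by the balls; the space is
   second countable, so this is the Borel sigma-algebra) *)
Local Notation BMat := (g_sigma_algebraType mx_balls).

Definition GL : set Mat := [set x | x \in unitmx].

Definition ovG (x : Mat) : int :=
  \big[Num.max/val (\det x)]_(ij : 'I_n * 'I_n | x ij.1 ij.2 != 0)
     (- val (x ij.1 ij.2)).

Definition Gi (i : int) : set Mat := [set x | x \in unitmx /\ ovG x <= i].

Definition GLO : set Mat :=
  [set x : Mat | (forall i j, in_OF (x i j)) /\ \det x != 0 /\ val (\det x) = 0].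

Definition mx_bounded (k : int) (y : Mat) : Prop :=
  forall i j, y i j = 0 \/ - k <= val (y i j).

Definition discr (p : {poly F}) : F :=
  (-1) ^+ ((size p).-1 * (size p).-2)./2 * resultant p p^`() / lead_coef p.

Definition Delta (x : Mat) : F := discr (char_poly x).

Definition Grss : set Mat := [set x | x \in unitmx /\ Delta x != 0].

Definition ovGrss (x : Mat) : int := Num.max (ovG x) (val (Delta x)).

Definition smooth (V : Type) (f : Mat -> V) : Prop :=
  forall x, x \in unitmx -> exists k : int,
    forall y, mx_ball x k y -> f y = f x.

(* compact support modulo Z(G): support contained in Z(G) G_i for some i
   (every compact subset of G lies in some G_i, and G_i is compact) *)
Definition cpt_supp_mod_center (V : zmodType) (f : Mat -> V) : Prop :=
  exists i : int, forall x, x \in unitmx -> f x != 0 ->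
    exists z : F, z != 0 /\ ovG (z *: x) <= i.

Variable R : realType.

Definition cintegral (d : measure_display) (T : measurableType d)
  (mu : {measure set T -> \bar R}) (D : set T) (f : T -> R[i]) : R[i] :=
  Complex (Rintegral mu D (fun t => complex.Re (f t)))
          (Rintegral mu D (fun t => complex.Im (f t))).

(* mu (a measure on M_n(F)) restricts to the Haar measure of G giving
   GL_n(O_F) measure 1: left G-invariant on Borel subsets of G, finite on
   compact subsets of G (i.e. on each G_i), normalized. *)
Definition is_haar_G (mu : {measure set BMat -> \bar R}) : Prop :=
  [/\ (forall g : Mat, g \in unitmx -> forall A : set BMat, measurable A ->
         A `<=` GL -> mu ((fun y => g *m y) @^-1` A) = mu A),
      (forall i, (mu (Gi i) < +oo)%E) &
      mu GLO = 1%E].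

Definition unip_std (blk : 'I_n -> nat) : set Mat :=
  [set u : Mat | forall i j, (blk i < blk j)%N \/ u i j = (i == j)%:R].

(* unipotent radicals of proper parabolic subgroups of G: conjugates of the
   standard ones for a nondecreasing, nonconstant block function *)
Definition proper_block (blk : 'I_n -> nat) : Prop :=
  (forall i j : 'I_n, (i <= j)%N -> (blk i <= blk j)%N) /\
  exists i j, blk i != blk j.

Definition unip_rad (g : Mat) (blk : 'I_n -> nat) : set Mat :=
  [set g *m u *m invmx g | u in unip_std blk].

(* nu is a Haar measure on the closed subgroup U of G: concentrated on U,
   left U-invariant, finite on compact subsets (bounded ones), nonzero *)
Definition is_haar_on (U : set Mat) (nu : {measure set BMat -> \bar R}) : Prop :=
  [/\ nu (~` U) = 0%E,
      (forall u, U u -> forall A : set BMat, measurable A ->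
         nu ((fun y => u *m y) @^-1` A) = nu A),
      (forall k, (nu [set y | mx_bounded k y] < +oo)%E) &
      (0 < nu U)%E].

Definition cuspidal (f : Mat -> R[i]) : Prop :=
  forall g blk, g \in unitmx -> proper_block blk ->
  forall x, x \in unitmx ->
    (exists k, forall u, unip_rad g blk u -> f (u *m x) != 0 -> mx_bounded k u)
    /\ (forall nu, is_haar_on (unip_rad g blk) nu ->
          cintegral nu (unip_rad g blk) (fun u => f (u *m x)) = 0).

(* (G^ad)_i realized through the fundamental domain
   {g in G : 0 <= val det g < n} of Z(G) modulo O_F^x:
   the preimage of (G^ad)_i in this domain *)
Definition Dad (i : int) : set Mat :=
  [set g | g \in unitmx /\ 0 <= val (\det g) < n%:Z /\
           exists z : F, z != 0 /\ ovG (z *: g) <= i].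

Definition Aop (mu : {measure set BMat -> \bar R}) (i : int)
  (f : Mat -> R[i]) (x : Mat) : R[i] :=
  cintegral mu (Dad i) (fun g : BMat => f (g *m x *m invmx g)).

End LocalField.

Notation BMat val n := (g_sigma_algebraType (@mx_balls _ val n)).

(* Main.v *)
Require Import Defs.
From HB Require Import structures.
From mathcomp Require Import all_boot all_order all_algebra.
From mathcomp Require Import all_classical all_reals all_analysis.
From mathcomp Require Import complex.
From mathcomp Require Import fingroup perm measurable_realfun zify ring.
Set Implicit Arguments. Unset Strict Implicit. Unset Printing Implicit Defensive.
Import Order.TTheory GRing.Theory Num.Theory.
Local Open Scope classical_set_scope.
Local Open Scope ring_scope.

(** Let K = GL_n(O_F) and x regular semisimple.  Since the sets (G^ad)_i are
    bi-K-invariant, it suffices to show that the average of m(k g k' x (k g k')^-1) over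
    k, k' in K vanishes for every g in (G^ad)_i outside (G^ad)_(i_0).  By the Cartan
    decomposition one may take g = a diagonal with increasing valuations, and g being deep
    means that two consecutive valuations differ by more than a bound gamma which is linear
    in ov(x).  Let U be the unipotent radical of the maximal parabolic P cut out by that gap.
    For a bounded u in U the element a^-1 u a lies in K, so the average over k' contains an
    average of m(k u Y u^-1 k^-1) over such u, where Y = a k' x k'^-1 a^-1.  If this is not
    identically zero then, after translating u, Y is bounded and its lower left block is tiny,
    so Hensel's lemma (a matrix Riccati equation, solvable because the discriminant of x is not
    too small) conjugates Y into Y0 in P by some w so close to 1 that u w u^-1 is in K; hence the
    average over k does not see the difference between Y and Y0.  Finally u Y0 u^-1 = u' Y0 where
    u -> u' is a linear automorphism of U, and the sum over u is a cuspidal integral.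
    No use is made of a level of m, which need not be bounded along Z(G). *)

(** Put $v=ov(x)$, let the support of [m] lie in $Z(G)G_N$, and write $b=v+2N$, $M=v+6n^2b$. The
    number $b$ comes from the determinant: conjugation keeps it equal to $\det x$, which pins down
    the central scalar left free by the support condition, so a conjugate of $x$ at which [m] is
    nonzero has entries of valuation at least $-b$. The number $M$ bounds the precision lost in
    solving the linear equations $XD-AX=E$ and is read off from the discriminant through a Bezout
    identity. The depth $\gamma=v+3M+1$ involves nothing else, which makes [beta] affine. The level
    at which [m] is locally constant is chosen last, after $x$ and $i$, on the compact set of
    bounded matrices of determinant $\det x$. It only serves to turn integrals into finite sums over
    cosets of a congruence subgroup, so its dependence on $i$ does not reach $i_0$. Finite sums make
    every change of order or of variable elementary. The one integral that stays is the cuspidal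
    one, and for it a Haar measure of $U$ has to be constructed: cuspidality quantifies over such
    measures and would say nothing if there were none. *)

(** Serves twice: for $F$ with its valuation and for $F[X]$ with the least valuation of a
    coefficient. The determinant estimates below thus cover matrices over $F$ and characteristic
    matrices alike. *)
Record filtration (R : nzRingType) (G : int -> R -> Prop) : Prop := Filtration {
  filt0 : forall k, G k 0;
  filt1 : G 0 1;
  filtD : forall k a b, G k a -> G k b -> G k (a + b);
  filtN : forall k a, G k a -> G k (- a);
  filtM : forall k l a b, G k a -> G l b -> G (k + l) (a * b);
  filtW : forall k l a, k <= l -> G l a -> G k a }.

Section Filtration.
Variables (R : nzRingType) (G : int -> R -> Prop).
Hypothesis HG : filtration G.

Lemma filtB k a b : G k a -> G k b -> G k (a - b).
Proof. by move=> ha hb; apply: (filtD HG ha); apply: (filtN HG hb). Qed.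

Lemma filt_sum (I : Type) (r : seq I) (P : pred I) (E : I -> R) k :
  (forall i, P i -> G k (E i)) -> G k (\sum_(i <- r | P i) E i).
Proof.
by move=> h; apply: (big_ind (G k)) => //; [exact: (filt0 HG)|exact: (filtD HG)].
Qed.

Lemma filt_prod (I : Type) (r : seq I) (E : I -> R) (k : int) :
  (forall i, G k (E i)) -> G (k *+ size r) (\prod_(i <- r) E i).
Proof.
move=> h; elim: r => [|i r IH] /=; first by rewrite big_nil mulr0n; exact: (filt1 HG).
by rewrite big_cons mulrS; apply: (filtM HG).
Qed.

Lemma filtX k a j : G k a -> G (k *+ j) (a ^+ j).
Proof.
move=> h; elim: j => [|j IH]; first by rewrite mulr0n expr0; exact: (filt1 HG).
by rewrite exprS mulrS; apply: (filtM HG).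
Qed.

Lemma filt_sign b : G 0 ((-1) ^+ b).
Proof. by rewrite -[0](mul0rn _ b); apply: filtX; apply: (filtN HG); exact: (filt1 HG). Qed.

Lemma filt_prod_sub (I : Type) (r : seq I) (E E' : I -> R) (k : int) : 0 <= k ->
  (forall i, G 0 (E i)) -> (forall i, G 0 (E' i)) ->
  (forall i, G k (E i - E' i)) ->
  G k (\prod_(i <- r) E i - \prod_(i <- r) E' i).
Proof.
move=> k0 h h' hd; elim: r => [|i r IH] /=.
  by rewrite !big_nil subrr; exact: (filt0 HG).
rewrite !big_cons; set P := \prod_(j <- r) E j; set P' := \prod_(j <- r) E' j.
have -> : E i * P - E' i * P' = E i * (P - P') + (E i - E' i) * P'.
  by rewrite mulrBr mulrBl addrA subrK.
have int0 : G 0 P'.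
  by rewrite -[0](mul0rn _ (size r)); exact: filt_prod.
apply: (filtD HG).
  by rewrite -[k]add0r; apply: (filtM HG).
by rewrite -[k]addr0; apply: (filtM HG).
Qed.

End Filtration.

Section FiltrationDet.
Variables (R : comNzRingType) (G : int -> R -> Prop).
Hypothesis HG : filtration G.

Lemma filt_det n (M : 'M[R]_n) k : (forall i j, G k (M i j)) -> G (k *+ n) (\det M).
Proof.
move=> h; apply: (filt_sum HG) => s _; rewrite -[k *+ n]add0r.
apply: (filtM HG); first exact: filt_sign.
have -> : k *+ n = k *+ size (index_enum 'I_n).
  by rewrite -[index_enum _]enumT size_enum_ord.
exact: filt_prod.
Qed.

Lemma filt_det_sub n (M M' : 'M[R]_n) k : 0 <= k ->
  (forall i j, G 0 (M i j)) -> (forall i j, G 0 (M' i j)) ->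
  (forall i j, G k (M i j - M' i j)) -> G k (\det M - \det M').
Proof.
move=> k0 h h' hd; rewrite /determinant -sumrB; apply: (filt_sum HG) => s _.
rewrite -mulrBr -[k]add0r; apply: (filtM HG); first exact: filt_sign.
by apply: (filt_prod_sub HG) => //.
Qed.

Lemma filt_cofactor n (M : 'M[R]_n) i0 j0 k :
  (forall i j, G k (M i j)) -> G (k *+ n.-1) (cofactor M i0 j0).
Proof.
move=> h; rewrite -[k *+ _]add0r; apply: (filtM HG); first exact: filt_sign.
by apply: filt_det => i j; rewrite !mxE.
Qed.

End FiltrationDet.

Definition vge (F : fieldType) (val : F -> int) (k : int) (a : F) : Prop :=
  a = 0 \/ k <= val a.

Definition pge (F : fieldType) (val : F -> int) (k : int) (p : {poly F}) : Prop :=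
  forall i, vge val k p`_i.

Definition mge (F : fieldType) (val : F -> int) (p q : nat) (k : int) (M : 'M[F]_(p, q)) : Prop :=
  forall i j, vge val k (M i j).

(** * Valuations *)

Section Valuation.
Variables (F : fieldType) (val : F -> int).
Hypothesis HF : is_local_field val.
Local Notation vge := (vge val).
Local Notation pge := (pge val).
Local Notation mge := (mge val).

Lemma val_mul x y : x != 0 -> y != 0 -> val (x * y) = val x + val y.
Proof. by case: HF => h *; exact: h. Qed.

Lemma val_one : val 1 = 0.
Proof. by apply: (addrI (val 1)); rewrite -val_mul ?oner_neq0 // mulr1 addr0. Qed.

Lemma val_inv x : x != 0 -> val x^-1 = - val x.
Proof.
by move=> x0; have := val_mul x0 (invr_neq0 x0); rewrite mulfV // val_one; lia.
Qed.

Lemma val_opp x : val (- x) = val x.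
Proof.
have [->|x0] := eqVneq x 0; first by rewrite oppr0.
have n1 : (-1 : F) != 0 by rewrite oppr_eq0 oner_neq0.
have : val (-1) = 0 by have := val_mul n1 n1; rewrite mulrNN mulr1 val_one; lia.
by move=> v1; rewrite -mulN1r val_mul // v1 add0r.
Qed.

Lemma val_exp x k : x != 0 -> val (x ^+ k) = val x *+ k.
Proof.
move=> x0; elim: k => [|k IH]; first by rewrite expr0 val_one mulr0n.
by rewrite exprS val_mul ?expf_neq0 // IH mulrS.
Qed.

Lemma val_prod (I : Type) (r : seq I) (E : I -> F) : (forall i, E i != 0) ->
  val (\prod_(i <- r) E i) = \sum_(i <- r) val (E i).
Proof.
move=> h; elim: r => [|i r IH]; first by rewrite !big_nil val_one.
rewrite !big_cons val_mul ?IH //; elim: (r) => [|j s IHs]; first by rewrite big_nil oner_neq0.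
by rewrite big_cons mulf_neq0.
Qed.

Lemma exists_uniformizer : exists c, c != 0 /\ val c = 1.
Proof. by case: HF. Qed.

Lemma exists_val k : exists c, c != 0 /\ val c = k.
Proof.
have [c [c0 c1]] := exists_uniformizer.
case: k => k; last first.
  by exists (c ^+ k.+1)^-1; rewrite invr_eq0 expf_neq0 // val_inv ?expf_neq0 // val_exp // c1; split => //; lia.
by exists (c ^+ k); rewrite expf_neq0 // val_exp // c1; split => //; lia.
Qed.

Lemma vge_filt : filtration vge.
Proof.
split.
- by move=> k; left.
- by right; rewrite val_one.
- move=> k a b; rewrite /vge; have [->|a0] := eqVneq a 0; first by rewrite add0r.
  have [->|b0] := eqVneq b 0; first by rewrite addr0.
  have [->|ab0] := eqVneq (a + b) 0; first by left.
  move=> [|ha]; first by move/eqP: a0.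
  move=> [|hb]; first by move/eqP: b0.
  right; case: HF => _ h _ _ _; have := h _ _ a0 b0 ab0.
  by apply: le_trans; rewrite le_min ha hb.
- by move=> k a [->|h]; [left; rewrite oppr0|right; rewrite val_opp].
- move=> k l a b; rewrite /vge; have [->|a0] := eqVneq a 0; first by rewrite mul0r; left.
  have [->|b0] := eqVneq b 0; first by rewrite mulr0; left.
  move=> [|ha]; first by move/eqP: a0.
  move=> [|hb]; first by move/eqP: b0.
  by right; rewrite val_mul // lerD.
- by move=> k l a kl [->|h]; [left|right; exact: le_trans h].
Qed.

Lemma vge0 k : vge k 0. Proof. exact: (filt0 vge_filt). Qed.
Lemma vge1 : vge 0 1. Proof. exact: (filt1 vge_filt). Qed.
Lemma vgeD k a b : vge k a -> vge k b -> vge k (a + b). Proof. exact: (filtD vge_filt). Qed.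
Lemma vgeN k a : vge k a -> vge k (- a). Proof. exact: (filtN vge_filt). Qed.
Lemma vgeB k a b : vge k a -> vge k b -> vge k (a - b). Proof. exact: (filtB vge_filt). Qed.
Lemma vgeM k l a b : vge k a -> vge l b -> vge (k + l) (a * b).
Proof. exact: (filtM vge_filt). Qed.
Lemma vgeW k l a : k <= l -> vge l a -> vge k a. Proof. exact: (filtW vge_filt). Qed.

Lemma vge_val k a : a != 0 -> vge k a <-> k <= val a.
Proof. by move=> a0; split=> [[a0'|//]|]; [rewrite a0' eqxx in a0|right]. Qed.

Lemma vge_self a : vge (val a) a.
Proof. by right. Qed.

Lemma vgeV a : a != 0 -> vge (- val a) a^-1.
Proof. by move=> a0; right; rewrite val_inv. Qed.

Lemma vge_eq0 a : (forall k, vge k a) -> a = 0.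
Proof.
move=> h; have [//|a0] := eqVneq a 0.
by case: (h (val a + 1)) => //; lia.
Qed.

Lemma vcloseE k a b : vclose val k a b <-> vge k (a - b).
Proof.
rewrite /vclose /vge; split=> [[->|h]|[/eqP|h]]; rewrite ?subrr; [by left|by right| |by right].
by rewrite subr_eq0 => /eqP ->; left.
Qed.

Lemma val_unit_sub a : vge 1 (a - 1) -> a != 0 /\ val a = 0.
Proof.
move=> h; have a0 : a != 0.
  by apply/eqP => a0; move: h; rewrite a0 sub0r => -[/eqP|];
    rewrite ?oppr_eq0 ?oner_eq0 // val_opp val_one.
have : vge 0 a.
  by rewrite -(subrK 1 a); apply: vgeD; [exact: vgeW h|exact: vge1].
move=> /(vge_val _ a0) ge0; split=> //; apply/eqP; rewrite eq_le ge0 andbT leNgt.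
apply/negP => gt0.
have : vge 1 (a - (a - 1)) by apply: vgeB => //; right.
by rewrite opprB addrC subrK => /(vge_val _ (oner_neq0 F)); rewrite val_one.
Qed.

Lemma pge_filt : filtration pge.
Proof.
split.
- by move=> k i; rewrite coef0; exact: vge0.
- move=> i; rewrite coef1; case: (i == 0%N); [exact: vge1|exact: vge0].
- by move=> k a b ha hb i; rewrite coefD; apply: vgeD.
- by move=> k a ha i; rewrite coefN; apply: vgeN.
- by move=> k l a b ha hb i; rewrite coefM; apply: (filt_sum vge_filt) => j _; apply: vgeM.
- by move=> k l a kl ha i; apply: vgeW (ha i).
Qed.

Lemma pgeC k a : vge k a -> pge k a%:P.
Proof. by move=> h i; rewrite coefC; case: eqP => _ //; exact: vge0. Qed.

Lemma pgeX : pge 0 'X.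
Proof. by move=> i; rewrite coefX; case: eqP => _; [exact: vge1|exact: vge0]. Qed.

Lemma pge_deriv k p : pge k p -> pge k p^`().
Proof.
move=> h i; rewrite coef_deriv -[_ *+ _]mulr_natl -[k]add0r; apply: vgeM => //.
elim: (i.+1) => [|j IH]; first exact: vge0.
by rewrite mulrS; apply: vgeD => //; exact: vge1.
Qed.

Lemma mge0 p q k : mge k (0 : 'M[F]_(p, q)).
Proof. by move=> i j; rewrite mxE; exact: vge0. Qed.
Lemma mgeD p q k (A B : 'M[F]_(p, q)) : mge k A -> mge k B -> mge k (A + B).
Proof. by move=> hA hB i j; rewrite mxE; exact: vgeD. Qed.
Lemma mgeN p q k (A : 'M[F]_(p, q)) : mge k A -> mge k (- A).
Proof. by move=> hA i j; rewrite mxE; exact: vgeN. Qed.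
Lemma mgeB p q k (A B : 'M[F]_(p, q)) : mge k A -> mge k B -> mge k (A - B).
Proof. by move=> hA hB; apply: mgeD => //; exact: mgeN. Qed.
Lemma mgeM p q r k l (A : 'M[F]_(p, q)) (B : 'M[F]_(q, r)) : mge k A -> mge l B -> mge (k + l) (A *m B).
Proof. by move=> hA hB i j; rewrite mxE; apply: (filt_sum vge_filt) => h _; exact: vgeM. Qed.
Lemma mgeZ p q k l a (A : 'M[F]_(p, q)) : vge k a -> mge l A -> mge (k + l) (a *: A).
Proof. by move=> ha hA i j; rewrite mxE; exact: vgeM. Qed.
Lemma mgeW p q k l (A : 'M[F]_(p, q)) : k <= l -> mge l A -> mge k A.
Proof. by move=> kl hA i j; exact: vgeW (hA i j). Qed.
Lemma mge1 p : mge 0 (1%:M : 'M[F]_p).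
Proof. by move=> i j; rewrite mxE; case: eqP => _; [exact: vge1|exact: vge0]. Qed.
Lemma mge_eq0 p q (A : 'M[F]_(p, q)) : (forall k, mge k A) -> A = 0.
Proof. by move=> h; apply/matrixP => i j; rewrite mxE; apply: vge_eq0 => k; exact: h. Qed.

Lemma mgeM3 p q r s k l h (A : 'M[F]_(p, q)) (B : 'M[F]_(q, r)) (C : 'M[F]_(r, s)) :
  mge k A -> mge l B -> mge h C -> mge (k + l + h) (A *m B *m C).
Proof. by move=> hA hB hC; apply: mgeM => //; exact: mgeM. Qed.

Lemma mge_block p1 p2 q1 q2 k (A : 'M[F]_(p1, q1)) (B : 'M[F]_(p1, q2)) (C : 'M[F]_(p2, q1)) (D : 'M[F]_(p2, q2)) :
  mge k (block_mx A B C D) <-> [/\ mge k A, mge k B, mge k C & mge k D].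
Proof.
split=> [h|[hA hB hC hD] i j].
  by split=> i j; [have := h (lshift _ i) (lshift _ j)|have := h (lshift _ i) (rshift _ j)
    |have := h (rshift _ i) (lshift _ j)|have := h (rshift _ i) (rshift _ j)];
    rewrite (block_mxEul, block_mxEur, block_mxEdl, block_mxEdr).
rewrite -(fintype.splitK i) -(fintype.splitK j); case: (fintype.split i) => i'; case: (fintype.split j) => j' /=;
  by rewrite (block_mxEul, block_mxEur, block_mxEdl, block_mxEdr).
Qed.

Lemma mge_adj n k (A : 'M[F]_n) : mge k A -> mge (k *+ n.-1) (\adj A).
Proof. by move=> hA i j; rewrite mxE; exact: (filt_cofactor vge_filt). Qed.

Lemma mge_inv n k (A : 'M[F]_n) : mge k A -> \det A != 0 ->
  mge (k *+ n.-1 - val (\det A)) (invmx A).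
Proof.
move=> hA d0; rewrite /invmx unitmxE unitfE d0 addrC; apply: mgeZ; first exact: vgeV.
exact: mge_adj.
Qed.

Lemma mge_val_det n k (A : 'M[F]_n) : mge k A -> \det A != 0 -> k *+ n <= val (\det A).
Proof. by move=> hA d0; apply/(vge_val _ d0); exact: (filt_det vge_filt). Qed.

End Valuation.

Lemma subr_ACA (V : zmodType) (a b c d : V) : (a - b) - (c - d) = (a - c) - (b - d).
Proof. by rewrite !opprB [d - c]addrC [d - b]addrC addrACA. Qed.

(** * Resultants and rescaling of characteristic polynomials *)

Section Resultant.
Variable F : fieldType.

(** The degrees are free parameters, whereas the type of [Sylvester_mx] depends on the sizes of the
    polynomials. Matrices attached to different pairs of polynomials can then be compared without
    casts. *)
Definition sylvester (dq dp : nat) (p q : {poly F}) : 'M[F]_(dq + dp) :=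
  \matrix_(i, j) match fintype.split i with
    | inl k => p`_(j - k) *+ (k <= j)
    | inr k => q`_(j - k) *+ (k <= j) end.

Lemma resultantE p q : resultant p q = \det (sylvester (size q).-1 (size p).-1 p q).
Proof. by congr (\det _); apply/matrixP => i j; rewrite Sylvester_mxE mxE. Qed.

(* The hypotheses say that p' and q' are p and q made homogeneous of weights N1 and N2 in c. *)
Lemma sylvester_scale dq dp (p q p' q' : {poly F}) (c : F) N1 N2 :
  (forall i, p'`_i * c ^+ i = c ^+ N1 * p`_i) ->
  (forall i, q'`_i * c ^+ i = c ^+ N2 * q`_i) ->
  sylvester dq dp p' q' *m diag_mx (\row_j c ^+ j) =
  diag_mx (\row_i match fintype.split i with inl k => c ^+ (N1 + k) | inr k => c ^+ (N2 + k) end)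
  *m sylvester dq dp p q.
Proof.
move=> hp hq; apply/matrixP => i j; rewrite mul_diag_mx mul_mx_diag !mxE.
case: (fintype.split i) => k; case: leqP => kj; rewrite ?mulr0n ?mul0r ?mulr0 // !mulr1n.
  by rewrite -{2}(subnK kj) exprD mulrA hp exprD mulrAC.
by rewrite -{2}(subnK kj) exprD mulrA hq exprD mulrAC.
Qed.

(** Substituting $cX$ for $X$ turns the characteristic matrix of $cY$ into $c$ times that of $Y$. *)
Lemma char_poly_scale n (Y : 'M[F]_n) (c : F) i :
  (char_poly (c *: Y))`_i * c ^+ i = c ^+ n * (char_poly Y)`_i.
Proof.
have -> : (char_poly (c *: Y))`_i * c ^+ i = (char_poly (c *: Y) \Po (c *: 'X))`_i.
  by rewrite comp_polyE; under eq_bigr => j _ do rewrite exprZn scalerA;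
     rewrite -(poly_def _ (fun j => (char_poly (c *: Y))`_j * c ^+ j)) coef_poly;
     case: ltnP => // /(nth_default 0) ->; rewrite mul0r.
have E : map_mx (comp_poly (c *: 'X)) (char_poly_mx (c *: Y)) = c%:P *: char_poly_mx Y.
  apply/matrixP => a b; rewrite !mxE rmorphB /= rmorphMn /= comp_polyX comp_polyC.
  by rewrite mulrBr mulrnAr mul_polyC polyCM.
by rewrite -coefZ -det_map_mx /= E detZ -rmorphXn /= mul_polyC.
Qed.

End Resultant.

(** * Bezout bounds and the Riccati equation *)

Section Hensel.
Variables (F : fieldType) (val : F -> int).
Hypothesis HF : is_local_field val.
Local Notation vge := (vge val).
Local Notation pge := (pge val).
Local Notation mge := (mge val).

(* The first row of the adjugate of the Sylvester matrix lists the coefficients of u and v. *)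
Lemma resultant_bezout p q : pge 0 p -> pge 0 q -> (1 < size p)%N ->
  exists u v, [/\ pge 0 u, pge 0 v & (resultant p q)%:P = u * p + v * q].
Proof.
move=> hp hq sp.
pose dq := (size q).-1; pose dp := (size p).-1.
have dS0 : (0 < dq + dp)%N by rewrite /dp; lia.
pose j0 := Ordinal dS0.
pose S : 'M[F]_(dq + dp) := Sylvester_mx p q.
have hS : mge 0 S.
  move=> i j; rewrite Sylvester_mxE; case: (fintype.split i) => k;
    by case: leqP => _; rewrite ?mulr1n ?mulr0n //; exact: (vge0 HF).
pose w := row j0 (\adj S).
have hw i : vge 0 (w 0 i).
  by rewrite mxE; have := mge_adj HF hS j0 i; rewrite mul0rn.
have rV_pge d (z : 'rV[F]_d) : (forall i, vge 0 (z 0 i)) -> pge 0 (rVpoly z).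
  move=> hz i; rewrite coef_rVpoly; case: insub => [k|]; [exact: hz|exact: (vge0 HF)].
exists (rVpoly (lsubmx w)), (rVpoly (rsubmx w)); split.
- by apply: rV_pge => i; rewrite mxE.
- by apply: rV_pge => i; rewrite mxE.
have : w *m S = resultant p q *: delta_mx 0 j0.
  by rewrite /w -row_mul mul_adj_mx -/(resultant p q) -scalemx1 linearZ /= row1.
rewrite -[w in w *m _]hsubmxK {1}/S /Sylvester_mx mul_row_col !mul_rV_lin1 /=.
move/(congr1 rVpoly); rewrite linearD linearZ /= rVpoly_delta expr0 alg_polyC => <-.
rewrite !poly_rV_K //.
  case: (eqVneq (rVpoly (rsubmx w)) 0) => [->|nz]; first by rewrite mul0r size_poly0.
  apply: leq_trans (size_polyMleq _ _) _.
  have : (size (rVpoly (rsubmx w)) <= dp)%N by exact: size_poly.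
  move: (size (rVpoly (rsubmx w))) => z; rewrite /dq /dp; lia.
case: (eqVneq (rVpoly (lsubmx w)) 0) => [->|nz]; first by rewrite mul0r size_poly0.
apply: leq_trans (size_polyMleq _ _) _.
have : (size (rVpoly (lsubmx w)) <= dq)%N by exact: size_poly.
move: (size (rVpoly (lsubmx w))) => z; rewrite /dq /dp; lia.
Qed.

Lemma char_poly_pge n (Y : 'M[F]_n) : mge 0 Y -> pge 0 (char_poly Y).
Proof.
move=> hY; rewrite /char_poly -[0](mul0rn _ n); apply: (filt_det (pge_filt HF)) => i j.
rewrite !mxE; apply: (filtB (pge_filt HF)); last exact: pgeC.
by case: eqP => _; rewrite ?mulr1n ?mulr0n; [exact: pgeX|exact: (filt0 (pge_filt HF))].
Qed.


(** The price in the discriminant for making a matrix integral by a scalar. Taking determinants in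
    [sylvester_scale] compares the two resultants up to powers of $c$; there are fewer than $2n$
    rows, each with exponent at most $3n$, hence $6n^2$. *)
Lemma resultant_char_poly_scale n (Y : 'M[F]_n) (c : F) : (0 < n)%N ->
  Delta Y != 0 -> c != 0 -> 0 <= val c ->
  let p := char_poly (c *: Y) in
  resultant p p^`() != 0 /\
  val (resultant p p^`()) <= val (Delta Y) + val c *+ (6 * n * n)%N.
Proof.
move=> n0 D0 c0 vc p; pose q := char_poly Y.
have hp i : p`_i * c ^+ i = c ^+ n * q`_i by exact: char_poly_scale.
have hp' i : p^`()`_i * c ^+ i = c ^+ n.-1 * q^`()`_i.
  apply: (mulIf c0); rewrite -mulrA -exprSr !coef_deriv mulrnAl hp.
  by rewrite mulrAC -exprSr prednK // mulrnAr.
have sp : size p = n.+1 by exact: size_char_poly.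
have sq : size q = n.+1 by exact: size_char_poly.
(* In positive characteristic the derivative may have degree below $n-1$, so its size is not
   computed but compared coefficient by coefficient. Both Sylvester matrices then have the same
   format. *)
have sz : size p^`() = size q^`().
  have e i : (p^`()`_i == 0) = (q^`()`_i == 0).
    have := congr1 (fun a => a == 0) (hp' i).
    by rewrite /= !mulf_eq0 !expf_eq0 (negbTE c0) !andbF orbF.
  apply/eqP; rewrite eqn_leq; apply/andP; split; apply/leq_sizeP => j hj; apply/eqP.
    by rewrite e nth_default.
  by rewrite -e nth_default.
have DE : Delta Y = (-1) ^+ ((n * n.-1)./2) * resultant q q^`().
  by rewrite /Delta /discr -/q (monicP (char_poly_monic Y)) divr1 sq.
have vD : val (Delta Y) = val (resultant q q^`()) /\ resultant q q^`() != 0.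
  move: D0; rewrite DE mulf_eq0 negb_or => /andP[s0 r0]; split => //.
  rewrite (val_mul HF) // (val_exp HF) ?oppr_eq0 ?oner_eq0 //.
  by rewrite (val_opp HF) (val_one HF) mul0rn add0r.
case: vD => vD r0.
have := sylvester_scale (size q^`()).-1 (size q).-1 hp hp'.
move/(congr1 determinant); rewrite !det_mulmx !det_diag.
rewrite !resultantE in r0 vD *; rewrite sz sp -sq; set R' := \det _; set R := \det (sylvester _ _ q _).
have cn k : c ^+ k != 0 by rewrite expf_neq0.
rewrite (eq_bigr (fun j : 'I_((size q^`()).-1 + (size q).-1) => c ^+ j)); last first.
  by move=> j _; rewrite mxE.
rewrite [X in _ = X * _](eq_bigr (fun i : 'I_((size q^`()).-1 + (size q).-1) =>
    match fintype.split i with inl k => c ^+ (n + k) | inr k => c ^+ (n.-1 + k) end)); last first.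
  by move=> j _; rewrite mxE.
move=> E.
have R'0 : R' != 0.
  apply/eqP => R'0; move/eqP: E; rewrite R'0 mul0r eq_sym mulf_eq0 (negbTE r0) orbF.
  by rewrite prodf_seq_eq0 => /hasP[i _ /=]; case: (fintype.split i) => k; rewrite (negbTE (cn _)).
split=> //; rewrite vD; move/(congr1 val): E.
have P1 : \prod_(j < (size q^`()).-1 + (size q).-1) c ^+ j != 0 by apply/prodf_neq0 => i _.
have P2 : \prod_(i < (size q^`()).-1 + (size q).-1)
    (match fintype.split i with inl k => c ^+ (n + k) | inr k => c ^+ (n.-1 + k) end) != 0.
  by apply/prodf_neq0 => i _; case: (fintype.split i).
rewrite (val_mul HF R'0 P1) (val_mul HF P2 r0).
rewrite !(val_prod HF) //; last by move=> i; case: (fintype.split i).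
have h1 : 0 <= \sum_(i < (size q^`()).-1 + (size q).-1) val (c ^+ i).
  by apply: sumr_ge0 => i _; rewrite (val_exp HF) // mulrn_wge0.
have h2 : \sum_(i < (size q^`()).-1 + (size q).-1)
    val (match fintype.split i with inl k => c ^+ (n + k) | inr k => c ^+ (n.-1 + k) end)
    <= val c *+ (6 * n * n)%N.
  apply: (@le_trans _ _ (\sum_(i < (size q^`()).-1 + (size q).-1) val c *+ (3 * n)%N)).
    apply: ler_sum => i _.
    have sq' : (size q^`() <= n)%N by have := lt_size_deriv (p := q); rewrite -size_poly_eq0 sq => /(_ isT).
    have hi : (i < 2 * n)%N by apply: (leq_trans (ltn_ord i)); rewrite sq; lia.
    case: splitP => k hk; rewrite (val_exp HF) //; apply: ler_wpMn2l => //; lia.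
  rewrite sumr_const card_ord -mulrnA; apply: ler_wpMn2l => //.
  have sq' : (size q^`() <= n)%N by have := lt_size_deriv (p := q); rewrite -size_poly_eq0 sq => /(_ isT).
  rewrite sq; nia.
have aux (a b e d f : int) : a + b = e + d -> 0 <= b -> e <= f -> a <= d + f by lia.
by move=> E; exact: aux E h1 h2.
Qed.


Lemma horner_mx_mge n (A : 'M[F]_n.+1) k p : mge 0 A -> pge k p -> mge k (horner_mx A p).
Proof.
move=> hA hp; rewrite -[p]coefK poly_def linear_sum /=.
move=> i j; rewrite summxE; apply: (filt_sum (vge_filt HF)) => l _.
rewrite linearZ /= rmorphXn /= horner_mx_X.
have hX : mge 0 (A ^+ l).
  elim: (nat_of_ord l) => [|h IH]; first by rewrite expr0; exact: mge1.
  by rewrite exprS -[0]addr0; exact: mgeM.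
by rewrite -[k]addr0; apply: (mgeZ HF).
Qed.

Lemma congr1_unit n (A : 'M[F]_n) : mge 1 (A - 1%:M) ->
  [/\ A \in unitmx, val (\det A) = 0, mge 0 A & mge 0 (invmx A)].
Proof.
move=> h.
have hA : mge 0 A by rewrite -(subrK 1%:M A); apply: (mgeD HF); [exact: mgeW h|exact: mge1].
have : vge 1 (\det A - \det (1%:M : 'M[F]_n)).
  apply: (filt_det_sub (vge_filt HF)) => // [|i j]; first exact: mge1.
  by have := h i j; rewrite !mxE.
rewrite det1 => /(val_unit_sub HF) [d0 v0].
split=> //; first by rewrite unitmxE unitfE.
by have := mge_inv HF hA d0; rewrite v0 mul0rn subr0.
Qed.

(* Evaluating the Bezout identity at A gives e = v(A) f'(A) g(A) + O(kappa). *)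
Lemma horner_mx_inv_bound n (A : 'M[F]_n.+1) (f g chi eps u v : {poly F}) e M kappa :
  mge 0 A -> horner_mx A f = 0 -> pge 0 f -> pge 0 g -> pge 0 u -> pge 0 v ->
  pge kappa eps -> chi = f * g + eps -> e%:P = u * chi + v * chi^`() ->
  e != 0 -> val e <= M -> M < kappa ->
  horner_mx A g \in unitmx /\ mge (- M) (invmx (horner_mx A g)).
Proof.
move=> hA fA hf hg hu hv heps -> + e0 eM Mk.
pose H := horner_mx A.
move/(congr1 H); rewrite /H horner_mx_C !(rmorphD, rmorphM, derivD, derivM) /= fA -/H.
rewrite !mul0r add0r addr0 mulrDr.
set eta := H u * H eps + H v * H eps^`() => E.
pose V := H v * H f^`().
(* The error [eta] has level [kappa], which exceeds [M] and hence [val e], so [B] is congruent to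
   the identity and invertible over the integers. *)
pose B := 1%:M - e^-1 *: eta.
have heta : mge kappa eta.
  apply: (mgeD HF); rewrite -[kappa]add0r; apply: (mgeM HF); apply: horner_mx_mge => //.
  exact: pge_deriv.
have hV : mge 0 V.
  by rewrite -[0]addr0; apply: (mgeM HF); apply: horner_mx_mge => //; exact: pge_deriv.
have VB : V *m H g = e *: B.
  rewrite /B scalerBr scalerA mulfV // scale1r scalemx1 E /eta /V.
  by rewrite addrCA addrK mulrA.
have [uB _ _ hB] : [/\ B \in unitmx, val (\det B) = 0, mge 0 B & mge 0 (invmx B)].
  apply: congr1_unit; rewrite /B addrAC subrr sub0r; apply: (mgeN HF).
  apply: (@mgeW _ _ HF _ _ _ (- val e + kappa)); first by lia.
  by apply: (mgeZ HF) => //; exact: vgeV.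
have inv : (e^-1 *: (invmx B *m V)) *m H g = 1%:M.
  by rewrite -scalemxAl -mulmxA VB -scalemxAr mulVmx // scalerA mulVf // scale1r.
have [_ ug] := mulmx1_unit inv; split => //.
have -> : invmx (H g) = e^-1 *: (invmx B *m V) by rewrite -[LHS]mul1mx -inv mulmxK.
apply: (@mgeW _ _ HF _ _ _ (- val e + (0 + 0))); first by lia.
by apply: (mgeZ HF); [exact: vgeV|exact: mgeM].
Qed.


Lemma horner_mx_intertwine p q (T : 'M[F]_p.+1) (D : 'M[F]_q.+1) (V : 'M[F]_(p.+1, q.+1)) f :
  T *m V = V *m D -> horner_mx T f *m V = V *m horner_mx D f.
Proof.
move=> h; elim/poly_ind: f => [|f c IH]; first by rewrite !rmorph0 mul0mx mulmx0.
rewrite !rmorphD !rmorphM /= !horner_mx_X !horner_mx_C mulmxDl mulmxDr.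
by rewrite -mulmxA h !mulmxA IH mul_scalar_mx mul_mx_scalar.
Qed.

Section Sylvester.
Variables (r s : nat) (A : 'M[F]_r.+1) (D : 'M[F]_s.+1).
Let S := horner_mx D (char_poly A).

(* The corner q of char_poly A evaluated at (A E; 0 D) solves, up to S, the equation
   X D - A X = E, because that polynomial in (A E; 0 D) commutes with (A E; 0 D). *)
Lemma horner_ublock (E : 'M[F]_(r.+1, s.+1)) :
  exists q, (horner_mx (block_mx A E 0 D : 'M[F]_((r + s.+1).+1)) (char_poly A)
    : 'M[F]_(r.+1 + s.+1)) = block_mx 0 q 0 S.
Proof.
pose T : 'M[F]_(r.+1 + s.+1) := block_mx A E 0 D.
set Z : 'M[F]_(r.+1 + s.+1) := horner_mx _ _.
have key1 d (V : 'M[F]_(r.+1 + s.+1, d.+1)) N : T *m V = V *m N ->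
  Z *m V = V *m horner_mx N (char_poly A) := @horner_mx_intertwine (r + s.+1) d T N V _.
have key2 d (V : 'M[F]_(d.+1, r.+1 + s.+1)) N : N *m V = V *m T ->
  horner_mx N (char_poly A) *m V = V *m Z := @horner_mx_intertwine d (r + s.+1) N T V _.
have h1 : Z *m col_mx 1%:M 0 = 0.
  rewrite (key1 _ (col_mx 1%:M 0) A) ?Cayley_Hamilton ?mulmx0 //.
  by rewrite /T mul_block_col mul_col_mx !(mulmx0, mul0mx, mulmx1, mul1mx, addr0).
have h2 : row_mx 0 S = row_mx 0 1%:M *m Z.
  rewrite -(key2 _ (row_mx 0 1%:M) D) ?mul_mx_row ?mulmx0 ?mulmx1 //.
  by rewrite /T mul_row_block !(mulmx0, mul0mx, mulmx1, mul1mx, add0r).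
exists (ursubmx Z); rewrite -[LHS]submxK.
move: h1 h2; rewrite -{1 2}[Z]submxK mul_block_col mul_row_block !(mulmx0, mul0mx, mulmx1, mul1mx, addr0, add0r).
rewrite -[X in _ = X -> _]col_mx0 => /eq_col_mx [-> ->] /eq_row_mx [_ <-].
by [].
Qed.

Lemma sylv_solve : S \in unitmx -> forall E, exists X, X *m D - A *m X = E.
Proof.
move=> uS E; have [q hq] := horner_ublock E.
set T : 'M[F]_(r.+1 + s.+1) := block_mx A E 0 D in hq.
have : T *m block_mx 0 q 0 S = block_mx 0 q 0 S *m T.
  rewrite -hq; apply: (@comm_mx_horner F (r + s.+1) T T); exact: comm_mx_refl.
rewrite /T !mulmx_block !(mulmx0, mul0mx, mulmx1, mul1mx, addr0, add0r).
move=> /eq_block_mx [_ hE _ hD].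
exists (q *m invmx S).
have hD' : invmx S *m D = D *m invmx S.
  by rewrite -[RHS]mul1mx -(mulVmx uS) -!mulmxA; congr (_ *m _); rewrite mulmxA -hD -mulmxA mulmxV // mulmx1.
by rewrite -mulmxA hD' !mulmxA -mulmxBl -hE addrC addKr mulmxK.
Qed.

(** After division by a scalar of valuation [k] the right hand side is integral, hence so is the
    corner $q$ of the polynomial evaluated at an integral matrix. The block matrix acts as $D$ on
    the columns of $(X';1)$, and evaluating [char_poly A] there gives $q=X'S$; the only loss is that
    of $S^{-1}$. *)
Lemma sylv_bound M k X : S \in unitmx -> mge (- M) (invmx S) ->
  mge 0 A -> mge 0 D -> mge k (X *m D - A *m X) -> mge (k - M) X.
Proof.
move=> uS hS hA hD hE; have [c [c0 vc]] := exists_val HF k.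
pose X' := c^-1 *: X; pose E' := X' *m D - A *m X'.
have hE' : mge 0 E'.
  rewrite /E' /X' -scalemxAl -scalemxAr -scalerBr -[0](addNr k).
  by apply: (mgeZ HF) => //; rewrite -vc; exact: vgeV.
have [q hq] := horner_ublock E'.
have hqi : mge 0 q.
  have : mge 0 (block_mx 0 q 0 S : 'M[F]_(r.+1 + s.+1)).
    have hT : mge 0 (block_mx A E' 0 D).
      by apply/mge_block; split=> //; exact: mge0.
    by rewrite -hq; apply: (@horner_mx_mge (r + s.+1)) hT (char_poly_pge hA).
  by move/mge_block => [].
have : (block_mx 0 q 0 S : 'M[F]_(r.+1 + s.+1)) *m col_mx X' 1%:M = col_mx X' 1%:M *m S.
  have key (V : 'M[F]_(r.+1 + s.+1, s.+1)) : block_mx A E' 0 D *m V = V *m D ->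
    (block_mx 0 q 0 S : 'M[F]_(r.+1 + s.+1)) *m V = V *m S.
    by rewrite -hq; exact: (@horner_mx_intertwine (r + s.+1) s (block_mx A E' 0 D) D V).
  apply: key; rewrite mul_block_col mul_col_mx /E'.
  by rewrite !(mul0mx, mulmx1, mul1mx, add0r) addrC subrK.
rewrite mul_block_col mul_col_mx !(mul0mx, mulmx1, mul1mx, add0r) => /eq_col_mx [qE _].
have -> : X = c *: (q *m invmx S) by rewrite qE mulmxK // /X' scalerA mulfV // scale1r.
apply: (mgeZ HF); first by rewrite -vc; exact: vge_self.
by rewrite -[- M]add0r; apply: (mgeM HF).
Qed.

End Sylvester.

Lemma mge_complete p q (W : nat -> 'M[F]_(p, q)) (k0 : int) :
  (forall j, mge (k0 + j%:Z) (W j.+1 - W j)) ->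
  exists L, forall j, mge (k0 + j%:Z) (L - W j).
Proof.
move=> hW.
have cau j d : mge (k0 + j%:Z) (W (j + d)%N - W j).
  elim: d => [|d IH]; first by rewrite addn0 subrr; exact: mge0.
  have -> : W (j + d.+1)%N - W j = (W (j + d).+1 - W (j + d)%N) + (W (j + d)%N - W j).
    by rewrite addnS addrA subrK.
  apply: (mgeD HF) => //.
  by apply: (mgeW HF _ (hW _)); lia.
have lim a b : exists l, forall j, vge (k0 + j%:Z) (l - W j a b).
  case: HF => _ _ _ _ /(_ (fun j => W j a b)) [].
    move=> k; exists `|k - k0|%N => x y hx hy; apply/vcloseE.
    have e z : (`|k - k0| <= z)%N -> vge k (W z a b - W `|k - k0|%N a b).
      move=> hz; have := cau `|k - k0|%N (z - `|k - k0|)%N a b; rewrite subnKC // !mxE.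
      by apply: (vgeW HF); lia.
    have -> : W x a b - W y a b = (W x a b - W `|k - k0|%N a b) - (W y a b - W `|k - k0|%N a b).
      by rewrite opprB addrA subrK.
    by apply: (vgeB HF); exact: e.
  move=> l hl; exists l => j; have [N hN] := hl (k0 + j%:Z).
  have /vcloseE h1 := hN (maxn N j) (leq_maxl _ _).
  have := cau j (maxn N j - j)%N a b; rewrite subnKC ?leq_maxr // !mxE => h2.
  rewrite -(subrK (W (maxn N j) a b) l) -addrA; apply: (vgeD HF) => //.
  by rewrite -opprB; exact: (vgeN HF).
have [L hL] := choice (fun ab : 'I_p * 'I_q => lim ab.1 ab.2).
exists (\matrix_(a, b) L (a, b)) => j a b.
by rewrite !mxE; exact: (hL (a, b) j).
Qed.


(** Dropping [C] changes the characteristic matrix by entries of level [k] only, and the determinant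
    is a polynomial with integer coefficients in the entries. *)
Lemma char_poly_block_sub r s (A : 'M[F]_r) (B : 'M[F]_(r, s)) (C : 'M[F]_(s, r)) (D : 'M[F]_s) k :
  0 <= k -> mge 0 (block_mx A B C D) -> mge k C ->
  pge k (char_poly (block_mx A B C D) - char_poly A * char_poly D).
Proof.
move=> k0 hY hC.
have mapE (C' : 'M[F]_(s, r)) : char_poly_mx (block_mx A B C' D) =
    block_mx (char_poly_mx A) (- map_mx polyC B) (- map_mx polyC C') (char_poly_mx D).
  rewrite /char_poly_mx map_block_mx scalar_mx_block opp_block_mx add_block_mx.
  by rewrite !add0r.
have -> : char_poly A * char_poly D = char_poly (block_mx A B 0 D).
  by rewrite /char_poly mapE map_mx0 oppr0 det_ublock.
have hint (Y : 'M[F]_(r + s)) : mge 0 Y -> forall i j, pge 0 (char_poly_mx Y i j).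
  move=> h i j; rewrite !mxE; apply: (filtB (pge_filt HF)); last exact: pgeC.
  by case: eqP => _; rewrite ?mulr1n ?mulr0n; [exact: pgeX|exact: (filt0 (pge_filt HF))].
apply: (filt_det_sub (pge_filt HF)) => //; first exact: hint.
  apply: hint; move/mge_block: hY => [hA hB _ hD].
  by apply/mge_block; split => //; exact: mge0.
move=> i j; rewrite !mapE -(fintype.splitK i) -(fintype.splitK j).
case: (fintype.split i) => i'; case: (fintype.split j) => j' /=;
  rewrite !(block_mxEul, block_mxEur, block_mxEdl, block_mxEdr) ?subrr;
  try exact: (filt0 (pge_filt HF)).
rewrite !mxE polyC0 oppr0 subr0; apply: (filtN (pge_filt HF)); exact: pgeC.
Qed.

(* The conclusion says that conjugation by (1 0; W 1) makes (A B; C D) block upper triangular. *)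
Lemma riccati r s (A : 'M[F]_r.+1) (B : 'M[F]_(r.+1, s.+1)) (C : 'M[F]_(s.+1, r.+1)) (D : 'M[F]_s.+1)
    (u v : {poly F}) e M k :
  let chi := char_poly (block_mx A B C D) in
  mge 0 (block_mx A B C D) -> pge 0 u -> pge 0 v -> e%:P = u * chi + v * chi^`() ->
  e != 0 -> val e <= M -> 0 <= M -> M *+ 2 < k -> mge k C ->
  exists W, mge (k - M) W /\ C + W *m A - (D + W *m B) *m W = 0.
Proof.
move=> chi hY hu hv he e0 eM M0 Mk hC.
have [hA hB _ hD] : [/\ mge 0 A, mge 0 B, mge 0 C & mge 0 D] by exact/mge_block.
have k0 : 0 <= k by lia.
have heps := char_poly_block_sub k0 hY hC.
have [uS hS] : horner_mx A (char_poly D) \in unitmx /\ mge (- M) (invmx (horner_mx A (char_poly D))).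
  apply: (@horner_mx_inv_bound _ A (char_poly A) (char_poly D) chi _ u v e M k) heps _ he _ _ _ => //.
  - exact: Cayley_Hamilton.
  - exact: char_poly_pge.
  - exact: char_poly_pge.
  - by rewrite addrC subrK.
  - by lia.
have slv W : exists W', W' *m A - D *m W' = W *m B *m W - C by exact: sylv_solve.
have bnd l X : mge l (X *m A - D *m X) -> mge (l - M) X by exact: sylv_bound.
have [nxt hnxt] := choice slv.
(* Picard iteration: each step freezes the quadratic term and solves a linear equation. Solving
   loses [M], while the quadratic term gains [k - M] on a difference of iterates, so [k > 2M] makes
   the map contract by at least one level per step. *)
pose W j := iter j nxt (0 : 'M[F]_(s.+1, r.+1)).
have hW j : mge (k - M) (W j).
  elim: j => [|j IH]; first exact: mge0.
  apply: bnd; rewrite hnxt; apply: (mgeB HF) => //.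
  by apply: (@mgeW _ _ HF _ _ _ (k - M + 0 + (k - M))); [lia|exact: mgeM3].
have quad l (X Y : 'M[F]_(s.+1, r.+1)) : mge (k - M) X -> mge (k - M) Y -> mge l (X - Y) ->
    mge (l + (k - M)) (X *m B *m X - Y *m B *m Y).
  move=> hX hY' hXY.
  have -> : X *m B *m X - Y *m B *m Y = X *m B *m (X - Y) + (X - Y) *m B *m Y.
    by rewrite mulmxBr !mulmxBl addrA subrK.
  apply: (mgeD HF).
    by apply: (@mgeW _ _ HF _ _ _ (k - M + 0 + l)); [lia|exact: mgeM3].
  by apply: (@mgeW _ _ HF _ _ _ (l + 0 + (k - M))); [lia|exact: mgeM3].
have hdiff j : mge (k - M + j%:Z) (W j.+1 - W j).
  elim: j => [|j IH]; first by rewrite addr0 [W 0%N]/= subr0; exact: hW.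
  apply: (@mgeW _ _ HF _ _ _ (k - M + j%:Z + (k - M) - M)); first by lia.
  apply: bnd.
  have -> : (W j.+2 - W j.+1) *m A - D *m (W j.+2 - W j.+1) =
     W j.+1 *m B *m W j.+1 - W j *m B *m W j.
    have h1 : W j.+1 *m A - D *m W j.+1 = W j *m B *m W j - C by exact: hnxt.
    have h2 : W j.+2 *m A - D *m W j.+2 = W j.+1 *m B *m W j.+1 - C by exact: hnxt.
    rewrite mulmxBl mulmxBr subr_ACA h1 h2 subr_ACA subrr subr0 //.
  by apply: quad => //.
have [L hL] := mge_complete hdiff.
have hLk : mge (k - M) L.
  by rewrite -(subrK (W 0%N) L); apply: (mgeD HF); [have := hL 0%N; rewrite addr0|exact: hW].
exists L; split => //; apply: mge_eq0 => l.
pose j := `|l|%N.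
have step : (W j.+1 *m A - D *m W j.+1) - (W j *m B *m W j - C) = 0.
  by rewrite -[W j.+1]/(nxt (W j)) hnxt subrr.
have -> : C + L *m A - (D + L *m B) *m L =
   ((L - W j.+1) *m A - D *m (L - W j.+1)) - (L *m B *m L - W j *m B *m W j)
   + ((W j.+1 *m A - D *m W j.+1) - (W j *m B *m W j - C)).
  rewrite mulmxBl mulmxBr mulmxDl.
  move: (L *m A) (W j.+1 *m A) (D *m L) (D *m W j.+1) (L *m B *m L) (W j *m B *m W j).
  move=> x1 x2 x3 x4 x5 x6; apply/matrixP => a b; rewrite !mxE; ring.
rewrite step addr0; apply: (mgeB HF).
  apply: (mgeB HF).
    by apply: (@mgeW _ _ HF _ _ _ (k - M + j.+1%:Z + 0)); [lia|exact: mgeM].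
  by apply: (@mgeW _ _ HF _ _ _ (0 + (k - M + j.+1%:Z))); [lia|exact: mgeM].
apply: (@mgeW _ _ HF _ _ _ ((k - M + j%:Z) + (k - M))); first by lia.
exact: quad.
Qed.

End Hensel.

(** The group $\mathrm{GL}_n(O_F)$, with integrality of the inverse in place of the condition on the
    determinant in [GLO]; stability under products and inverses is then immediate, and [GLOE]
    identifies the two. *)
Definition GLint (F : fieldType) (val : F -> int) (n : nat) (k : 'M[F]_n) : Prop :=
  [/\ k \in unitmx, mge val 0 k & mge val 0 (invmx k)].

(** * The maximal compact subgroup and the Cartan decomposition *)

Section Integral.
Variables (F : fieldType) (val : F -> int).
Hypothesis HF : is_local_field val.
Local Notation vge := (vge val).
Local Notation mge := (mge val).
Local Notation GLint := (GLint val).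

Lemma invmxM n (A B : 'M[F]_n) : A \in unitmx -> B \in unitmx ->
  invmx (A *m B) = invmx B *m invmx A.
Proof.
move=> uA uB; have uAB : A *m B \in unitmx by rewrite unitmx_mul uA.
by rewrite -[RHS](mulmxK uAB) mulmxA mulmxKV // mulVmx // mul1mx.
Qed.

Lemma invmx_eq n (A B : 'M[F]_n) : A *m B = 1%:M -> invmx A = B.
Proof.
by move=> AB; have [uA _] := mulmx1_unit AB; rewrite -[LHS]mulmx1 -AB mulmxA mulVmx // mul1mx.
Qed.

Lemma det_neq0 n (A : 'M[F]_n) : A \in unitmx -> \det A != 0.
Proof. by rewrite unitmxE unitfE. Qed.

Lemma mgeM0 p q r k (A : 'M[F]_(p, q)) (B : 'M[F]_(q, r)) : mge 0 A -> mge k B -> mge k (A *m B).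
Proof. by move=> hA hB; rewrite -[k]add0r; exact: mgeM. Qed.
Lemma mge0M p q r k (A : 'M[F]_(p, q)) (B : 'M[F]_(q, r)) : mge k A -> mge 0 B -> mge k (A *m B).
Proof. by move=> hA hB; rewrite -[k]addr0; exact: mgeM. Qed.

Lemma GLint1 n : GLint (1%:M : 'M[F]_n).
Proof. by split; rewrite ?unitmx1 ?invmx1 //; exact: mge1. Qed.

Lemma GLintM n (A B : 'M[F]_n) : GLint A -> GLint B -> GLint (A *m B).
Proof.
move=> [uA hA hA'] [uB hB hB']; split; first by rewrite unitmx_mul uA.
  exact: mgeM0.
by rewrite invmxM //; exact: mgeM0.
Qed.

Lemma GLintV n (A : 'M[F]_n) : GLint A -> GLint (invmx A).
Proof. by move=> [uA hA hA']; split; rewrite ?unitmx_inv ?invmxK. Qed.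

Lemma GLint_intro n (A B : 'M[F]_n) : A *m B = 1%:M -> mge 0 A -> mge 0 B -> GLint A.
Proof. by move=> AB hA hB; split; rewrite ?(invmx_eq AB) //; have [] := mulmx1_unit AB. Qed.

Lemma GLint_det n (A : 'M[F]_n) : GLint A -> val (\det A) = 0.
Proof.
move=> [uA hA hA']; have d0 := det_neq0 uA.
have d1 : \det (invmx A) != 0 by apply: det_neq0; rewrite unitmx_inv.
have := mge_val_det HF hA d0; have := mge_val_det HF hA' d1.
by rewrite det_inv (val_inv HF) // !mul0rn oppr_ge0 => h1 h2; apply/eqP; rewrite eq_le h1 h2.
Qed.

Lemma GLOE n (A : 'M[F]_n) : GLO val A <-> GLint A.
Proof.
split=> [[hA [d0 v0]]|hA]; last first.
  by have [uA h1 h2] := hA; split=> //; split; [exact: det_neq0|exact: GLint_det].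
have hA' : mge 0 A by move=> i j; exact: hA.
split=> //; first by rewrite unitmxE unitfE.
by have := mge_inv HF hA' d0; rewrite v0 mul0rn subr0.
Qed.

Lemma congr_GLint n t (A : 'M[F]_n) : 1 <= t -> mge t (A - 1%:M) -> GLint A.
Proof. by move=> t1 h; have [] := congr1_unit HF (mgeW HF t1 h). Qed.

Lemma congr_conj n t (g A : 'M[F]_n) : GLint g -> mge t (A - 1%:M) ->
  mge t (g *m A *m invmx g - 1%:M).
Proof.
move=> [ug hg hg'] hA.
have -> : g *m A *m invmx g - 1%:M = g *m (A - 1%:M) *m invmx g.
  by rewrite mulmxBr mulmx1 mulmxBl mulmxV.
by apply: mge0M => //; exact: mgeM0.
Qed.

Lemma congr_inv n t (A : 'M[F]_n) : 1 <= t -> mge t (A - 1%:M) -> mge t (invmx A - 1%:M).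
Proof.
move=> t1 h; have [uA hA hA'] := congr_GLint t1 h.
have -> : invmx A - 1%:M = - (invmx A *m (A - 1%:M)) by rewrite mulmxBr mulVmx // mulmx1 opprB.
by apply: (mgeN HF); exact: mgeM0.
Qed.

Lemma congr_mul n t (A B : 'M[F]_n) : 1 <= t -> mge t (A - 1%:M) -> mge t (B - 1%:M) ->
  mge t (A *m B - 1%:M).
Proof.
move=> t1 hA hB; have [_ hA0 _] := congr_GLint t1 hA.
have -> : A *m B - 1%:M = A *m (B - 1%:M) + (A - 1%:M) by rewrite mulmxBr mulmx1 addrA subrK.
by apply: (mgeD HF) => //; exact: mgeM0.
Qed.

Lemma ovG_le n (x : 'M[F]_n) i : ovG val x <= i <-> mge (- i) x /\ val (\det x) <= i.
Proof.
rewrite /ovG; split.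
  move=> h; split; last by apply: le_trans h; rewrite bigmax_ge_id.
  move=> a b; have [->|nz] := eqVneq (x a b) 0; first exact: vge0.
  right; rewrite lerNl; apply: le_trans h.
  exact: (@le_bigmax_cond _ _ _ _ (a, b) (fun ij => x ij.1 ij.2 != 0) (fun ij => - val (x ij.1 ij.2))).
move=> [h1 h2]; apply/bigmax_leP; split=> // -[a b] /= nz.
by rewrite lerNl; apply/(vge_val val _ nz).
Qed.

Lemma ovG_ge0 n (x : 'M[F]_n) : (0 < n)%N -> x \in unitmx -> 0 <= ovG val x.
Proof.
move=> n0 ux; rewrite leNgt; apply/negP => lt0.
have [h1 h2] : mge (- (-1)) x /\ val (\det x) <= -1 by apply/ovG_le; lia.
have := mge_val_det HF h1 (det_neq0 ux); rewrite opprK; lia.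
Qed.

Lemma mge_GLint n k (A g B : 'M[F]_n) : GLint A -> GLint B -> mge k (A *m g *m B) <-> mge k g.
Proof.
move=> [uA hA hA'] [uB hB hB']; split=> h; last by apply: mge0M => //; exact: mgeM0.
have -> : g = invmx A *m (A *m g *m B) *m invmx B by rewrite -mulmxA mulmxK // mulKmx.
by apply: mge0M => //; exact: mgeM0.
Qed.

Lemma val_det_GLint n (A g B : 'M[F]_n) : GLint A -> GLint B -> g \in unitmx ->
  val (\det (A *m g *m B)) = val (\det g).
Proof.
move=> hA hB ug; have [uA _ _] := hA; have [uB _ _] := hB.
rewrite !det_mulmx !(val_mul HF) ?mulf_neq0 ?det_neq0 //.
by rewrite (GLint_det hA) (GLint_det hB) add0r addr0.
Qed.

Lemma Dad_GLint n i (A g B : 'M[F]_n) : GLint A -> GLint B ->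
  Dad val i (A *m g *m B) <-> Dad val i g.
Proof.
have imp (A' g' B' : 'M[F]_n) : GLint A' -> GLint B' -> Dad val i g' -> Dad val i (A' *m g' *m B').
  move=> hA hB [ug [dg [z [z0 hz]]]]; have [uA _ _] := hA; have [uB _ _] := hB.
  split; first by rewrite !unitmx_mul uA ug.
  rewrite val_det_GLint //; split => //; exists z; split => //.
  move/ovG_le: hz => [h1 h2]; apply/ovG_le.
  rewrite scalemxAl scalemxAr; split; first exact/mge_GLint.
  by rewrite val_det_GLint // unitmxZ // unitfE.
move=> hA hB; split; last exact: imp.
have [uA _ _] := hA; have [uB _ _] := hB.
move/(imp _ _ _ (GLintV hA) (GLintV hB)).
by rewrite -[A *m g *m B]mulmxA mulKmx // mulmxK.
Qed.

Lemma GLint_perm n (s : {perm 'I_n}) : GLint (perm_mx s : 'M[F]_n).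
Proof.
have h (t : {perm 'I_n}) : mge 0 (perm_mx t : 'M[F]_n).
  by move=> i j; rewrite !mxE; case: eqP => _; [exact: vge1|exact: vge0].
by apply: (@GLint_intro _ _ (perm_mx s^-1)) => //; rewrite -perm_mxM mulgV perm_mx1.
Qed.

Lemma GLint_block_diag r s (A : 'M[F]_r) (D : 'M[F]_s) : GLint A -> GLint D ->
  GLint (block_mx A 0 0 D).
Proof.
move=> [uA hA hA'] [uD hD hD'].
apply: (@GLint_intro _ _ (block_mx (invmx A) 0 0 (invmx D))).
- by rewrite mulmx_block !(mulmx0, mul0mx, addr0, add0r) !mulmxV // -scalar_mx_block.
- by apply/mge_block; split=> //; exact: mge0.
- by apply/mge_block; split=> //; exact: mge0.
Qed.

Lemma GLint_upper r s (X : 'M[F]_(r, s)) : mge 0 X -> GLint (block_mx 1%:M X 0 1%:M).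
Proof.
move=> hX; apply: (@GLint_intro _ _ (block_mx 1%:M (- X) 0 1%:M)).
- by rewrite mulmx_block !(mulmx0, mul0mx, mulmx1, mul1mx, addr0, add0r) addNr -scalar_mx_block.
- by apply/mge_block; split=> //; try exact: mge1; exact: mge0.
- by apply/mge_block; split=> //; try exact: mge1; try exact: mge0; exact: mgeN.
Qed.

Lemma GLint_lower r s (X : 'M[F]_(s, r)) : mge 0 X -> GLint (block_mx 1%:M 0 X 1%:M).
Proof.
move=> hX; apply: (@GLint_intro _ _ (block_mx 1%:M 0 (- X) 1%:M)).
- by rewrite mulmx_block !(mulmx0, mul0mx, mulmx1, mul1mx, addr0, add0r) subrr -scalar_mx_block.
- by apply/mge_block; split=> //; try exact: mge1; exact: mge0.
- by apply/mge_block; split=> //; try exact: mge1; try exact: mge0; exact: mgeN.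
Qed.

(** Elimination with a pivot of least valuation: the row and column operations are then integral,
    and the Schur complement [h] again has all entries at least as deep as the pivot. The bound [c]
    is carried through the induction precisely to make the valuations on the diagonal increase. *)
Lemma cartan n (g : 'M[F]_n) c : g \in unitmx -> mge c g ->
  exists k1 k2 (d : 'rV[F]_n),
    [/\ GLint k1, GLint k2, forall i, d 0 i != 0 /\ c <= val (d 0 i),
        forall i j : 'I_n, (i <= j)%N -> val (d 0 i) <= val (d 0 j)
      & g = k1 *m diag_mx d *m k2].
Proof.
elim: n => [|n IH] in g c *.
  move=> _ _; exists 1%:M, 1%:M, 0; split; try exact: GLint1; try by case.
  by apply/matrixP; case.
move=> ug hg.
have [ij0 nz0] : exists ij : 'I_n.+1 * 'I_n.+1, g ij.1 ij.2 != 0.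
  apply/existsP; apply: contraTT ug; rewrite negb_exists => /forallP h.
  have -> : g = 0 by apply/matrixP => i j; have := h (i, j); rewrite negbK mxE => /eqP.
  by rewrite unitmxE det0 unitr0.
have [i1 nz1 min1] : exists2 i1 : 'I_n.+1 * 'I_n.+1, g i1.1 i1.2 != 0 &
    forall ij, g ij.1 ij.2 != 0 -> val (g i1.1 i1.2) <= val (g ij.1 ij.2).
  have [i1 h1 h2] := @Order.TotalTheory.arg_minP _ _ _ ij0 (fun ij => g ij.1 ij.2 != 0)
    (fun ij => val (g ij.1 ij.2)) nz0.
  by exists i1.
pose P1 : 'M[F]_(1 + n) := perm_mx (tperm 0 i1.1).
pose P2 : 'M[F]_(1 + n) := perm_mx (tperm 0 i1.2).
pose g' : 'M[F]_(1 + n) := P1 *m g *m P2.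
have gE : g = P1 *m g' *m P2.
  rewrite /g' !mulmxA -!mulmxA -perm_mxM tperm2 perm_mx1 mulmx1.
  by rewrite mulmxA -perm_mxM tperm2 perm_mx1 mul1mx.
have g'E i j : g' i j = g (tperm 0 i1.1 i) (tperm 0 i1.2 j).
  by rewrite /g' /P2 -row_permE -[tperm 0 i1.2]invgK -col_permE !mxE !tpermV.
pose alpha := g i1.1 i1.2.
have hg' : mge (val alpha) g'.
  move=> i j; rewrite g'E; case: (eqVneq (g (tperm 0 i1.1 i) (tperm 0 i1.2 j)) 0) => [->|nz]; first exact: vge0.
  by right; exact: (min1 (_, _)).
have g'00 : ulsubmx g' = alpha%:M.
  apply/matrixP => i j; have -> : ulsubmx g' i j = g' (lshift n i) (lshift n j) by rewrite !mxE.
  rewrite g'E mxE !ord1 eqxx mulr1n.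
  have -> : lshift n (0 : 'I_1) = 0 :> 'I_(1 + n) by apply: val_inj.
  by rewrite !tpermL.
pose b := ursubmx g'; pose c' := dlsubmx g'; pose h := drsubmx g' - alpha^-1 *: (c' *m b).
have [hb hc hd] : [/\ mge (val alpha) b, mge (val alpha) c' & mge (val alpha) (drsubmx g')].
  by move: hg'; rewrite -{1}[g']submxK => /mge_block [].
have va : vge (- val alpha) alpha^-1 by exact: vgeV.
have hh : mge (val alpha) h.
  apply: (mgeB HF) => //; rewrite -[val alpha](addKr (val alpha)).
  by apply: (mgeZ HF) => //; exact: mgeM.
have ib : mge 0 (alpha^-1 *: b) by rewrite -[0](addNr (val alpha)); apply: mgeZ.
have ic : mge 0 (alpha^-1 *: c') by rewrite -[0](addNr (val alpha)); apply: mgeZ.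
pose L : 'M[F]_(1 + n) := block_mx 1%:M 0 (alpha^-1 *: c') 1%:M.
pose U : 'M[F]_(1 + n) := block_mx 1%:M (alpha^-1 *: b) 0 1%:M.
have g'LU : g' = L *m block_mx alpha%:M 0 0 h *m U.
  rewrite /L /U !mulmx_block !(mulmx0, mul0mx, mulmx1, mul1mx, addr0, add0r).
  rewrite -[LHS]submxK g'00 -/b -/c'.
  rewrite mul_scalar_mx scalerA mulfV // scale1r mul_mx_scalar scalerA mulfV // scale1r.
  by rewrite -scalemxAr /h addrC subrK.
have uh : h \in unitmx.
  have : g' \in unitmx by rewrite /g' !unitmx_mul !unitmx_perm ug.
  rewrite g'LU !unitmx_mul => /andP[/andP[_ +] _].
  by rewrite unitmxE det_ublock unitrM => /andP[_]; rewrite -unitmxE.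
have [k1 [k2 [d [hk1 hk2 hd1 hd2 hE]]]] := IH _ _ uh hh.
have alpha_c : c <= val alpha by apply/(vge_val val _ nz1); exact: hg.
have hL : GLint L by exact: GLint_lower.
have hU : GLint U by exact: GLint_upper.
have hP1 : GLint P1 by exact: GLint_perm.
have hP2 : GLint P2 by exact: GLint_perm.
have hB1 : GLint (block_mx (1%:M : 'M[F]_1) 0 0 k1) by apply: GLint_block_diag => //; exact: GLint1.
have hB2 : GLint (block_mx (1%:M : 'M[F]_1) 0 0 k2) by apply: GLint_block_diag => //; exact: GLint1.
pose dd : 'rV[F]_(1 + n) := row_mx alpha%:M d.
have ddl (j : 'I_1) : dd 0 (lshift n j) = alpha by rewrite row_mxEl !mxE ord1 eqxx mulr1n.
have ddr (j : 'I_n) : dd 0 (rshift 1 j) = d 0 j by rewrite row_mxEr.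
have hd1' (i : 'I_(1 + n)) : dd 0 i != 0 /\ c <= val (dd 0 i).
  case: (split_ordP i) => j ->; first by rewrite ddl.
  by rewrite ddr; case: (hd1 j) => n0 le; split => //; exact: le_trans le.
have hd2' (i j : 'I_(1 + n)) : (i <= j)%N -> val (dd 0 i) <= val (dd 0 j).
  case: (split_ordP i) => i' ->; case: (split_ordP j) => j' ->; rewrite ?ddl ?ddr //.
  + by move=> _; case: (hd1 j').
  + by rewrite /= ord1.
  + by rewrite /= leq_add2l; exact: hd2.
have gfin : g = (P1 *m L *m block_mx 1%:M 0 0 k1) *m diag_mx dd *m (block_mx 1%:M 0 0 k2 *m U *m P2) :> 'M[F]_(1 + n).
  rewrite [LHS]gE g'LU hE /dd diag_mx_row.
  have -> : diag_mx (alpha%:M : 'M[F]_1) = alpha%:M.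
    by apply/matrixP => i j; rewrite !mxE !ord1 eqxx.
  rewrite -!mulmxA; congr (P1 *m (L *m _)); rewrite !mulmxA; congr (_ *m U *m P2).
  by rewrite !mulmx_block !(mulmx0, mul0mx, mulmx1, mul1mx, addr0, add0r).
exists (P1 *m L *m block_mx 1%:M 0 0 k1), (block_mx 1%:M 0 0 k2 *m U *m P2), dd.
split.
- exact: (@GLintM (1 + n) _ _ (@GLintM (1 + n) _ _ hP1 hL) hB1).
- exact: (@GLintM (1 + n) _ _ (@GLintM (1 + n) _ _ hB2 hU) hP2).
- exact: hd1'.
- exact: hd2'.
exact: gfin.
Qed.

Lemma val_detZ n z (y : 'M[F]_n) : z != 0 -> y \in unitmx ->
  val (\det (z *: y)) = val z *+ n + val (\det y).
Proof.
by move=> z0 uy; rewrite detZ (val_mul HF) ?expf_neq0 ?det_neq0 // (val_exp HF).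
Qed.

(** The determinant controls the central scalar: $n\,val(z)\le N-val(\det y)\le n(N+v)$. Dividing
    [z *: y] by [z] then costs at most $N+v$ beyond the $N$ already lost. *)
Lemma ovG_scale_bound n z (y : 'M[F]_n) N v : (0 < n)%N -> y \in unitmx -> z != 0 ->
  ovG val (z *: y) <= N -> (- v) *+ n <= val (\det y) -> 0 <= N ->
  mge (- (v + N *+ 2)) y.
Proof.
move=> n0 uy z0 /ovG_le[h1 h2] hd N0.
have hz : val z <= N + v.
  move: h2; rewrite val_detZ // => h2.
  have : val z *+ n <= (N + v) *+ n.
    rewrite mulrnDl; move: hd h2; rewrite mulNrn.
    have : N <= N *+ n by rewrite -[X in X <= _]mulr1n; apply: ler_wpMn2l.
    by lia.
  by rewrite ler_pMn2r.
rewrite -[y]scale1r -(mulVf z0) -scalerA.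
apply: (mgeW HF _ (mgeZ HF (vgeV HF z0) h1)); lia.
Qed.

(** The normalization of the determinant in [Dad] makes the scalar bounded from above and, through
    the adjugate, the inverse bounded as well. The bound depends on [i] and enters only the choice
    of levels, never [i0]. *)
Lemma Dad_bounded n i : (0 < n)%N -> exists b, 0 <= b /\
  forall g : 'M[F]_n, Dad val i g -> mge (- b) g /\ mge (- b) (invmx g).
Proof.
move=> n0; pose N := Num.max i 0; pose b0 := N *+ 2.
have N0 : 0 <= N by rewrite le_max lexx orbT.
have b00 : 0 <= b0 by rewrite mulrn_wge0.
exists (b0 *+ n + n%:Z); split; first by rewrite addr_ge0 // mulrn_wge0.
have b0n : b0 <= b0 *+ n by rewrite -[X in X <= _]mulr1n; apply: ler_wpMn2l.
move=> g [ug [/andP[d1 d2] [z [z0 hz]]]].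
have hg : mge (- b0) g.
  rewrite /b0 -[N *+ 2]add0r; apply: (@ovG_scale_bound _ z) => //; last by rewrite oppr0 mul0rn.
  by apply: le_trans hz _; rewrite le_max lexx.
split; first by apply: (mgeW HF _ hg); lia.
have := mge_inv HF hg (det_neq0 ug); apply: (mgeW HF).
have : b0 *+ n.-1 <= b0 *+ n by apply: ler_wpMn2l => //; lia.
rewrite mulNrn; move: d2; move: (val _) (b0 *+ n) (b0 *+ n.-1) => x y w; lia.
Qed.

(** Without such a gap consecutive valuations differ by less than [gamma]. Dividing [g] by a scalar
    whose valuation is that of the first diagonal entry then leaves an integral matrix whose
    determinant has valuation at most $n\cdot n\gamma$, so [g] lies in [Dad val i0]. *)
Lemma Dad_gap n (g : 'M[F]_n) k1 k2 (d : 'rV[F]_n) (gamma i0 : int) : (0 < n)%N ->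
  g = k1 *m diag_mx d *m k2 -> GLint k1 -> GLint k2 -> (forall i, d 0 i != 0) ->
  (forall i j : 'I_n, (i <= j)%N -> val (d 0 i) <= val (d 0 j)) ->
  0 <= val (\det g) < n%:Z -> 0 <= gamma -> gamma *+ (n * n) <= i0 -> ~ Dad val i0 g ->
  exists2 r, (0 < r < n)%N & forall i j : 'I_n, (i < r)%N -> (r <= j)%N ->
    gamma <= val (d 0 j) - val (d 0 i).
Proof.
move=> n0 gE hk1 hk2 d0 dmon dg g0 gi0; apply: contra_notP => nogap.
pose o := Ordinal n0.
have step k (hk : (k < n)%N) : val (d 0 (Ordinal hk)) - val (d 0 o) <= gamma *+ k.
  elim: k hk => [|k IH] hk.
    rewrite (_ : Ordinal hk = o) ?subrr ?mulr0n //; exact: val_inj.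
  have hk' : (k < n)%N by lia.
  have [] := pselect (gamma <= val (d 0 (Ordinal hk)) - val (d 0 (Ordinal hk'))); last first.
    by move/negP; rewrite -ltNge => h; have := IH hk'; rewrite mulrS; lia.
  move=> h; exfalso; apply: nogap; exists k.+1; first by lia.
  move=> i j hi hj; apply: le_trans h _.
  have h1 : val (d 0 (Ordinal hk)) <= val (d 0 j) by exact: dmon.
  have h2 : val (d 0 i) <= val (d 0 (Ordinal hk')) by exact: dmon.
  lia.
have [uk1 _ _] := hk1; have [uk2 _ _] := hk2.
have ud : diag_mx d \in unitmx.
  by rewrite unitmxE det_diag unitfE; apply/prodf_neq0 => i _.
have ug : g \in unitmx by rewrite gE !unitmx_mul uk1 ud.
have [z [z0 vz]] := exists_val HF (- val (d 0 o)).
have zdE : z *: diag_mx d = diag_mx (z *: d) by apply/matrixP => i j; rewrite !mxE mulrnAr.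
have dz i : val ((z *: d) 0 i) = val (d 0 i) - val (d 0 o).
  by rewrite mxE (val_mul HF) // vz addrC.
split=> //; split=> //; exists z; split=> //; apply/ovG_le.
have -> : z *: g = k1 *m diag_mx (z *: d) *m k2 by rewrite gE -zdE -scalemxAr -scalemxAl.
split.
  apply/mge_GLint => //; apply: (@mgeW _ _ HF _ _ _ 0).
    by rewrite oppr_le0; apply: le_trans gi0; rewrite mulrn_wge0.
  move=> i j; rewrite mxE; case: eqP => _; last exact: vge0.
  by right; rewrite mulr1n dz subr_ge0; apply: dmon.
rewrite val_det_GLint //; last by rewrite -zdE unitmxZ ?unitfE.
rewrite det_diag (val_prod HF); last by move=> i; rewrite mxE mulf_neq0.
apply: le_trans gi0; rewrite mulrnA -[X in _ <= _ *+ X]card_ord -sumr_const.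
apply: ler_sum => i _; rewrite dz; case: i => k hk; apply: le_trans (step k hk) _.
by apply: ler_wpMn2l => //; exact: ltnW.
Qed.

End Integral.

(** Lists of representatives replace measures: all averages over $K$, over shells and over balls of
    $U$ are sums over such lists, for cosets of a congruence subgroup that have equal volume. *)
Definition transv_seq (T : eqType) (S : set T) (e : T -> T -> Prop) (s : seq T) : Prop :=
  [/\ uniq s, forall x, x \in s -> S x, forall x y, x \in s -> y \in s -> e x y -> x = y
    & forall x, S x -> exists2 y, y \in s & e x y].

(** * Finite transversals *)

Section Transversal.
Variables (T : eqType) (e : T -> T -> Prop).
Hypothesis e_refl : forall x, e x x.
Hypothesis e_sym : forall x y, e x y -> e y x.
Hypothesis e_trans : forall x y z, e x y -> e y z -> e x z.

(** [s0] is a finite net whose points need not lie in [S]. Points near the same [r] are equivalent,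
    so each [r] contributes at most one class; that class is removed from [S] before the next [r] is
    treated. *)
Lemma transversal_exists (P : T -> T -> Prop) (s0 : seq T) (S : set T) :
  (forall x y r, P x r -> P y r -> e x y) ->
  (forall x, S x -> exists2 r, r \in s0 & P x r) -> exists s, transv_seq S e s.
Proof.
move=> hP; elim: s0 S => [|r s0 IH] S hS.
  by exists [::]; split=> // x /hS [].
have [[x0 [Sx0 Px0]]|none] := pselect (exists x0, S x0 /\ P x0 r); last first.
  apply: IH => x Sx; have [r' + Pr'] := hS x Sx.
  rewrite inE => /orP[/eqP rr|h]; last by exists r'.
  by exfalso; apply: none; exists x; split=> //; rewrite -rr.
have [x [Sx nx]|s [us sS se sc]] := IH (fun x => S x /\ ~ e x x0).
  have [r' + Pr'] := hS x Sx; rewrite inE => /orP[/eqP rr|h]; last by exists r'.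
  by exfalso; apply: nx; apply: (hP _ _ r) => //; rewrite -rr.
exists (x0 :: s); split.
- rewrite /= us andbT; apply/negP => /sS [_]; apply; exact: e_refl.
- by move=> x; rewrite inE => /orP[/eqP ->//|/sS []].
- move=> x y; rewrite !inE => /orP[/eqP ->|xs] /orP[/eqP ->|ys] exy //.
  + by have [_ []] := sS _ ys; exact: e_sym.
  + by have [_ []] := sS _ xs.
  + exact: se.
- move=> x Sx; have [h|h] := pselect (e x x0); first by exists x0; rewrite ?mem_head.
  by have [y ys exy] := sc x (conj Sx h); exists y; rewrite ?inE ?ys ?orbT.
Qed.

Lemma transversal_sum (V : zmodType) (S : set T) (s s' : seq T) (phi : T -> V) :
  transv_seq S e s -> transv_seq S e s' ->
  (forall x y, S x -> S y -> e x y -> phi x = phi y) ->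
  \sum_(x <- s) phi x = \sum_(x <- s') phi x.
Proof.
move=> [us sS se sc] [us' sS' se' sc'] hphi.
have [rho hrho] : exists rho : T -> T, forall x, x \in s -> rho x \in s' /\ e x (rho x).
  have h x : exists y, x \in s -> y \in s' /\ e x y.
    have [xs|_] := boolP (x \in s); last by exists x.
    by have [y ys exy] := sc' x (sS x xs); exists y.
  by have [rho hr] := choice h; exists rho.
have pm : perm_eq (map rho s) s'.
  apply: uniq_perm => //.
    rewrite map_inj_in_uniq // => x y xs ys exy; apply: se => //.
    have [_ h1] := hrho x xs; have [_ h2] := hrho y ys.
    by apply: e_trans h1 _; rewrite exy; exact: e_sym.
  move=> y; apply/idP/idP => [/mapP[x xs ->]|ys]; first by case: (hrho x xs).
  have [x xs exy] := sc y (sS' y ys); apply/mapP; exists x => //.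
  have [h1 h2] := hrho x xs; apply: se' => //; exact: e_trans h2.
rewrite -(perm_big _ pm) big_map /= !big_seq; apply: eq_bigr => x xs.
have [h1 h2] := hrho x xs; apply: hphi => //; [exact: sS|exact: sS'].
Qed.

(** Change of variables: [theta] permutes the classes in [S], so it sends a list of representatives
    to another one. *)
Lemma transversal_reindex (V : zmodType) (S : set T) (s : seq T) (theta : T -> T) (phi : T -> V) :
  transv_seq S e s -> (forall x, S x -> S (theta x)) ->
  (forall x y, S x -> S y -> e x y <-> e (theta x) (theta y)) ->
  (forall y, S y -> exists2 x, S x & e y (theta x)) ->
  (forall x y, S x -> S y -> e x y -> phi x = phi y) ->
  \sum_(x <- s) phi (theta x) = \sum_(x <- s) phi x.
Proof.
move=> tr hS he hsurj hphi; rewrite -(big_map theta predT).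
have [us sS se sc] := tr.
apply: (transversal_sum (S := S)) => //; split.
- rewrite map_inj_in_uniq // => x y xs ys exy; apply: se => //.
  by apply/(he x y (sS _ xs) (sS _ ys)); rewrite exy; exact: e_refl.
- by move=> _ /mapP[x /sS xs ->]; exact: hS.
- move=> _ _ /mapP[x xs ->] /mapP[y ys ->] h; congr theta; apply: se => //.
  by apply/he => //; exact: sS.
- move=> y /hsurj [x Sx exy]; have [x' xs' exx'] := sc x Sx.
  exists (theta x'); first exact: map_f.
  by apply: e_trans exy _; apply: (he x x' Sx (sS _ xs')).1.
Qed.

Lemma transversal_cat (S S' : set T) (s s' : seq T) :
  (forall x y, S x -> S' y -> ~ e x y) ->
  transv_seq S e s -> transv_seq S' e s' -> transv_seq (S `|` S') e (s ++ s').
Proof.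
move=> dis [us sS se sc] [us' sS' se' sc']; split.
- rewrite cat_uniq us us' andbT /=; apply/hasPn => x xs'; apply/negP => xs.
  exact: (dis _ _ (sS _ xs) (sS' _ xs') (e_refl x)).
- by move=> x; rewrite mem_cat => /orP[/sS|/sS']; [left|right].
- move=> x y; rewrite !mem_cat => /orP[xs|xs] /orP[ys|ys] exy; [exact: se| | |exact: se'].
    by case: (dis _ _ (sS _ xs) (sS' _ ys) exy).
  by case: (dis _ _ (sS _ ys) (sS' _ xs) (e_sym exy)).
- move=> x [/sc|/sc'] [y ys exy]; exists y => //; by rewrite mem_cat ys ?orbT.
Qed.

End Transversal.

(** * Total boundedness of balls *)

Section TotallyBounded.
Variables (F : fieldType) (val : F -> int).
Hypothesis HF : is_local_field val.
Local Notation vge := (vge val).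
Local Notation mge := (mge val).

(** One digit at a time: finiteness of the residue field refines a net of level $M+d$ to one of
    level $M+d+1$. *)
Lemma vge_totally_bounded M k :
  exists s : seq F, forall a, vge M a -> exists2 r, r \in s & vge k (a - r).
Proof.
have [kM|Mk] := leP k M.
  by exists [:: 0] => a ha; exists 0; rewrite ?mem_head // subr0; exact: vgeW ha.
have -> : k = M + `|k - M|%N%:Z by lia.
move: (`|k - M|%N) => d; elim: d => [|d [s IH]].
  by exists [:: 0] => a ha; exists 0; rewrite ?mem_head // !subr0.
have [_ _ _ [s0 [_ hs0]] _] := HF.
have [c [c0 vc]] := exists_val HF (M + d%:Z).
exists [seq r + c * q | r <- s, q <- s0] => a /IH [r rs ha].
have [q qs] : exists2 q, q \in s0 & vclose val 1 (c^-1 * (a - r)) q.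
  have h0 : vge 0 (c^-1 * (a - r)).
    by rewrite -(addNr (val c)); apply: (vgeM HF); [exact: vgeV|rewrite vc].
  exact: hs0.
move/vcloseE => hq; exists (r + c * q); first exact: allpairs_f.
have -> : a - (r + c * q) = c * (c^-1 * (a - r) - q) by rewrite mulrBr mulrA mulfV // mul1r opprD addrA.
have -> : M + d.+1%:Z = val c + 1 by rewrite vc; lia.
by apply: (vgeM HF) => //; exact: vge_self.
Qed.

Lemma mge_totally_bounded p q M k :
  exists s : seq 'M[F]_(p, q), forall A, mge M A -> exists2 B, B \in s & mge k (A - B).
Proof.
have [s hs] := vge_totally_bounded M k.
exists [seq (\matrix_(i, j) ssval (f (i, j))) | f : {ffun 'I_p * 'I_q -> seq_sub s}] => A hA.
have h (ij : 'I_p * 'I_q) : exists r : seq_sub s, vge k (A ij.1 ij.2 - ssval r).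
  by have [r rs hr] := hs _ (hA ij.1 ij.2); exists (SeqSub rs).
have [f hf] := choice h.
exists (\matrix_(i, j) ssval (f (i, j))).
  apply/mapP; exists (finfun f); rewrite ?mem_enum //.
  by apply/matrixP => i j; rewrite !mxE ffunE.
by move=> i j; rewrite !mxE; exact: (hf (i, j)).
Qed.

Lemma mge_exists p q (A : 'M[F]_(p, q)) : exists N : nat, mge (- N%:Z) A.
Proof.
exists (\max_(ij : 'I_p * 'I_q) `|val (A ij.1 ij.2)|)%N => i j.
right; have := @leq_bigmax _ (fun ij : 'I_p * 'I_q => `|val (A ij.1 ij.2)|%N) (i, j).
by rewrite /=; lia.
Qed.

End TotallyBounded.

(** * Integrals of step functions *)

Section StepIntegral.
Variables (R : realType) (d : measure_display) (T : measurableType d).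
Variables (mu : {measure set T -> \bar R}).

Lemma Rintegral_step (I : Type) (s : seq I) (A : I -> set T) (c : I -> R) (D : set T) (f : T -> R) :
  measurable D -> (forall i, measurable (A i)) -> (forall i, A i `<=` D) ->
  (forall i, (mu (A i) < +oo)%E) ->
  (forall x, D x -> f x = \sum_(i <- s) c i * \1_(A i) x) ->
  Rintegral mu D f = \sum_(i <- s) c i * fine (mu (A i)).
Proof.
move=> mD mA AD Afin hf.
rewrite (@eq_Rintegral _ _ _ mu D (fun x => \sum_(i <- s) c i * \1_(A i) x)); last first.
  by move=> x /set_mem; exact: hf.
have int1 i : mu.-integrable D (EFin \o (\1_(A i) : T -> R)).
  apply/integrableP; split; first by apply/measurable_EFinP.
  under eq_integral do rewrite /= ger0_norm //.
  by rewrite integral_indic // setIidl.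
have intc i : mu.-integrable D (EFin \o (fun x => c i * \1_(A i) x)).
  by apply: (integrableZl mD (c i) (int1 i)).
elim: s {hf f} => [|i s IH].
  under eq_Rintegral do rewrite big_nil.
  by rewrite big_nil /Rintegral integral0.
under eq_Rintegral do rewrite big_cons.
rewrite RintegralD //; last first.
  rewrite (_ : _ \o _ = (fun x => (\sum_(j <- s) (c j * \1_(A j) x)%:E)%E)); last first.
    by apply/funext => x /=; rewrite sumEFin.
  by apply: integrable_sum => // j _; exact: intc.
rewrite IH big_cons RintegralZl //; congr (_ * _ + _).
by rewrite /Rintegral integral_indic // setIidl.
Qed.

(** The only passage between integrals and finite sums, used for [Aop] with cosets in $G$ and for
    the cuspidal integral with translates of a ball in $U$. In both cases invariance gives all
    pieces one common measure [c]. *)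
Lemma cintegral_step (I : eqType) (s : seq I) (A : I -> set T) (p : I -> T) (c : R) (D : set T)
    (f : T -> R[i]) :
  uniq s -> measurable D -> (forall i, i \in s -> measurable (A i)) ->
  (forall i, i \in s -> A i `<=` D) -> (forall i, i \in s -> mu (A i) = c%:E) ->
  (forall i j x, i \in s -> j \in s -> A i x -> A j x -> i = j) ->
  (forall i x, i \in s -> A i x -> f x = f (p i)) ->
  (forall x, D x -> (forall i, i \in s -> ~ A i x) -> f x = 0) ->
  cintegral mu D f = c%:C%C * \sum_(i <- s) f (p i).
Proof.
move=> us mD mA AD Ac dis fA f0.
have key (h : R[i] -> R) : (h 0 = 0) -> {morph h : x y / x + y} ->
    Rintegral mu D (h \o f) = c * h (\sum_(i <- s) f (p i)).
  move=> h0 hD.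
  (* [Rintegral_step] asks for conditions on every index, so the pieces outside [s] are made
     empty. *)
  pose A' i := if i \in s then A i else set0.
  rewrite (@Rintegral_step I s A' (fun i => h (f (p i))) D).
  - rewrite (big_morph h hD h0) mulr_sumr big_seq [RHS]big_seq; apply: eq_bigr => i si.
    by rewrite /A' si Ac // mulrC.
  - exact: mD.
  - by move=> i; rewrite /A'; case: ifP => // si; exact: mA.
  - by move=> i x; rewrite /A'; case: ifP => // si; exact: AD.
  - by move=> i; rewrite /A'; case: ifP => [/Ac ->|_]; rewrite ?measure0 ltry.
  move=> x Dx; have [[i [si Aix]]|none] := pselect (exists i, i \in s /\ A i x).
    rewrite (bigD1_seq i) //= big1_seq ?addr0.
      by rewrite /A' si /= (fA i x si Aix) indicE mem_set // mulr1.
    move=> j /andP[ji sj]; rewrite indicE memNset ?mulr0 // /A' sj => Ajx.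
    by move: ji; rewrite (dis _ _ _ sj si Ajx Aix) eqxx.
  rewrite /= (f0 x Dx) ?h0; last by move=> i si Aix; apply: none; exists i.
  rewrite big1_seq // => i /andP[_ si]; rewrite indicE memNset ?mulr0 // /A' si => Aix.
  by apply: none; exists i.
rewrite /cintegral; have := key (fun z : R[i] => complex.Re z) erefl; rewrite /comp => ->; last by case=> ? ? [].
have := key (fun z : R[i] => complex.Im z) erefl; rewrite /comp => ->; last by case=> ? ? [].
case: (\sum_(i <- s) f (p i)) => a b.
by apply/eqP; rewrite eq_complex /= !mul0r subr0 addr0 !eqxx.
Qed.

End StepIntegral.

(** * Topology and measure on matrices *)

Section MatrixTopology.
Variables (F : fieldType) (val : F -> int).
Hypothesis HF : is_local_field val.
Variable n : nat.
Local Notation vge := (vge val).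
Local Notation mge := (mge val).

Lemma mx_ballE (a y : 'M[F]_n) k : Defs.mx_ball val a k y <-> mge k (y - a).
Proof.
by split=> h i j; [rewrite !mxE; apply/vcloseE|apply/vcloseE; have := h i j; rewrite !mxE].
Qed.

(** Second countability: the finite nets of all boxes, at all levels, give countably many balls, and
    an open set is the union of those that it contains. *)
Lemma mx_open_measurable (A : set (BMat val n)) :
  (forall y, A y -> exists k : int, Defs.mx_ball val y k `<=` A) -> measurable A.
Proof.
move=> hA.
have hL (Nk : nat * nat) := mge_totally_bounded HF n n (- Nk.1%:Z) Nk.2%:Z.
have [L hL'] := choice hL.
pose c (Nki : nat * nat * nat) : 'M[F]_n := nth 0 (L Nki.1) Nki.2.
pose ball (Nki : nat * nat * nat) : set (BMat val n) := Defs.mx_ball val (c Nki) Nki.1.2%:Z.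
pose G Nki := if `[< ball Nki `<=` A >] then ball Nki else set0.
have -> : A = \bigcup_Nki G Nki.
  apply/seteqP; split=> [y Ay|y [Nki _]]; last first.
    by rewrite /G; case: asboolP => // h; exact: h.
  have [k hk] := hA y Ay; have [N hN] := mge_exists val y.
  pose k' := `|k|%N.
  have [B /(nthP 0) [i _ iE] hB] := hL' (N, k') y hN.
  exists (N, k', i) => //; rewrite /G; case: asboolP => [_|]; first by apply/mx_ballE; rewrite /c iE.
  case=> z /mx_ballE hz; apply: hk; apply/mx_ballE.
  rewrite -(subrK B z) -addrA; apply: (mgeD HF); last first.
    by rewrite -opprB; apply: (mgeN HF); apply: (mgeW HF _ hB) => /=; lia.
  by move: hz; rewrite /c /= iE; apply: (mgeW HF); lia.
apply: countable_bigcupT_measurable => // Nki; rewrite /G; case: asboolP => _ //.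
by apply: sub_sigma_algebra; exists (c Nki), Nki.1.2%:Z.
Qed.

Lemma det_limit (L : 'M[F]_n) (B : int) (d0 : F) : mge (- B) L ->
  (forall k, exists y : 'M[F]_n, [/\ mge (- B) y, \det y = d0 & mge k (L - y)]) -> \det L = d0.
Proof.
move=> hL hy; have [c [c0 vc]] := exists_val HF B.
have vcB : vge B c by rewrite -vc; exact: vge_self.
have scal (y : 'M[F]_n) : mge (- B) y -> mge 0 (c *: y).
  by move=> h; rewrite -(subrr B); exact: mgeZ.
apply/eqP; rewrite -subr_eq0; apply/eqP/(mulfI (expf_neq0 n c0)); rewrite mulr0.
apply: (vge_eq0 (val := val)) => k; have [y [h1 <- h3]] := hy (Num.max k 0 - B).
rewrite mulrBr -!detZ; apply: (@vgeW _ _ HF _ (Num.max k 0)); first by rewrite le_max lexx.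
apply: (filt_det_sub (vge_filt HF)); first by rewrite le_max lexx orbT.
- exact: scal.
- exact: scal.
move=> i j; have := mgeZ HF vcB h3 i j; rewrite !mxE -mulrBr.
by rewrite [B + _]addrC subrK.
Qed.

(* The set of bounded matrices of determinant d0 is compact: otherwise nested bad balls
   would shrink to a point where f is not locally constant. *)
Lemma uniform_level (V : Type) (f : 'M[F]_n -> V) (B : int) (d0 : F) : d0 != 0 ->
  smooth val f -> exists t : int, forall y : 'M[F]_n, mge (- B) y -> \det y = d0 ->
    forall y' : 'M[F]_n, mge t (y' - y) -> f y' = f y.
Proof.
move=> d0nz sf; apply: contrapT => nouni.
pose C (y : 'M[F]_n) := mge (- B) y /\ \det y = d0.
pose bad (a : 'M[F]_n) k := forall t : int, exists y y' : 'M[F]_n,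
  [/\ mge k (y - a), C y, mge t (y' - y) & f y' <> f y].
have bad0 : bad 0 (- B).
  move=> t; apply: contrapT => none; apply: nouni; exists t => y h1 h2 y' h3.
  by apply: contrapT => h4; apply: none; exists y, y'; split; rewrite ?subr0.
have step (ak : 'M[F]_n * int) : exists a' : 'M[F]_n, bad ak.1 ak.2 ->
    mge ak.2 (a' - ak.1) /\ bad a' (ak.2 + 1).
  case: ak => a k /=; have [bd|] := pselect (bad a k); last by exists a.
  have [s hs] := mge_totally_bounded HF n n k (k + 1).
  apply: contrapT => none.
  have tr (r : 'M[F]_n) : exists t : int, forall y y' : 'M[F]_n,
      mge k (y - a) -> mge (k + 1) (y - a - r) -> C y -> mge t (y' - y) -> f y' = f y.
    apply: contrapT => nt; apply: none; exists (a + r) => _.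
    have bd' (t : int) : exists y y' : 'M[F]_n, [/\ mge k (y - a), mge (k + 1) (y - (a + r)), C y,
        mge t (y' - y) & f y' <> f y].
      apply: contrapT => no; apply: nt; exists t => y y' h0 h1 h2 h3.
      by apply: contrapT => h4; apply: no; exists y, y'; split=> //; rewrite opprD addrA.
    split; last by move=> t; have [y [y' [_ h1 h2 h3 h4]]] := bd' t; exists y, y'; split.
    have [y [y' [h0 h1 _ _ _]]] := bd' 0.
    rewrite -(subrK y (a + r)) -addrA; apply: (mgeD HF) => //.
    by rewrite -opprB; apply: (mgeN HF); apply: (mgeW HF _ h1); lia.
  have [t ht] := choice tr.
  have [y [y' [h1 h2 h3 h4]]] := bd (\big[Num.max/0]_(r <- s) t r).
  have [r rs hr] := hs _ h1; apply: h4; apply: (ht r y y') => //.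
  by apply: (mgeW HF _ h3); apply: (bigmax_sup_seq _ r).
have [nxt hnxt] := choice step.
pose a := fix a (j : nat) : 'M[F]_n := if j is j'.+1 then nxt (a j', - B + j'%:Z) else 0.
have hbad j : bad (a j) (- B + j%:Z).
  elim: j => [|j IH]; first by rewrite addr0.
  have [_] := hnxt (a j, - B + j%:Z) IH; rewrite /= -addrA.
  by have -> : j%:Z + 1 = j.+1%:Z by lia.
have hdiff j : mge (- B + j%:Z) (a j.+1 - a j) by have [] := hnxt (a j, - B + j%:Z) (hbad j).
have [L hL] := mge_complete HF hdiff.
have hnear (k : int) : exists j y y', [/\ k <= - B + j%:Z, C y, mge k (L - y), mge k (y' - L) & f y' <> f y].
  pose j := `|(k + B)%R|%N; have [y [y' [h1 h2 h3 h4]]] := hbad j k.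
  have hLy : mge k (L - y).
    rewrite -(subrK (a j) L) -addrA; apply: (mgeD HF); first by apply: (mgeW HF _ (hL j)); lia.
    by rewrite -opprB; apply: (mgeN HF); apply: (mgeW HF _ h1); lia.
  exists j, y, y'; split=> //; first by lia.
  by rewrite -(subrK y y') -addrA; apply: (mgeD HF) => //; rewrite -opprB; exact: mgeN.
have hLB : mge (- B) L.
  have [j [y [y' [_ [h1 _] h2 _ _]]]] := hnear (- B).
  by rewrite -(subrK y L); apply: (mgeD HF).
(* Fixing a nonzero determinant is what keeps the limit point invertible; [smooth] says nothing
   about singular matrices. *)
have dL : \det L = d0.
  apply: (det_limit hLB) => k; have [j [y [y' [_ [h1 h1'] h2 _ _]]]] := hnear k.
  by exists y; split.
have [k hk] : exists k, forall y, Defs.mx_ball val L k y -> f y = f L.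
  by apply: sf; rewrite unitmxE dL unitfE.
have [j [y [y' [_ _ h1 h2 h3]]]] := hnear k.
apply: h3; rewrite !hk //; apply/mx_ballE => //.
by rewrite -opprB; exact: mgeN.
Qed.

End MatrixTopology.

(* The block function of the maximal parabolic of block sizes (r, s). *)
Definition blk2 (r s : nat) (i : 'I_(r + s)) : nat := (r <= i)%N.

Definition unip (F : fieldType) (r s : nat) (X : 'M[F]_(r, s)) : 'M[F]_(r + s) :=
  block_mx 1%:M X 0 1%:M.

Section Unip.
Variables (F : fieldType) (r s : nat).
Implicit Types X Y : 'M[F]_(r, s).

Lemma unipD X Y : unip X *m unip Y = unip (X + Y).
Proof.
by rewrite /unip mulmx_block !(mulmx0, mul0mx, mulmx1, mul1mx, addr0, add0r) addrC.
Qed.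

Lemma unip0 : unip (0 : 'M[F]_(r, s)) = 1%:M.
Proof. by rewrite /unip -scalar_mx_block. Qed.

Lemma unipNK X : unip X *m unip (- X) = 1%:M.
Proof. by rewrite unipD subrr unip0. Qed.

Lemma unip_unit X : unip X \in unitmx.
Proof. by have [] := mulmx1_unit (unipNK X). Qed.

Lemma invmx_unip X : invmx (unip X) = unip (- X).
Proof. exact: invmx_eq (unipNK X). Qed.

Lemma det_unip X : \det (unip X) = 1.
Proof. by rewrite /unip det_ublock !det1 mulr1. Qed.

Lemma unip_inj X Y : unip X = unip Y -> X = Y.
Proof. by move/eq_block_mx => []. Qed.

Lemma blk2_lshift (i : 'I_r) : blk2 (lshift s i) = 0%N.
Proof. by rewrite /blk2 /= leqNgt ltn_ord. Qed.

Lemma blk2_rshift (i : 'I_s) : blk2 (rshift r i) = 1%N.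
Proof. by rewrite /blk2 /= leq_addr. Qed.

Lemma unip_stdP (u : 'M[F]_(r + s)) : unip_std (@blk2 r s) u <-> exists X, u = unip X.
Proof.
split=> [h|[X ->] i j].
  exists (ursubmx u); rewrite /unip -[LHS]submxK; congr block_mx; apply/matrixP => i j; rewrite !mxE.
  - by have := h (lshift s i) (lshift s j); rewrite !blk2_lshift eq_lshift => -[].
  - by have := h (rshift r i) (lshift s j); rewrite blk2_lshift blk2_rshift eq_rlshift => -[].
  - by have := h (rshift r i) (rshift r j); rewrite !blk2_rshift eq_rshift => -[].
rewrite /unip; case: (split_ordP i) => i' ->; case: (split_ordP j) => j' ->.
- by right; rewrite block_mxEul mxE eq_lshift.
- by left; rewrite blk2_lshift blk2_rshift.
- by right; rewrite block_mxEdl mxE eq_rlshift.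
- by right; rewrite block_mxEdr mxE eq_rshift.
Qed.

Lemma proper_block2 : (0 < r)%N -> (0 < s)%N -> proper_block (@blk2 r s).
Proof.
move=> r0 s0; split.
  by rewrite /blk2 => i j ij; case: (leqP r i) => // h; rewrite (leq_trans h ij).
exists (lshift s (Ordinal r0)), (rshift r (Ordinal s0)).
by rewrite blk2_lshift blk2_rshift.
Qed.

Lemma unip_radP g (y : 'M[F]_(r + s)) :
  unip_rad g (@blk2 r s) y <-> exists X, y = g *m unip X *m invmx g.
Proof.
split=> [[u /unip_stdP [X ->] <-]|[X ->]]; first by exists X.
by exists (unip X) => //; apply/unip_stdP; exists X.
Qed.

End Unip.

Section Bounds.
Variables (F : fieldType) (val : F -> int).
Hypothesis HF : is_local_field val.
Local Notation vge := (vge val).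
Local Notation mge := (mge val).

Lemma conj_bound n (g : 'M[F]_n) : exists c : int, [/\ 0 <= c, mge (- c) g, mge (- c) (invmx g),
  forall k (A : 'M[F]_n), mge k A -> mge (k - c) (g *m A *m invmx g) &
  forall k (A : 'M[F]_n), mge k A -> mge (k - c) (invmx g *m A *m g)].
Proof.
have [N1 h1] := mge_exists val g; have [N2 h2] := mge_exists val (invmx g).
exists (N1%:Z + N2%:Z); split; first by lia.
- by apply: (mgeW HF _ h1); lia.
- by apply: (mgeW HF _ h2); lia.
- by move=> k A hA; apply: (mgeW HF _ (mgeM3 HF h1 hA h2)); lia.
- by move=> k A hA; apply: (mgeW HF _ (mgeM3 HF h2 hA h1)); lia.
Qed.

Lemma unip_mge r s k (X : 'M[F]_(r, s)) : k <= 0 -> mge k X <-> mge k (unip X).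
Proof.
move=> k0; rewrite /unip; split=> [h|/mge_block [] //].
by apply/mge_block; split=> //; try exact: mge0; apply: (mgeW HF k0); exact: mge1.
Qed.

Lemma unip_sub_mge r s k (X Y : 'M[F]_(r, s)) : mge k (unip X - unip Y) <-> mge k (X - Y).
Proof.
rewrite /unip opp_block_mx add_block_mx !subrr; split=> [/mge_block [] //|h].
by apply/mge_block; split=> //; exact: mge0.
Qed.

End Bounds.

(** * Haar measures of unipotent radicals *)

Section HaarUnip.
Variables (R : realType) (F : fieldType) (val : F -> int).
Hypothesis HF : is_local_field val.
Local Notation vge := (vge val).
Local Notation mge := (mge val).

Lemma null_cover (d : measure_display) (T : measurableType d) (mu : {measure set T -> \bar R})
    (A : set T) (B : nat -> set T) :
  measurable A -> (forall i, measurable (B i)) -> (forall i, mu (B i) = 0%E) ->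
  A `<=` \bigcup_i B i -> mu A = 0%E.
Proof.
move=> mA mB B0 AB; apply/(negligibleP mu mA); apply: (negligibleS AB).
by apply: negligible_bigcup => i; apply/(negligibleP mu (mB i)); exact: B0.
Qed.

Section Measurable.
Variable n : nat.

Lemma coset_measurable (g : 'M[F]_n) t : g \in unitmx ->
  @measurable _ (BMat val n) [set y | mge t (invmx g *m y - 1%:M)].
Proof.
move=> ug; apply: (mx_open_measurable HF) => y /= hy.
have [N hN] := mge_exists val (invmx g).
exists (t + N%:Z) => z /mx_ballE hz /=.
have -> : invmx g *m z - 1%:M = invmx g *m (z - y) + (invmx g *m y - 1%:M).
  by rewrite mulmxBr addrA subrK.
by apply: (mgeD HF) => //; apply: (mgeW HF _ (mgeM HF hN hz)); lia.
Qed.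

Lemma Gi_measurable i : @measurable _ (BMat val n) (Gi val i).
Proof.
apply: (mx_open_measurable HF) => y [uy /(ovG_le HF) [h1 h2]].
have [N hN] := mge_exists val (invmx y).
exists (Num.max (N%:Z + 1) (- i)) => z /mx_ballE hz /=.
have hz1 : mge 1 (invmx y *m z - 1%:M).
  rewrite -(mulVmx uy) -mulmxBr; apply: (mgeW HF _ (mgeM HF hN hz)).
  by rewrite addrC lerBrDr le_max addrC lexx.
have [uz vz _ _] := congr1_unit HF hz1.
have zE : z = y *m (invmx y *m z) by rewrite mulKVmx.
have uz' : z \in unitmx by rewrite zE unitmx_mul uy.
split=> //; apply/(ovG_le HF); split.
  rewrite -(subrK y z); apply: (mgeD HF) => //; apply: (mgeW HF _ hz).
  by rewrite le_max lexx orbT.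
by rewrite zE det_mulmx (val_mul HF) ?det_neq0 // vz addr0.
Qed.

Lemma bounded_measurable k : @measurable _ (BMat val n) [set y | mx_bounded val k y].
Proof.
apply: (mx_open_measurable HF) => y hy; exists (- k) => z /mx_ballE hz /=.
by rewrite -(subrK y z); exact: (mgeD HF hz hy).
Qed.

Lemma GLO_measurable : @measurable _ (BMat val n) (@GLO F val n).
Proof.
apply: (mx_open_measurable HF) => y /(GLOE HF) hy; exists 1 => z /mx_ballE hz.
have [uy hy0 hy'] := hy; apply/(GLOE HF).
have -> : z = y *m (invmx y *m z) by rewrite mulKVmx.
apply: GLintM => //; apply: (congr_GLint HF (t := 1)) => //.
by rewrite -(mulVmx uy) -mulmxBr; exact: mgeM0.
Qed.

Lemma haar_coset (mu : {measure set BMat val n -> \bar R}) t (g : 'M[F]_n) :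
  (forall g : 'M[F]_n, g \in unitmx -> forall A : set (BMat val n), measurable A ->
         A `<=` @GL F n -> mu ((fun y => g *m y) @^-1` A) = mu A) ->
  1 <= t -> g \in unitmx ->
  mu [set y | mge t (invmx g *m y - 1%:M)] = mu [set y | mge t (y - 1%:M)].
Proof.
move=> inv t1 ug.
have e : [set y : BMat val n | mge t (y - 1%:M)] = [set y | mge t (invmx 1%:M *m y - 1%:M)].
  by apply/seteqP; split=> y /=; rewrite invmx1 mul1mx.
rewrite -[RHS](inv (invmx g)) ?unitmx_inv //.
  by rewrite e; exact: (@coset_measurable 1%:M t (unitmx1 _ _)).
by move=> y /= hy; have [] := congr_GLint HF t1 hy.
Qed.

End Measurable.

Lemma restricted_image_measure (d d' : measure_display) (T : measurableType d) (T' : measurableType d')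
    (mu : {measure set T -> \bar R}) (D : set T) (f : T -> T') :
  measurable D -> measurable_fun [set: T] f ->
  exists nu : {measure set T' -> \bar R}, forall A, nu A = mu (f @^-1` A `&` D).
Proof.
move=> mD mf.
by exists (measure_function_pushforward__canonical__measure_function_Measure (mrestr mu mD) mf).
Qed.

Section Projection.
Variables (r s : nat).

(* On U K_1, where K_1 is the first congruence subgroup, the function (a b; c d) |-> b d^-1 is
   left U-equivariant; pushing the Haar measure of G forward along it yields one of U. *)
Definition uproj (y : 'M[F]_(r + s)) : 'M[F]_(r, s) := ursubmx y *m invmx (drsubmx y).

Lemma drsub_congr t (y : 'M[F]_(r + s)) : mge t (y - 1%:M) -> mge t (drsubmx y - 1%:M).
Proof. by move=> h i j; have := h (rshift r i) (rshift r j); rewrite !mxE eq_rshift. Qed.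

Lemma sub_mge t (y : 'M[F]_(r + s)) : mge t y -> mge t (ursubmx y) /\ mge t (drsubmx y).
Proof. by rewrite -{1}[y]submxK => /mge_block []. Qed.

Lemma sub_mge2 t (y z : 'M[F]_(r + s)) : mge t (z - y) ->
  mge t (ursubmx z - ursubmx y) /\ mge t (drsubmx z - drsubmx y).
Proof.
have -> : ursubmx z - ursubmx y = ursubmx (z - y) by apply/matrixP => i j; rewrite !mxE.
have -> : drsubmx z - drsubmx y = drsubmx (z - y) by apply/matrixP => i j; rewrite !mxE.
exact: sub_mge.
Qed.

Lemma uproj_unip X (y : 'M[F]_(r + s)) : mge 1 (y - 1%:M) -> uproj (unip X *m y) = X + uproj y.
Proof.
move=> /drsub_congr /(congr1_unit HF) [ud _ _ _].
rewrite /uproj /unip -{1 2}[y]submxK mulmx_block block_mxKur block_mxKdr.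
by rewrite mul0mx !mul1mx add0r mulmxDl mulmxK // addrC.
Qed.

Lemma uproj_int (y : 'M[F]_(r + s)) : mge 1 (y - 1%:M) -> mge 0 (uproj y).
Proof.
move=> h; have [_ _ hd hd'] := congr1_unit HF (drsub_congr h).
have [_ _ hy _] := congr1_unit HF h; have [hu _] := sub_mge hy.
exact: mgeM0.
Qed.

Lemma uproj_sub t (y z : 'M[F]_(r + s)) : mge 1 (y - 1%:M) -> mge 1 (z - 1%:M) ->
  mge t (z - y) -> mge t (uproj z - uproj y).
Proof.
move=> hy hz hzy.
have [uy _ _ hdy] := congr1_unit HF (drsub_congr hy).
have [uz _ _ hdz] := congr1_unit HF (drsub_congr hz).
have [_ _ hy0 _] := congr1_unit HF hy; have [hu _] := sub_mge hy0.
have [h1 h2] := sub_mge2 hzy.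
have -> : uproj z - uproj y = (ursubmx z - ursubmx y) *m invmx (drsubmx z) -
   ursubmx y *m (invmx (drsubmx z) *m (drsubmx z - drsubmx y) *m invmx (drsubmx y)).
  have -> : invmx (drsubmx z) *m (drsubmx z - drsubmx y) *m invmx (drsubmx y) =
     invmx (drsubmx y) - invmx (drsubmx z) by rewrite mulmxBr mulVmx // mulmxBl mul1mx mulmxK.
  by rewrite /uproj mulmxBr mulmxBl opprB addrA subrK.
apply: (mgeB HF); first exact: mge0M.
by apply: mgeM0 => //; apply: mge0M => //; exact: mgeM0.
Qed.

Variable g : 'M[F]_(r + s).
Hypothesis ug : g \in unitmx.

Definition ucell (y : 'M[F]_(r + s)) : Prop :=
  exists X k, mge 1 (k - 1%:M) /\ y = g *m (unip X *m k).

(** The projection of the open set $gUK_1$ to $gUg^{-1}$. Left translation by $gUg^{-1}$ preserves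
    this set. The value 1 elsewhere is a mere default that makes the map total, since the measure is
    restricted to the cell before being pushed forward. *)
Definition ucell_proj (y : 'M[F]_(r + s)) : 'M[F]_(r + s) :=
  if `[< ucell y >] then g *m unip (uproj (invmx g *m y)) *m invmx g else 1%:M.

Lemma ucell_projE X k : mge 1 (k - 1%:M) ->
  ucell_proj (g *m (unip X *m k)) = g *m unip (X + uproj k) *m invmx g.
Proof.
move=> hk; rewrite /ucell_proj; case: asboolP => [_|[]]; last by exists X, k.
by rewrite mulKmx // uproj_unip.
Qed.

Lemma ucell_proj_cont y k : ucell y ->
  exists t : int, forall z, mge t (z - y) -> ucell z /\ mge k (ucell_proj z - ucell_proj y).
Proof.
move=> [X [kp [hk yE]]]; have [c [c0 _ hc' hc _]] := conj_bound HF g.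
have [N hN] := mge_exists val (unip (- X)).
exists (Num.max (1 + N%:Z + c) (k + c + N%:Z + c)) => z hz.
pose kz := unip (- X) *m (invmx g *m z).
have zE : z = g *m (unip X *m kz) by rewrite /kz [unip X *m _]mulmxA unipNK mul1mx mulKVmx.
have kE : kp = unip (- X) *m (invmx g *m y).
  by rewrite yE mulKmx // mulmxA -{2}[X]opprK unipNK mul1mx.
have hd : mge (Num.max 1 (k + c)) (kz - kp).
  rewrite kE /kz -!mulmxBr.
  apply: (mgeW HF _ (mgeM HF hN (mgeM HF hc' hz))).
  by case: (leP 1 (k + c)); case: (leP (1 + N%:Z + c) (k + c + N%:Z + c)); lia.
have hkz : mge 1 (kz - 1%:M).
  rewrite -(subrK kp kz) -addrA; apply: (mgeD HF) => //; apply: (mgeW HF _ hd).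
  by rewrite le_max lexx.
split; first by exists X, kz.
rewrite zE yE !ucell_projE // -mulmxBl -mulmxBr -[k](addrK c); apply: hc.
apply/(unip_sub_mge HF); rewrite opprD addrACA subrr add0r; apply: uproj_sub => //.
by apply: (mgeW HF _ hd); rewrite le_max lexx orbT.
Qed.

Lemma unip_rad_measurable : @measurable _ (BMat val (r + s)) (unip_rad g (@blk2 r s)).
Proof.
rewrite -[X in measurable X]setCK; apply: measurableC.
apply: (mx_open_measurable HF) => y /= hy.
have [c [c0 _ _ _ hc]] := conj_bound HF g.
pose P (z : 'M[F]_(r + s)) := z - unip (ursubmx z).
have memP z : P (invmx g *m z *m g) = 0 <-> unip_rad g (@blk2 r s) z.
  split=> [/eqP|/unip_radP [X ->]].
    rewrite subr_eq0 => /eqP e; apply/unip_radP; exists (ursubmx (invmx g *m z *m g)).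
    by rewrite -e !mulmxA mulmxV // mul1mx mulmxK.
  by rewrite !mulmxA mulVmx // mul1mx mulmxKV // /P /unip block_mxKur subrr.
have [k hk] : exists k, ~ mge k (P (invmx g *m y *m g)).
  apply: contrapT => h; apply: hy; apply/memP; apply: (mge_eq0 (val := val)) => k.
  by apply: contrapT => h'; apply: h; exists k.
exists (k + c) => z /mx_ballE hz /memP hPz; apply: hk.
have hd : mge k (invmx g *m z *m g - invmx g *m y *m g).
  by rewrite -mulmxBl -mulmxBr -[k](addrK c); exact: hc.
have -> : P (invmx g *m y *m g) = - (P (invmx g *m z *m g) - P (invmx g *m y *m g)).
  by rewrite hPz sub0r opprK.
apply: (mgeN HF); rewrite /P subr_ACA; apply: (mgeB HF) => //.
by apply/(unip_sub_mge HF); have [] := sub_mge2 hd.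
Qed.

Lemma ucell_unit y : ucell y -> y \in unitmx.
Proof.
move=> [X [k [hk ->]]]; have [uk _ _ _] := congr1_unit HF hk.
by rewrite !unitmx_mul ug unip_unit uk.
Qed.

Lemma ucell_measurable : @measurable _ (BMat val (r + s)) ucell.
Proof.
apply: (mx_open_measurable HF) => y hy; have [t ht] := ucell_proj_cont 0 hy.
by exists t => z /mx_ballE /ht [].
Qed.

Lemma ucell_proj_measurable :
  measurable_fun [set: BMat val (r + s)] (ucell_proj : BMat val (r + s) -> BMat val (r + s)).
Proof.
apply: (@measurability _ _ (BMat val (r + s)) (BMat val (r + s)) _ _ (@mx_balls F val (r + s))) => //.
move=> _ [_ [a [k ->]] <-]; rewrite setTI.
have -> : ucell_proj @^-1` (Defs.mx_ball val a k) =
    [set y | ucell y /\ Defs.mx_ball val a k (ucell_proj y)] `|`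
    (if `[< Defs.mx_ball val a k 1%:M >] then ~` ucell else set0).
  apply/seteqP; split=> y /=.
    move=> h; have [cy|ncy] := pselect (ucell y); first by left.
    right; move: h; rewrite /ucell_proj; case: asboolP => // _ h; case: asboolP => //.
  move=> [[]//|]; case: asboolP => // h ncy; rewrite /ucell_proj.
  by case: asboolP.
apply: measurableU.
  apply: (mx_open_measurable HF) => y [cy /mx_ballE hy]; have [t ht] := ucell_proj_cont k cy.
  exists t => z /mx_ballE /ht [cz hz]; split => //; apply/mx_ballE.
  by rewrite -(subrK (ucell_proj y) (ucell_proj z)) -addrA; exact: mgeD.
case: asboolP => _ //; apply: measurableC; exact: ucell_measurable.
Qed.

Lemma ucell_proj_translate X y : ucell y ->
  ucell (g *m unip X *m invmx g *m y) /\
  ucell_proj (g *m unip X *m invmx g *m y) = g *m unip X *m invmx g *m ucell_proj y.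
Proof.
move=> [X' [k [hk ->]]].
have -> : g *m unip X *m invmx g *m (g *m (unip X' *m k)) = g *m (unip (X + X') *m k).
  by rewrite !mulmxA mulmxKV // -[g *m _ *m unip X']mulmxA unipD.
split; first by exists (X + X'), k.
by rewrite !ucell_projE // !mulmxA mulmxKV // -[g *m _ *m unip (X' + _)]mulmxA unipD addrA.
Qed.

(** Existence matters here: the vanishing in [cuspidal] is stated for every Haar measure of the
    radical and yields information only once one is exhibited. *)
Lemma haar_unip (mu : {measure set BMat val (r + s) -> \bar R}) : is_haar_G mu ->
  exists nu : {measure set BMat val (r + s) -> \bar R}, is_haar_on (unip_rad g (@blk2 r s)) nu.
Proof.
move=> [inv fin norm].
have [nu nuE] := restricted_image_measure mu ucell_measurable ucell_proj_measurable.
exists nu; split.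
- rewrite nuE (_ : _ `&` _ = set0) ?measure0 //; apply/seteqP; split=> // y [/= h [X [k [hk yE]]]].
  by apply: h; rewrite yE ucell_projE //; apply/unip_radP; exists (X + uproj k).
- move=> u /unip_radP [X ->] A mA; rewrite !nuE.
  have um : g *m unip X *m invmx g \in unitmx by rewrite !unitmx_mul ug unip_unit unitmx_inv ug.
  rewrite -[RHS](inv _ um); last by move=> y [_ /ucell_unit].
    congr (mu _); apply/seteqP; split=> y [/= h1 h2].
      by have [h3 h4] := ucell_proj_translate X h2; rewrite /= h4.
    have h2' : ucell y.
      have := ucell_proj_translate (- X) h2.
      by rewrite !mulmxA mulmxKV // -[g *m _ *m unip X]mulmxA unipD addNr unip0 mulmx1 mulmxV // mul1mx => -[].
    by have [h3 h4] := ucell_proj_translate X h2'; rewrite /= -h4.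
  by apply: measurableI; [rewrite -[X in measurable X]setTI; apply: ucell_proj_measurable|exact: ucell_measurable].
(* A bounded projection bounds the unipotent part, and the other factor lies in $K_1$; the preimage
   is therefore contained in some [Gi], which has finite measure. *)
- move=> k; rewrite nuE; have [c [c0 hg _ _ hc]] := conj_bound HF g.
  pose K := Num.max (k + c) 0; have K0 : - K <= 0 by rewrite oppr_le0 le_max lexx orbT.
  pose i := Num.max (c + K) (val (\det g)).
  apply: le_lt_trans (fin i); apply: le_measure.
  + apply/mem_set; apply: measurableI; last exact: ucell_measurable.
    by rewrite -[X in measurable X]setTI; apply: ucell_proj_measurable => //; exact: bounded_measurable.
  + by apply/mem_set; exact: Gi_measurable.
  move=> y [/= hb cy]; have uy := ucell_unit cy; split=> //.
  move: cy hb => [X [kp [hk ->]]]; rewrite ucell_projE // => hb.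
  have [_ _ hk0 _] := congr1_unit HF hk.
  have hX : mge (- K) X.
    rewrite -(addrK (uproj kp) X); apply: (mgeB HF); last first.
      exact: (mgeW HF K0 (uproj_int hk)).
    apply/(unip_mge HF _ K0).
    have := hc _ _ (hb : mge (- k) _); rewrite !mulmxA mulVmx // mul1mx mulmxKV //.
    by apply: (mgeW HF); rewrite -opprD lerN2 le_max lexx.
  apply/(ovG_le HF); split.
    have hX' : mge (- K) (unip X) by exact: (unip_mge HF X K0).1 hX.
    apply: (mgeW HF _ (mgeM HF hg (mgeM HF hX' hk0))).
    by rewrite addr0 -opprD lerN2 le_max lexx.
  have [uk vk _ _] := congr1_unit HF hk.
  rewrite !det_mulmx det_unip mul1r (val_mul HF) ?det_neq0 // vk addr0.
  by rewrite le_max lexx orbT.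
- rewrite nuE lt0e measure_ge0 andbT.
  (* If the cell were null, so would be $gK_1$ inside it and, by invariance, every coset of $K_1$.
     Countably many of these cover $\mathrm{GL}_n(O_F)$, which has measure 1. *)
  apply/eqP => mu0.
  have mu1 : mu [set y | mge 1 (invmx g *m y - 1%:M)] = 0%E.
    apply/eqP; rewrite -measure_le0 -mu0; apply: le_measure.
    + by apply/mem_set; exact: coset_measurable.
    + by apply/mem_set; apply: measurableI; [rewrite -[X in measurable X]setTI; apply: ucell_proj_measurable => //; exact: unip_rad_measurable|exact: ucell_measurable].
    move=> y /= hy; have yE : y = g *m (unip 0 *m (invmx g *m y)) by rewrite unip0 mul1mx mulKVmx.
    split; last by exists 0, (invmx g *m y).
    by rewrite /= yE ucell_projE //; apply/unip_radP; exists (0 + uproj (invmx g *m y)).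
  have : mu (@GLO F val (r + s)) = 0%E.
    have [l hl] := mge_totally_bounded HF (r + s) (r + s) 0 1.
    pose B i : set (BMat val (r + s)) :=
      [set y | nth 0 l i \in unitmx /\ mge 1 (invmx (nth 0 l i) *m y - 1%:M)].
    have BE i : nth 0 l i \in unitmx -> B i = [set y | mge 1 (invmx (nth 0 l i) *m y - 1%:M)].
      by move=> ui; apply/seteqP; split=> y /=; rewrite /B /= ?ui //; case.
    have BE0 i : nth 0 l i \notin unitmx -> B i = set0.
      by move=> /negP ui; apply/seteqP; split=> y //= -[].
    apply: (null_cover (B := B)).
    + exact: GLO_measurable.
    + move=> i; have [ui|ui] := boolP (nth 0 l i \in unitmx); last by rewrite BE0.
      by rewrite BE //; exact: coset_measurable.
    + move=> i; have [ui|ui] := boolP (nth 0 l i \in unitmx); last by rewrite BE0 ?measure0.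
      by rewrite BE // (haar_coset inv) // -mu1 (haar_coset inv).
    move=> y /(GLOE HF) [uy hy hy']; have [b /(nthP 0) [i _ bE] hb] := hl y hy.
    have hb1 : mge 1 (invmx y *m b - 1%:M).
      rewrite -(mulVmx uy) -mulmxBr -opprB mulmxN; apply: (mgeN HF); exact: mgeM0.
    have ub : b \in unitmx.
      by have [+ _ _ _] := congr1_unit HF hb1; rewrite unitmx_mul => /andP[].
    exists i => //; rewrite /B /= bE; split=> //.
    have -> : invmx b *m y = invmx (invmx y *m b) by rewrite invmxM ?unitmx_inv // invmxK.
    exact: congr_inv.
  by rewrite norm => /eqP; rewrite onee_eq0.
Qed.

End Projection.

End HaarUnip.

(** * Cuspidality as a finite sum *)

Section CuspidalSum.
Variables (R : realType) (F : fieldType) (val : F -> int).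
Hypothesis HF : is_local_field val.
Local Notation vge := (vge val).
Local Notation mge := (mge val).
Variables (r s : nat).
Hypotheses (r0 : (0 < r)%N) (s0 : (0 < s)%N).
Variables (mu : {measure set BMat val (r + s) -> \bar R}).
Hypothesis Hmu : is_haar_G mu.
Variables (A : 'M[F]_r) (B : 'M[F]_(r, s)) (D : 'M[F]_s).
Hypotheses (uA : A \in unitmx) (uD : D \in unitmx).
Variables (beta : int).
Hypothesis slv : forall E : 'M[F]_(r, s), exists X, X *m D - A *m X = E.
Hypothesis bnd : forall k (X : 'M[F]_(r, s)), mge k (X *m D - A *m X) -> mge (k - beta) X.

Let Y0 := block_mx A B 0 D.
Let T (X : 'M[F]_(r, s)) := (X *m D - A *m X) *m invmx D.

Lemma unip_conj_upper X : unip X *m Y0 *m unip (- X) = unip (T X) *m Y0.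
Proof.
rewrite /Y0 /unip !mulmx_block !(mulmx0, mul0mx, mulmx1, mul1mx, addr0, add0r).
congr block_mx; rewrite /T mulmxKV // mulmxN.
by move: (A *m X) (X *m D) => P Q; apply/matrixP => i j; rewrite !mxE; ring.
Qed.

Let TD X X' : T (X + X') = T X + T X'.
Proof. by rewrite /T -mulmxDl; congr (_ *m _); rewrite mulmxDl mulmxDr opprD addrACA. Qed.

Let TN X : T (- X) = - T X.
Proof. by rewrite /T mulNmx mulmxN opprK -[RHS]mulNmx opprB addrC. Qed.

Let T_surj Z : exists X, T X = Z.
Proof. by have [X hX] := slv (Z *m D); exists X; rewrite /T hX mulmxK. Qed.

Variable k1 : 'M[F]_(r + s).
Hypothesis uk1 : k1 \in unitmx.
(** Parametrizes the conjugated radical so that $m(\phi(X)y_1)=f(X)$ for a single $y_1$, which is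
    the shape $u\mapsto f(ux)$ that cuspidality requires. It is a homomorphism because [T] is
    additive. *)
Let phi X := k1 *m unip (T X) *m invmx k1.

Let phiD X X' : phi X *m phi X' = phi (X + X').
Proof.
by rewrite /phi TD -unipD !mulmxA mulmxKV.
Qed.

Let phi_unit X : phi X \in unitmx.
Proof. by rewrite /phi !unitmx_mul uk1 unip_unit unitmx_inv uk1. Qed.

Let phi_bounded N : exists K, forall X, mge N X -> mx_bounded val K (phi X).
Proof.
have [a ha] := mge_exists val A; have [d hd] := mge_exists val D.
have [d' hd'] := mge_exists val (invmx D).
have [c [c0 _ _ hc _]] := conj_bound HF k1.
pose k := Num.min (N - a%:Z - d%:Z - d'%:Z) 0.
exists (- (k - c)) => X hX; rewrite /mx_bounded opprK -/(mge _ _); apply: hc.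
have k0 : k <= 0 by rewrite ge_min lexx orbT.
apply: (unip_mge HF _ k0).1.
have h1 : mge (N - a%:Z - d%:Z) (X *m D - A *m X).
  apply: (mgeB HF); first by apply: (mgeW HF _ (mgeM HF hX hd)); lia.
  by apply: (mgeW HF _ (mgeM HF ha hX)); lia.
by apply: (mgeW HF _ (mgeM HF h1 hd')); rewrite ge_min lexx.
Qed.

Let phi_inj X X' : phi X = phi X' -> X = X'.
Proof.
(* Uniqueness comes from [bnd] at all levels at once: if $XD=AX$ then [X] lies in every ball around
   0. *)
move=> h; apply/eqP; rewrite -subr_eq0; apply/eqP; apply: (mge_eq0 (val := val)) => t.
rewrite -[t](addrK beta); apply: bnd.
have : T X - T X' = 0.
  apply/eqP; rewrite subr_eq0; apply/eqP/unip_inj.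
  by apply: (can_inj (mulKmx uk1)); apply: (can_inj (mulmxK _)) h; rewrite unitmx_inv.
rewrite -TN -TD => /(congr1 (mulmxr D)) /=; rewrite /T mulmxKV // mul0mx => ->; exact: mge0.
Qed.

Let piece (t : int) (X : 'M[F]_(r, s)) : set (BMat val (r + s)) :=
  [set y | exists2 X', mge t (X' - X) & y = phi X'].

Let phi_near t : exists k, forall X X', mge k (phi X' - phi X) -> mge t (X' - X).
Proof.
have [d hd] := mge_exists val D; have [c [c0 _ _ _ hc]] := conj_bound HF k1.
exists (t + beta + d%:Z + c) => X X' h.
have h1 : mge (t + beta + d%:Z) (T X' - T X).
  apply/(unip_sub_mge HF); have := hc _ _ h; rewrite addrK.
  by rewrite /phi -mulmxBl -mulmxBr !mulmxA mulVmx // mul1mx mulmxKV.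
rewrite -[t](addrK beta); apply: bnd.
have -> : (X' - X) *m D - A *m (X' - X) = (T X' - T X) *m D.
  by rewrite -TN -TD /T mulmxKV.
by apply: (mgeW HF _ (mgeM HF h1 hd)); lia.
Qed.

Let radP y : unip_rad k1 (@blk2 r s) y <-> exists X, y = phi X.
Proof.
split=> [/unip_radP [Z ->]|[X ->]]; last by apply/unip_radP; exists (T X).
by have [X <-] := T_surj Z; exists X.
Qed.

Let piece_measurable t X : measurable (piece t X).
Proof.
have [k hk] := phi_near t.
(* By [phi_near] the inverse of [phi] is uniformly continuous, so a piece is the trace on the closed
   subgroup of an open set. *)
have -> : piece t X = [set y | exists2 X', mge t (X' - X) & mge k (y - phi X')]
    `&` unip_rad k1 (@blk2 r s).
  apply/seteqP; split=> y.
    move=> [X' hX' ->]; split; last by apply/radP; exists X'.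
    by exists X' => //; rewrite subrr; exact: mge0.
  move=> [/= [X' hX' hy] /radP [X'' yE]]; exists X'' => //.
  rewrite -(subrK X' X'') -addrA; apply: (mgeD HF) => //; apply: hk.
  by rewrite -yE.
apply: measurableI; last exact: unip_rad_measurable.
apply: (mx_open_measurable HF) => y [X' hX' hy]; exists k => z /mx_ballE hz /=.
by exists X' => //; rewrite -(subrK y z) -addrA; exact: mgeD.
Qed.

Variable m : 'M[F]_(r + s) -> R[i].
Hypothesis Hcusp : cuspidal val m.
Let f X := m (k1 *m (unip X *m Y0 *m unip (- X)) *m invmx k1).

(** The ball represented by [L] contains the support of [f], and [f] is constant on the classes, so
    the cuspidal integral is the common measure of the pieces times this sum; that measure is finite
    and nonzero. *)
Lemma cuspidal_sum (N t : int) (L : seq 'M[F]_(r, s)) :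
  transv_seq (mge (- N)) (fun X X' => mge t (X' - X)) L ->
  (forall X, f X != 0 -> mge (- N) X) ->
  (forall X X', mge t (X' - X) -> f X' = f X) -> - N <= t ->
  \sum_(X <- L) f X = 0.
Proof.
move=> [uL LN Le Lc] hsupp hloc Nt.
have [nu hnu] := haar_unip HF uk1 Hmu; have [nu0 nuinv nufin nupos] := hnu.
pose y1 := k1 *m Y0 *m invmx k1.
have uY0 : Y0 \in unitmx.
  by rewrite unitmxE det_ublock unitrM -!unitmxE uA uD.
have uy1 : y1 \in unitmx by rewrite /y1 !unitmx_mul uk1 uY0 unitmx_inv uk1.
have fE X : m (phi X *m y1) = f X.
  by rewrite /f unip_conj_upper /phi /y1 !mulmxA mulmxKV.
have [_ /(_ nu hnu) int0] := Hcusp uk1 (proper_block2 r0 s0) uy1.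
have piece_nu X : nu (piece t X) = nu (piece t 0).
  rewrite -(nuinv (phi X)) //; last by apply/radP; exists X.
  congr (nu _); apply/seteqP; split=> y /= [X' hX' yE].
    exists (X' - X); first by rewrite subr0.
    by rewrite -[y](mulKmx (phi_unit X)) yE; apply: (canLR (mulKmx (phi_unit X))); rewrite phiD addrC subrK.
  rewrite subr0 in hX'; exists (X + X'); first by rewrite addrAC subrr add0r.
  by rewrite yE phiD.
have [K hK] := phi_bounded t.
have fin0 : nu (piece t 0) \is a fin_num.
  rewrite ge0_fin_numE //; apply: le_lt_trans (nufin K); apply: le_measure.
  - by apply/mem_set; exact: piece_measurable.
  - by apply/mem_set; exact: bounded_measurable.
  - by move=> y [X']; rewrite subr0 => hX' ->; exact: hK.
pose c := fine (nu (piece t 0)).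
have cE X : nu (piece t X) = c%:E by rewrite piece_nu /c fineK.
(* Countably many translates of one piece cover the radical, which would be null if the piece
   were. *)
have c0 : c != 0.
  apply/eqP => c0; move: nupos; rewrite (_ : nu _ = 0%E) ?ltxx //.
  have hl (N' : nat) := mge_totally_bounded HF r s (- N'%:Z) t.
  have [l hl'] := choice hl.
  apply: (null_cover (B := fun N' => \bigcup_i piece t (nth 0 (l N') i))).
  - exact: unip_rad_measurable.
  - by move=> N'; apply: bigcupT_measurable => i; exact: piece_measurable.
  - move=> N'; apply: (null_cover (B := fun i => piece t (nth 0 (l N') i))) => //.
    + by apply: bigcupT_measurable => i; exact: piece_measurable.
    + by move=> i; rewrite cE c0.
  - move=> y /radP [X ->]; have [N' hN'] := mge_exists val X.
    have [X' /(nthP 0) [i _ iE] hX'] := hl' N' X hN'.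
    by exists N' => //; exists i => //; exists X => //; rewrite iE.
have := @cintegral_step R _ _ nu _ L (piece t) phi c (unip_rad k1 (@blk2 r s)) (fun u => m (u *m y1)).
rewrite int0 => /(_ uL) h.
have h' : 0 = (c%:C)%C * \sum_(X <- L) m (phi X *m y1).
  apply: h.
  - exact: unip_rad_measurable.
  - by move=> X _; exact: piece_measurable.
  - by move=> X _ y [X' _ ->]; apply/radP; exists X'.
  - by move=> X _; exact: cE.
  - move=> X X' y XL XL' [Z hZ ->] [Z' hZ' /phi_inj ZZ']; apply: Le => //.
    rewrite -(subrK Z X') -addrA; apply: (mgeD HF) => //.
    by rewrite -opprB; apply: (mgeN HF); rewrite ZZ'.
  - move=> X y XL [X' hX' ->]; rewrite !fE; exact: hloc.
  - move=> y /radP [X ->] none; rewrite fE; apply/eqP; apply: contrapT => /negP /hsupp hX.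
    have [X' XL' hX'] := Lc X hX; apply: (none X' XL'); exists X => //.
    by rewrite -opprB; exact: mgeN.
move/esym/eqP: h'; rewrite mulf_eq0 => /orP[/eqP [/eqP]|/eqP]; first by rewrite (negbTE c0).
by under eq_bigr do rewrite fE.
Qed.

End CuspidalSum.

(** * Cosets of congruence subgroups *)

Definition rcongr (F : fieldType) (val : F -> int) (n : nat) (t : int) (g g' : 'M[F]_n) : Prop :=
  exists2 k, mge val t (k - 1%:M) & g' = g *m k.

Lemma char_poly_conj (F : fieldType) n (P A : 'M[F]_n) : P \in unitmx ->
  char_poly (P *m A *m invmx P) = char_poly A.
Proof.
move=> uP; rewrite /char_poly.
have E : char_poly_mx (P *m A *m invmx P) =
    map_mx polyC P *m char_poly_mx A *m map_mx polyC (invmx P).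
  rewrite /char_poly_mx mulmxBr mulmxBl -!map_mxM /=; congr (_ - _).
  by rewrite mul_mx_scalar -scalemxAl -map_mxM mulmxV // map_mx1 scalemx1.
rewrite E !det_mulmx mulrC mulrA -det_mulmx -map_mxM mulVmx // map_mx1 det1 mul1r.
by [].
Qed.

Lemma det_conj (F : fieldType) n (k y : 'M[F]_n) : k \in unitmx -> \det (k *m y *m invmx k) = \det y.
Proof. by move=> uk; rewrite !det_mulmx mulrAC -det_mulmx mulmxV // det1 mul1r. Qed.

Lemma Delta_conj (F : fieldType) n (P Y : 'M[F]_n) : P \in unitmx -> Delta (P *m Y *m invmx P) = Delta Y.
Proof. by move=> uP; rewrite /Delta char_poly_conj. Qed.

Section Congruence.
Variables (F : fieldType) (val : F -> int).
Hypothesis HF : is_local_field val.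
Local Notation mge := (mge val).
Local Notation GLint := (GLint val).
Variables (n : nat) (t : int).
Hypothesis t1 : 1 <= t.
Local Notation e := (@rcongr F val n t).

Lemma rcongr_refl g : e g g.
Proof. by exists 1%:M; rewrite ?mulmx1 // subrr; exact: mge0. Qed.

Lemma rcongr_sym g h : e g h -> e h g.
Proof.
move=> [k hk ->]; have [uk _ _] := congr_GLint HF t1 hk.
by exists (invmx k); [exact: congr_inv|rewrite mulmxK].
Qed.

Lemma rcongr_trans g h l : e g h -> e h l -> e g l.
Proof.
by move=> [k hk ->] [k' hk' ->]; exists (k *m k'); [exact: congr_mul|rewrite mulmxA].
Qed.

(** On the left any invertible matrix will do, since the classes are the cosets $gK_t$. On the right
    [B] has to normalize $K_t$, as the elements of $K$ do. *)
Lemma rcongr_mul A B g h : A \in unitmx -> GLint B -> e g h <-> e (A *m g *m B) (A *m h *m B).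
Proof.
move=> uA hB; have [uB _ _] := hB; split=> [[k hk ->]|[k hk E]].
  exists (invmx B *m k *m B).
    by have := congr_conj HF (GLintV hB) hk; rewrite invmxK.
  by rewrite !mulmxA mulmxK.
exists (B *m k *m invmx B); first exact: congr_conj.
by move: E; rewrite -!mulmxA => /(can_inj (mulKmx uA)) E; rewrite !mulmxA -[g *m B *m k]mulmxA -E mulmxK.
Qed.

Lemma rcongrE g h : g \in unitmx -> e g h <-> mge t (invmx g *m h - 1%:M).
Proof.
move=> ug; split=> [[k hk ->]|hk]; first by rewrite mulKmx.
by exists (invmx g *m h) => //; rewrite mulKVmx.
Qed.

Lemma rcongr_transversal (S : set 'M[F]_n) (b : int) :
  (forall g, S g -> [/\ g \in unitmx, mge (- b) g & mge (- b) (invmx g)]) ->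
  exists s, transv_seq S e s.
Proof.
move=> hS; have [s0 hs0] := mge_totally_bounded HF n n (- b) (t + b).
pose P (g h : 'M[F]_n) := [/\ g \in unitmx, mge (- b) (invmx g) & mge (t + b) (g - h)].
apply: (@transversal_exists _ e rcongr_refl rcongr_sym P s0).
  move=> g h l [ug hg hgl] [uh _ hhl]; apply/(rcongrE _ ug).
  rewrite -(mulVmx ug) -mulmxBr -[t](addrK b) addrC; apply: (mgeM HF) => //.
  rewrite -(subrK l h) -addrA; apply: (mgeD HF) => //.
  by rewrite -opprB; exact: mgeN.
move=> g Sg; have [ug hg hg'] := hS g Sg.
by have [l ls hl] := hs0 g hg; exists l.
Qed.

Lemma GLint_transversal : exists s, transv_seq (fun k : 'M[F]_n => GLint k) e s.
Proof. by apply: (@rcongr_transversal _ 0) => g [ug hg hg']; split; rewrite ?oppr0. Qed.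

Lemma GLint_sum_mul (V : zmodType) (s : seq 'M[F]_n) (A B : 'M[F]_n) (f : 'M[F]_n -> V) :
  transv_seq (fun k : 'M[F]_n => GLint k) e s -> GLint A -> GLint B ->
  (forall k k', GLint k -> GLint k' -> e k k' -> f k = f k') ->
  \sum_(k <- s) f (A *m k *m B) = \sum_(k <- s) f k.
Proof.
move=> ts hA hB hf; have [uA _ _] := hA; have [uB _ _] := hB.
apply: (transversal_reindex rcongr_refl rcongr_sym rcongr_trans ts) => //.
- by move=> k hk; do ! apply: GLintM.
- by move=> k k' _ _; exact: rcongr_mul.
- move=> k hk; exists (invmx A *m k *m invmx B); first by do ! apply: GLintM => //; exact: GLintV.
  by rewrite !mulmxA mulmxV // mul1mx mulmxKV //; exact: rcongr_refl.
Qed.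

End Congruence.

(** * Vanishing on deep shells *)

Section Core.
Variables (R : realType) (F : fieldType) (val : F -> int).
Hypothesis HF : is_local_field val.
Local Notation vge := (vge val).
Local Notation pge := (pge val).
Local Notation mge := (mge val).
Local Notation GLint := (GLint val).
Variables (r s : nat).
Let n := (r.+1 + s.+1)%N.
Variables (mu : {measure set BMat val n -> \bar R}).
Hypothesis Hmu : is_haar_G mu.
Variable m : 'M[F]_n -> R[i].
Hypothesis Hcusp : cuspidal val m.
Variables (N v : int).
Hypotheses (N0 : 0 <= N) (v0 : 0 <= v).
Hypothesis Hsupp : forall y : 'M[F]_n, y \in unitmx -> m y != 0 ->
  exists z : F, z != 0 /\ ovG val (z *: y) <= N.
Variable x : 'M[F]_n.
Hypotheses (ux : x \in unitmx) (hx : mge (- v) x) (Dx : Delta x != 0) (vDx : val (Delta x) <= v).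
Let b := v + N *+ 2.
Let M := v + b *+ (6 * n * n).
Variable t : int.
Hypothesis t1 : 1 <= t.
Variable Bd : int.
Hypothesis HBd : b + M *+ 2 <= Bd.
Hypothesis Hinv : forall z : 'M[F]_n, mge (- Bd) z -> \det z = \det x ->
  forall k, mge t (k - 1%:M) -> m (k *m z *m invmx k) = m z.

Let b0 : 0 <= b. Proof. by rewrite addr_ge0 // mulrn_wge0. Qed.
Let M0 : 0 <= M. Proof. by rewrite addr_ge0 // mulrn_wge0. Qed.

Let unit_det (y : 'M[F]_n) : \det y = \det x -> y \in unitmx.
Proof. by move=> e; rewrite unitmxE e -unitmxE. Qed.

(** Conjugates of [x] share its determinant, so compactness modulo the center becomes honest
    boundedness through [ovG_scale_bound]. *)
Lemma supp_bound (k y : 'M[F]_n) : GLint k -> \det y = \det x ->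
  m (k *m y *m invmx k) != 0 -> mge (- b) y.
Proof.
move=> hk dy my; have [uk _ _] := hk.
apply/(mge_GLint HF _ y hk (GLintV hk)).
have dk := det_conj y uk.
have uy : k *m y *m invmx k \in unitmx by apply: unit_det; rewrite dk.
have [z [z0 hz]] := Hsupp uy my.
apply: (ovG_scale_bound HF _ uy z0 hz) => //.
by rewrite dk dy; apply: (mge_val_det HF hx); exact: det_neq0.
Qed.

(** $K$ normalizes $K_t$, so $k\,k_p\,k^{-1}$ is again of level [t] and the invariance of [m]
    applies at $kzk^{-1}$, which satisfies the same bounds as [z]. *)
Lemma conj_level (k z kp : 'M[F]_n) : GLint k -> mge (- Bd) z -> \det z = \det x ->
  mge t (kp - 1%:M) -> m (k *m kp *m z *m invmx (k *m kp)) = m (k *m z *m invmx k).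
Proof.
move=> hk hz dz hkp; have [uk _ _] := hk; have [ukp _ _] := congr_GLint HF t1 hkp.
have <- := Hinv (z := k *m z *m invmx k) _ _ (congr_conj HF hk hkp).
- have -> : invmx (k *m kp *m invmx k) = k *m invmx kp *m invmx k.
    by rewrite !invmxM ?unitmx_mul ?uk ?ukp ?unitmx_inv // invmxK mulmxA.
  by rewrite invmxM // !mulmxA !mulmxKV.
- by apply/(mge_GLint HF _ z hk (GLintV hk)).
- by rewrite det_conj.
Qed.

(** Multiplying by a scalar of valuation [b] makes [Y] integral and raises the valuation of the
    discriminant by at most $6n^2b$; this is the origin of [M]. *)
Lemma bezout_scaled (Y : 'M[F]_n) c : c != 0 -> val c = b -> mge (- b) Y -> Delta Y = Delta x ->
  let chi := char_poly (c *: Y) in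
  exists u w e, [/\ pge 0 u, pge 0 w, e != 0, val e <= M & e%:P = u * chi + w * chi^`()].
Proof.
move=> c0 vc hY DY chi.
have hcY : mge 0 (c *: Y) by rewrite -(subrr b); apply: (mgeZ HF) => //; rewrite -vc; exact: vge_self.
have hchi : pge 0 chi by exact: char_poly_pge.
have sz : (1 < size chi)%N by rewrite size_char_poly.
have [u [w [hu hw e]]] := resultant_bezout HF hchi (pge_deriv HF hchi) sz.
exists u, w, (resultant chi chi^`()).
have [] := @resultant_char_poly_scale _ _ HF n Y c isT; rewrite ?DY ?vc //.
move=> r0 vr; split => //; apply: (le_trans vr).
by rewrite /M; apply: lerD.
Qed.

Lemma unip_conj_bound (Y : 'M[F]_n) (X : 'M[F]_(r.+1, s.+1)) : mge (- b) Y -> mge (- M) X ->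
  mge (- Bd) (unip X *m Y *m unip (- X)).
Proof.
move=> hY hX; have M0' : - M <= 0 by rewrite oppr_le0.
have h1 : mge (- M) (unip X) by exact: (unip_mge HF _ M0').1.
have h2 : mge (- M) (unip (- X)) by apply: (unip_mge HF _ M0').1; exact: mgeN.
by apply: (mgeW HF _ (mgeM3 HF h1 hY h2)); move: HBd; rewrite mulr2n; lia.
Qed.

Lemma det_unip_conj (Y : 'M[F]_n) (X : 'M[F]_(r.+1, s.+1)) :
  \det (unip X *m Y *m unip (- X)) = \det Y.
Proof. by rewrite !det_mulmx !det_unip mul1r mulr1. Qed.

Variable L : seq 'M[F]_(r.+1, s.+1).
Hypothesis trL : transv_seq (mge (- M)) (fun X X' => mge t (X' - X)) L.

(** A nonzero term forces the upper right block $B+(XD-AX)$ to have level $-b$, hence [X] to have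
    level $-M$. The list [L] therefore sees the whole support on $U$, and the sum is a full cuspidal
    integral. *)
Lemma upper_sum A B D (k1 : 'M[F]_n) :
  let Y0 : 'M[F]_n := block_mx A B 0 D in
  mge (- b) Y0 -> \det Y0 = \det x -> Delta Y0 = Delta x -> GLint k1 ->
  \sum_(X <- L) m (k1 *m (unip X *m Y0 *m unip (- X)) *m invmx k1) = 0.
Proof.
move=> Y0 hY0 dY0 DY0 hk1; have [uk1 _ _] := hk1.
have [c [c0 vc]] := exists_val HF b.
have vcb : vge b c by rewrite -vc; exact: vge_self.
have [u [w [e [hu hw e0 eM eE]]]] := bezout_scaled c0 vc hY0 DY0.
have uY0 : Y0 \in unitmx by exact: unit_det.
have [uA uD] : A \in unitmx /\ D \in unitmx.
  by move: uY0; rewrite unitmxE det_ublock unitrM -!unitmxE => /andP.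
have [hA hB _ hD] := (mge_block val (- b) A B 0 D).1 hY0.
have scal p q (Z : 'M[F]_(p, q)) : mge (- b) Z -> mge 0 (c *: Z).
  by move=> hZ; rewrite -(subrr b); apply: (mgeZ HF).
have chiE : char_poly (c *: Y0) = char_poly (c *: A) * char_poly (c *: D).
  rewrite /Y0 scale_block_mx scaler0 /char_poly.
  rewrite /char_poly_mx map_block_mx scalar_mx_block opp_block_mx add_block_mx map_mx0 !oppr0 !addr0.
  by rewrite det_ublock.
have [uS hS] : horner_mx (c *: D) (char_poly (c *: A)) \in unitmx /\
    mge (- M) (invmx (horner_mx (c *: D) (char_poly (c *: A)))).
  (* The characteristic polynomial of a block triangular matrix factors exactly, so the error
     polynomial is 0 and any [kappa] above [M] will do. *)
  apply: (@horner_mx_inv_bound _ _ HF _ (c *: D) (char_poly (c *: D)) (char_poly (c *: A))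
    (char_poly (c *: Y0)) 0 u w e M (M + 1)) eE e0 eM _ => //.
  - exact: scal.
  - exact: Cayley_Hamilton.
  - by apply: char_poly_pge => //; exact: scal.
  - by apply: char_poly_pge => //; exact: scal.
  - exact: (filt0 (pge_filt HF)).
  - by rewrite addr0 chiE mulrC.
  - by lia.
have scE (X : 'M[F]_(r.+1, s.+1)) : X *m (c *: D) - (c *: A) *m X = c *: (X *m D - A *m X).
  by rewrite -scalemxAr -scalemxAl scalerBr.
have slv (E : 'M[F]_(r.+1, s.+1)) : exists X, X *m D - A *m X = E.
  have [X hX] := sylv_solve uS (c *: E); exists X.
  by move: hX; rewrite scE => /(scalerI c0).
have bnd k (X : 'M[F]_(r.+1, s.+1)) : mge k (X *m D - A *m X) -> mge (k - (M - b)) X.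
  move=> hX; have : mge (b + k) (X *m (c *: D) - (c *: A) *m X) by rewrite scE; exact: mgeZ.
  move/(sylv_bound HF uS hS (scal _ _ _ hA) (scal _ _ _ hD)).
  by apply: (mgeW HF); lia.
pose f X := m (k1 *m (unip X *m Y0 *m unip (- X)) *m invmx k1).
have hsupp X : f X != 0 -> mge (- M) X.
  move=> fX; have := supp_bound hk1 _ fX; rewrite det_unip_conj => /(_ dY0).
  rewrite (unip_conj_upper A B uD) /unip mulmx_block => /mge_block [_ + _ _].
  rewrite !mul1mx mulmxKV // => h.
  have : mge (- b) (X *m D - A *m X).
    by rewrite -(addKr B (_ - _)); apply: (mgeD HF) => //; exact: mgeN.
  by move/bnd; apply: (mgeW HF); lia.
apply: (@cuspidal_sum R F val HF r.+1 s.+1 isT isT mu Hmu A B D uA uD (M - b) slv bnd k1 uk1 m Hcusp M t L trL hsupp).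
  move=> X X' hXX'.
  (* The ball of level $-M$ is a union of classes because $-M\le t$. If [X] lies outside it, so does
     [X'], and both values vanish. *)
  have [hX|hX] := pselect (mge (- M) X); last first.
    have fX : f X = 0 by apply/eqP; apply: contrapT => /negP /hsupp.
    rewrite -[RHS]/(f X) fX; apply/eqP; apply: contrapT => /negP /hsupp hX'; apply: hX.
    rewrite -(subrK X' X); apply: (mgeD HF) => //; rewrite -opprB; apply: (mgeN HF).
    by apply: (mgeW HF _ hXX'); lia.
  have := conj_level hk1 (unip_conj_bound hY0 hX) _ (_ : mge t (unip (X' - X) - 1%:M)).
  rewrite det_unip_conj -unip0 => /(_ dY0) <-; last by apply/(unip_sub_mge HF); rewrite subr0.
  congr m; rewrite invmxM // ?unip_unit // invmx_unip !mulmxA -[k1 *m unip _ *m unip _]mulmxA unipD subrK.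
  by rewrite -[_ *m unip (- X) *m unip _]mulmxA unipD opprB addKr.
by lia.
Qed.

Variable ks : seq 'M[F]_n.
Hypothesis trK : transv_seq (fun k : 'M[F]_n => GLint k) (rcongr val t) ks.

Lemma ks_GLint k : k \in ks -> GLint k.
Proof. by case: trK => _ h _ _; exact: h. Qed.

(** Averaging over $K$ forgets conjugation of [z] by $K$. This is what allows a near-identity
    conjugation to be discarded in the next lemma. *)
Lemma conj_sum_right (z k0 : 'M[F]_n) : mge (- Bd) z -> \det z = \det x -> GLint k0 ->
  \sum_(k <- ks) m (k *m (k0 *m z *m invmx k0) *m invmx k) = \sum_(k <- ks) m (k *m z *m invmx k).
Proof.
move=> hz dz hk0; have [uk0 _ _] := hk0.
have inv k k' : GLint k -> GLint k' -> rcongr val t k k' -> m (k *m z *m invmx k) = m (k' *m z *m invmx k').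
  by move=> hk _ [kp hkp ->]; rewrite conj_level.
rewrite -(GLint_sum_mul HF t1 trK (GLint1 HF n) hk0 inv) big_seq [RHS]big_seq.
apply: eq_bigr => k /ks_GLint [uk _ _]; congr m.
by rewrite mul1mx invmxM // !mulmxA.
Qed.

(** The exponent $3M+1$ is spent as follows: solving the Riccati equation loses [M], which leaves
    [W] at level $2M+1$; conjugation by a unipotent of level $-M$ loses [M] twice more and still
    ends at level 1, inside $K$. *)
Lemma bounded_sum (Y : 'M[F]_n) : mge (- b) Y -> \det Y = \det x -> Delta Y = Delta x ->
  mge (M *+ 3 + 1) (dlsubmx Y) ->
  \sum_(X <- L) \sum_(k <- ks) m (k *m (unip X *m Y *m unip (- X)) *m invmx k) = 0.
Proof.
move=> hY dY DY hC; have [c [c0 vc]] := exists_val HF b.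
have vcb : vge b c by rewrite -vc; exact: vge_self.
pose A := ulsubmx Y; pose B := ursubmx Y; pose C := dlsubmx Y; pose D := drsubmx Y.
have YE : Y = block_mx A B C D by rewrite submxK.
have [u [w [e [hu hw e0 eM eE]]]] := bezout_scaled c0 vc hY DY.
have cYE : c *: Y = block_mx (c *: A) (c *: B) (c *: C) (c *: D) by rewrite {1}YE scale_block_mx.
have hcY : mge 0 (block_mx (c *: A) (c *: B) (c *: C) (c *: D)).
  by rewrite -cYE -(subrr b); exact: mgeZ.
have hcC : mge (b + (M *+ 3 + 1)) (c *: C) by exact: mgeZ.
have M23 : M *+ 2 < b + (M *+ 3 + 1) by rewrite !mulrS mulr0n; move: b0 M0; lia.
have [W [hW WE]] : exists W, mge (b + (M *+ 3 + 1) - M) W /\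
    c *: C + W *m (c *: A) - (c *: D + W *m (c *: B)) *m W = 0.
  by apply: (@riccati _ _ HF r s (c *: A) (c *: B) (c *: C) (c *: D) u w e M) => //; rewrite -cYE.
have {WE} WE : C + W *m A - (D + W *m B) *m W = 0.
  apply: (scalerI c0); rewrite scaler0 -{}WE.
  by rewrite scalerBr -!scalemxAr -!scalerDr -scalemxAl.
have hW2 : mge (M *+ 2 + 1) W.
  by apply: (mgeW HF _ hW); rewrite !mulrS mulr0n; move: b0 M0; lia.
have hW0 : mge 0 W by apply: (mgeW HF _ hW2); rewrite !mulrS mulr0n; move: M0; lia.
pose wm : 'M[F]_n := block_mx 1%:M 0 W 1%:M.
pose wi : 'M[F]_n := block_mx 1%:M 0 (- W) 1%:M.
have hwm : GLint wm by exact: GLint_lower.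
have [uwm _ _] := hwm.
have wiE : invmx wm = wi.
  apply: invmx_eq; rewrite /wm /wi mulmx_block !(mulmx0, mul0mx, mulmx1, mul1mx, addr0, add0r).
  by rewrite subrr -scalar_mx_block.
pose Y0 : 'M[F]_n := block_mx (A - B *m W) B 0 (D + W *m B).
have Y0E : Y0 = wm *m Y *m invmx wm.
  rewrite wiE /wm /wi YE !mulmx_block !(mulmx0, mul0mx, mulmx1, mul1mx, addr0, add0r).
  rewrite /Y0 !mulmxN; congr block_mx; last by rewrite addrC.
  by rewrite -WE addrC [W *m A + C]addrC [W *m B + D]addrC addrC.
have hY0 : mge (- b) Y0 by rewrite Y0E; apply/(mge_GLint HF _ Y hwm (GLintV hwm)).
have dY0 : \det Y0 = \det x by rewrite Y0E det_conj.
have DY0 : Delta Y0 = Delta x by rewrite Y0E Delta_conj.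
have red X : mge (- M) X -> \sum_(k <- ks) m (k *m (unip X *m Y *m unip (- X)) *m invmx k) =
    \sum_(k <- ks) m (k *m (unip X *m Y0 *m unip (- X)) *m invmx k).
  (* Conjugating $uY_0u^{-1}$ by $u\,w^{-1}u^{-1}$ gives $uYu^{-1}$, so the two averages over $K$
     agree as soon as this element lies in $K$. *)
  move=> hX; pose kX := unip X *m wi *m unip (- X).
  have hkX : GLint kX.
    apply: (congr_GLint HF (t := 1)) => //.
    have -> : kX - 1%:M = unip X *m (wi - 1%:M) *m unip (- X).
      by rewrite mulmxBr mulmx1 mulmxBl unipNK.
    have hwi : mge (M *+ 2 + 1) (wi - 1%:M).
      rewrite /wi scalar_mx_block opp_block_mx add_block_mx !subrr oppr0 !addr0.
      by apply/mge_block; split; try exact: mge0; exact: mgeN.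
    have M0' : - M <= 0 by rewrite oppr_le0.
    have h1 : mge (- M) (unip X) by exact: (unip_mge HF _ M0').1.
    have h2 : mge (- M) (unip (- X)) by apply: (unip_mge HF _ M0').1; exact: mgeN.
    by apply: (mgeW HF _ (mgeM3 HF h1 hwi h2)); rewrite !mulrS mulr0n; lia.
  rewrite -[RHS](conj_sum_right _ _ hkX) ?det_unip_conj //; last exact: unip_conj_bound.
  apply: eq_bigr => k _; congr m; congr (_ *m _); congr (_ *m _).
  have uNX : unip (- X) *m unip X = 1%:M by rewrite -{2}[X]opprK unipNK.
  have -> : invmx kX = unip X *m wm *m unip (- X).
    apply: invmx_eq; rewrite /kX -wiE !mulmxA -[_ *m unip (- X) *m unip X]mulmxA.
    by rewrite uNX mulmx1 mulmxKV // unipNK.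
  rewrite /kX -wiE Y0E.
  rewrite !mulmxA -[_ *m unip (- X) *m unip X]mulmxA uNX mulmx1.
  rewrite -[_ *m unip (- X) *m unip X]mulmxA uNX mulmx1.
  by rewrite mulmxKV // mulmxKV.
transitivity (\sum_(X <- L) \sum_(k <- ks) m (k *m (unip X *m Y0 *m unip (- X)) *m invmx k)).
  rewrite big_seq [RHS]big_seq; apply: eq_bigr => X XL; apply: red.
  by case: trL => _ h _ _; exact: h.
rewrite exchange_big /= big_seq big1 // => k /ks_GLint hk.
exact: upper_sum.
Qed.

(** Removes the bound on [Y] from the previous lemma: either all terms vanish, or a nonzero term at
    [X0] shows that the conjugate [Y1] is bounded, and [Y1] may replace [Y]. *)
Lemma core_sum (Y : 'M[F]_n) : \det Y = \det x -> Delta Y = Delta x ->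
  mge (M *+ 3 + 1) (dlsubmx Y) ->
  \sum_(X <- L) \sum_(k <- ks) m (k *m (unip X *m Y *m unip (- X)) *m invmx k) = 0.
Proof.
move=> dY DY hC.
pose h (Y : 'M[F]_n) (X : 'M[F]_(r.+1, s.+1)) := \sum_(k <- ks) m (k *m (unip X *m Y *m unip (- X)) *m invmx k).
have [[X0 [k0 [XL kK nz]]]|none] := pselect (exists X0 k0, [/\ X0 \in L, k0 \in ks &
    m (k0 *m (unip X0 *m Y *m unip (- X0)) *m invmx k0) != 0]); last first.
  rewrite big_seq big1 // => X XL; rewrite big_seq big1 // => k kK.
  by apply/eqP; apply: contrapT => /negP nz; apply: none; exists X, k.
pose Y1 := unip X0 *m Y *m unip (- X0).
have hX0 : mge (- M) X0 by case: trL => _ h' _ _; exact: h'.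
have dY1 : \det Y1 = \det x by rewrite det_unip_conj.
have DY1 : Delta Y1 = Delta x by rewrite /Y1 -invmx_unip Delta_conj ?unip_unit.
have hY1 : mge (- b) Y1 by exact: supp_bound (ks_GLint kK) dY1 nz.
(* Conjugation by an upper unipotent leaves the lower left block unchanged, so the translation costs
   nothing there. *)
have hC1 : mge (M *+ 3 + 1) (dlsubmx Y1).
  have -> : dlsubmx Y1 = dlsubmx Y; last by [].
  rewrite /Y1 /unip -{1}[Y]submxK !mulmx_block block_mxKdl.
  by rewrite !(mulmx0, mul0mx, mulmx1, mul1mx, addr0, add0r).
apply: etrans (bounded_sum hY1 dY1 DY1 hC1).
have -> : \sum_(X <- L) \sum_(k <- ks) m (k *m (unip X *m Y *m unip (- X)) *m invmx k) =
    \sum_(X <- L) h Y1 (X - X0).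
  apply: eq_bigr => X _; apply: eq_bigr => k _; congr (m (k *m _ *m _)).
  rewrite /Y1 !mulmxA unipD subrK -[_ *m unip (- X0) *m _]mulmxA unipD.
  by congr (_ *m unip _); rewrite opprB addKr.
(* The ball of level $-M$ is an additive group containing [X0], so subtracting [X0] permutes its
   classes. *)
apply: (transversal_reindex (e := fun X X' => mge t (X' - X)) _ _ _ trL).
- by move=> X; rewrite subrr; exact: mge0.
- by move=> X X' hXX; rewrite -opprB; exact: mgeN.
- by move=> X X' X'' h1 h2; rewrite -(subrK X' X'') -addrA; exact: mgeD.
- by move=> X hX; exact: mgeB.
- by move=> X X' _ _; rewrite opprB addrA subrK.
- move=> X hX; exists (X + X0); first exact: mgeD.
  by rewrite addrK subrr; exact: mge0.
move=> X X' hX hX' hXX; rewrite /h big_seq [RHS]big_seq; apply: eq_bigr => k /ks_GLint hk.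
have [uk _ _] := hk.
have := conj_level hk (unip_conj_bound hY1 hX) _ (_ : mge t (unip (X' - X) - 1%:M)).
rewrite det_unip_conj -unip0 => /(_ dY1) <-; last by apply/(unip_sub_mge HF); rewrite subr0.
clearbody Y1; congr m; rewrite invmxM // ?unip_unit // invmx_unip !mulmxA -[k *m unip _ *m unip _]mulmxA unipD subrK.
by rewrite -[_ *m unip (- X) *m unip _]mulmxA unipD opprB addKr.
Qed.

End Core.

(** * Averages over a double coset of $K$ *)

Section Shell.
Variables (R : realType) (F : fieldType) (val : F -> int).
Hypothesis HF : is_local_field val.
Local Notation vge := (vge val).
Local Notation mge := (mge val).
Local Notation GLint := (GLint val).

(* [cbound] bounds the entries of those conjugates of x at which m may be nonzero, when the support
   of m lies in Z(G) G_N; [dbound] bounds the valuation of the discriminant of such a conjugate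
   rescaled to have integral entries. *)
Definition cbound (N v : int) : int := v + N *+ 2.
Definition dbound (n : nat) (N v : int) : int := v + cbound N v *+ (6 * n * n).

Lemma invmx_diag n (d : 'rV[F]_n) : (forall i, d 0 i != 0) ->
  diag_mx d \in unitmx /\ invmx (diag_mx d) = diag_mx (\row_i (d 0 i)^-1).
Proof.
move=> d0.
have e : diag_mx d *m diag_mx (\row_i (d 0 i)^-1) = 1%:M.
  rewrite mulmx_diag; apply/matrixP => i j; rewrite !mxE.
  by case: eqP => [->|//]; rewrite mulfV.
by split; [have [] := mulmx1_unit e|exact: invmx_eq].
Qed.

Lemma diag_conj_entry n (d : 'rV[F]_n) (y : 'M[F]_n) i j : (forall i, d 0 i != 0) ->
  (diag_mx d *m y *m invmx (diag_mx d)) i j = d 0 i * y i j / d 0 j.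
Proof.
by move=> d0; have [_ ->] := invmx_diag d0; rewrite mul_mx_diag mxE mul_diag_mx !mxE.
Qed.

Lemma diag_conj_entryV n (d : 'rV[F]_n) (y : 'M[F]_n) i j : (forall i, d 0 i != 0) ->
  (invmx (diag_mx d) *m y *m diag_mx d) i j = (d 0 i)^-1 * y i j * d 0 j.
Proof.
by move=> d0; have [_ ->] := invmx_diag d0; rewrite mul_mx_diag mxE mul_diag_mx !mxE.
Qed.

(** Two levels are in play. The function [m] is invariant at level [t0] on bounded matrices, while
    the representatives of $K$ are taken at the finer level [t]: conjugation by the diagonal matrix
    loses at most [2 bg], exactly the difference. *)
Lemma shell_sum (r s : nat) (n := (r.+1 + s.+1)%N) (mu : {measure set BMat val n -> \bar R})
    (m : 'M[F]_n -> R[i]) (N v : int) (x : 'M[F]_n) (t0 t Bd bg : int) (ks : seq 'M[F]_n)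
    (d : 'rV[F]_n) (k1 k2 : 'M[F]_n) :
  is_haar_G mu -> cuspidal val m -> 0 <= N -> 0 <= v ->
  (forall y : 'M[F]_n, y \in unitmx -> m y != 0 -> exists z : F, z != 0 /\ ovG val (z *: y) <= N) ->
  x \in unitmx -> mge (- v) x -> Delta x != 0 -> val (Delta x) <= v ->
  1 <= t0 -> 0 <= bg -> t = t0 + bg *+ 2 ->
  cbound N v + dbound n N v *+ 2 <= Bd -> v + bg *+ 2 <= Bd ->
  (forall z : 'M[F]_n, mge (- Bd) z -> \det z = \det x ->
     forall k, mge t0 (k - 1%:M) -> m (k *m z *m invmx k) = m z) ->
  transv_seq (fun k : 'M[F]_n => GLint k) (rcongr val t) ks ->
  (forall i, d 0 i != 0) -> mge (- bg) (diag_mx d) -> mge (- bg) (invmx (diag_mx d)) ->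
  (forall i j : 'I_n, (i < r.+1)%N -> (r.+1 <= j)%N ->
     v + dbound n N v *+ 3 + 1 <= val (d 0 j) - val (d 0 i)) ->
  GLint k1 -> GLint k2 ->
  \sum_(a <- ks) \sum_(c <- ks)
     m ((a *m (k1 *m diag_mx d *m k2) *m c) *m x *m invmx (a *m (k1 *m diag_mx d *m k2) *m c)) = 0.
Proof.
move=> Hmu Hcusp N0 v0 Hsupp ux hx Dx vDx t01 bg0 tE HB1 HB2 Hinv0 trK d0 hd hd' gap hk1 hk2.
set M := dbound n N v in HB1 gap *.
have M0 : 0 <= M by rewrite addr_ge0 // mulrn_wge0 // addr_ge0 // mulrn_wge0.
have t0t : t0 <= t by rewrite tE mulr2n; lia.
have t1 : 1 <= t by exact: le_trans t0t.
have Hinv (z : 'M[F]_n) : mge (- Bd) z -> \det z = \det x ->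
     forall k, mge t (k - 1%:M) -> m (k *m z *m invmx k) = m z.
  by move=> hz dz k hk; apply: Hinv0 => //; exact: (mgeW HF t0t hk).
have hks k : k \in ks -> GLint k by case: trK => _ h _ _; exact: h.
pose D := diag_mx d; have [uD Dinv] := invmx_diag d0.
have [uk1 _ _] := hk1; have [uk2 _ _] := hk2.
pose z k := D *m (k *m x *m invmx k) *m invmx D.
have hz k : GLint k -> mge (- Bd) (z k).
  move=> hk; have hkx : mge (- v) (k *m x *m invmx k) by apply/(mge_GLint HF _ x hk (GLintV hk)).
  by apply: (mgeW HF _ (mgeM3 HF hd hkx hd')); move: HB2; rewrite mulr2n; lia.
have dz k : k \in unitmx -> \det (z k) = \det x.
  by move=> uk; rewrite /z !det_conj.
pose G k := \sum_(a <- ks) m (a *m z k *m invmx a).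
(* Moving [k] inside its class conjugates [z k] by an element that has level [t] before conjugation
   by [D] and level [t0] after it. *)
have Ginv k k' : GLint k -> GLint k' -> rcongr val t k k' -> G k = G k'.
  move=> hk _ [kp hkp ->]; have [uk _ _] := hk.
  have [ukp _ _] := congr_GLint HF t1 hkp.
  rewrite /G big_seq [RHS]big_seq; apply: eq_bigr => a /hks ha.
  pose c := D *m (k *m kp *m invmx k) *m invmx D.
  have hc : mge t0 (c - 1%:M).
    have -> : c - 1%:M = D *m (k *m kp *m invmx k - 1%:M) *m invmx D.
      by rewrite mulmxBr mulmx1 mulmxBl mulmxV.
    apply: (mgeW HF _ (mgeM3 HF hd (congr_conj HF hk hkp) hd')).
    by rewrite tE mulr2n; lia.
  rewrite -(conj_level HF t01 Hinv0 ha (hz _ hk) (dz _ uk) hc).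
  have [ua _ _] := ha; have [uc _ _] := congr_GLint HF t01 hc.
  congr m; rewrite [invmx (a *m c)]invmxM // /z /c !invmxM ?unitmx_mul ?unitmx_inv ?uD ?uk ?ukp //.
  rewrite !invmxK !mulmxA.
  do ! rewrite (mulmxKV uD) ?(mulmxKV uk).
  by [].
have step1 c : GLint c -> \sum_(a <- ks) m ((a *m (k1 *m D *m k2) *m c) *m x *m
    invmx (a *m (k1 *m D *m k2) *m c)) = G (k2 *m c *m 1%:M).
  move=> hc; have [uc _ _] := hc; rewrite mulmx1.
  have hk2c : GLint (k2 *m c) by exact: GLintM.
  have [uk2c _ _] := hk2c.
  rewrite /G -(conj_sum_right HF t1 Hinv trK (hz _ hk2c) (dz _ uk2c) hk1).
  rewrite big_seq [RHS]big_seq; apply: eq_bigr => a /hks [ua _ _]; congr m.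
  rewrite /z !invmxM ?unitmx_mul ?ua ?uk1 ?uk2 ?uD //.
  by rewrite !mulmxA.
rewrite exchange_big /=.
transitivity (\sum_(c <- ks) G c).
  rewrite -(GLint_sum_mul HF t1 trK hk2 (GLint1 HF n) Ginv).
  by rewrite big_seq [RHS]big_seq; apply: eq_bigr => c /hks; exact: step1.
have [L0 hL0] := mge_totally_bounded HF r.+1 s.+1 (- M) t.
have [L trL] : exists L, transv_seq (mge (- M)) (fun X X' : 'M[F]_(r.+1, s.+1) => mge t (X' - X)) L.
  apply: (@transversal_exists _ _ _ _ (fun X Y => mge t (X - Y)) L0) => //.
  - by move=> X; rewrite subrr; exact: mge0.
  - by move=> X X' h; rewrite -opprB; exact: mgeN.
  - by move=> X X' Z h1 h2; rewrite -(subrK Z X') -addrA; apply: (mgeD HF) => //; rewrite -opprB; exact: mgeN.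
have Lnil : (size L)%:R != 0 :> R[i].
  rewrite pnatr_eq0 size_eq0; apply/eqP => L_nil.
  by case: trL => _ _ _ /(_ 0 (mge0 HF _)) [X]; rewrite L_nil.
(* Instead of dividing to form an average over unipotents, the identity is multiplied by the number
   of them. Each copy of the sum over $K$ is then translated by its own [U X]. *)
apply: (mulfI Lnil); rewrite mulr0 mulr_natl.
pose U (X : 'M[F]_(r.+1, s.+1)) := invmx D *m unip X *m D.
(* Conjugation by the inverse of [D] contracts the upper right block by the gap, which exceeds [M];
   this brings unipotents of level $-M$ into $K$. *)
have hU X : mge (- M) X -> mge 0 (U X).
  move=> hX; have -> : U X = 1%:M + invmx D *m (unip X - 1%:M) *m D.
    by rewrite mulmxBr mulmx1 mulmxBl mulVmx // addrC subrK.
  apply: (mgeD HF); first exact: mge1.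
  have -> : unip X - 1%:M = block_mx 0 X 0 0.
    by rewrite /unip scalar_mx_block opp_block_mx add_block_mx !subrr oppr0 addr0.
  move=> i j; rewrite diag_conj_entryV //.
  case: (split_ordP i) => i' ->; case: (split_ordP j) => j' ->;
    rewrite ?(block_mxEul, block_mxEur, block_mxEdl, block_mxEdr) ?mxE ?mulr0 ?mul0r;
    try exact: (vge0 HF).
  have := gap (lshift _ i') (rshift _ j'); rewrite /= leq_addr ltn_ord => /(_ isT isT) gp.
  have v1 : vge (- val (d 0 (lshift s.+1 i'))) (d 0 (lshift s.+1 i'))^-1 by apply: (vgeV HF); exact: d0.
  have v2 := vge_self val (d 0 (rshift r.+1 j')).
  apply: (vgeW HF _ (vgeM HF (vgeM HF v1 (hX i' j')) v2)).
  by move: gp; rewrite !mulrS mulr0n; lia.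
have GU X : mge (- M) X -> GLint (U X).
  move=> hX; apply: (@GLint_intro _ _ _ _ (U (- X))); [|exact: hU|by apply: hU; exact: mgeN].
  by rewrite /U !mulmxA mulmxK // -[_ *m unip X *m unip _]mulmxA unipNK mulmx1 mulVmx.
have LM X : X \in L -> mge (- M) X by case: trL => _ h _ _; exact: h.
transitivity (\sum_(X <- L) \sum_(c <- ks) G (U X *m c *m 1%:M)).
  transitivity (\sum_(X <- L) \sum_(c <- ks) G c); first by rewrite big_const_seq count_predT iter_addr_0.
  rewrite big_seq [RHS]big_seq; apply: eq_bigr => X /LM hX.
  by rewrite (GLint_sum_mul HF t1 trK (GU X hX) (GLint1 HF n) Ginv).
rewrite exchange_big /= big_seq big1 // => c /hks hc.
have [uc _ _] := hc.
have hcx : mge (- v) (c *m x *m invmx c) by apply/(mge_GLint HF _ x hc (GLintV hc)).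
(* The same gap pushes the lower left block down. The conjugate of [x] by $K$ has level $-v$, so
   $3M+1$ remains of $v+3M+1$. *)
have dl : mge (M *+ 3 + 1) (dlsubmx (z c)).
  move=> i j; have -> : dlsubmx (z c) i j = z c (rshift r.+1 i) (lshift s.+1 j) by rewrite !mxE.
  rewrite /z diag_conj_entry //.
  have := gap (lshift _ j) (rshift _ i); rewrite /= leq_addr ltn_ord => /(_ isT isT) gp.
  have v1 : vge (- val (d 0 (lshift s.+1 j))) (d 0 (lshift s.+1 j))^-1 by apply: (vgeV HF); exact: d0.
  have v2 := vge_self val (d 0 (rshift r.+1 i)).
  apply: (vgeW HF _ (vgeM HF (vgeM HF v2 (hcx (rshift r.+1 i) (lshift s.+1 j))) v1)).
  by move: gp; rewrite !mulrS mulr0n; lia.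
have Dz : Delta (z c) = Delta x by rewrite /z !Delta_conj.
have := core_sum HF Hmu Hcusp N0 v0 Hsupp ux hx Dx vDx t1 HB1 Hinv trL trK (dz c uc) Dz dl.
apply: etrans; rewrite big_seq [RHS]big_seq; apply: eq_bigr => X XL.
apply: eq_bigr => a _; congr (m (a *m _ *m _)).
rewrite /z /U mulmx1 !invmxM ?unitmx_mul ?unitmx_inv ?uD ?unip_unit ?uc //.
rewrite invmxK invmx_unip !mulmxA mulmxV // mul1mx.
by rewrite mulmxK.
Qed.

End Shell.

(** * From the operators $\mathcal{A}_i$ to sums over shells *)

Section Main.
Variables (R : realType) (F : fieldType) (val : F -> int).
Hypothesis HF : is_local_field val.
Local Notation mge := (mge val).
Local Notation GLint := (GLint val).

(** The summand [v] pays for the entries of $kxk^{-1}$ with $k$ in $K$; the rest is the depth of the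
    lower left block that [bounded_sum] needs. *)
Definition gap_bound (n : nat) (N v : int) : int := v + dbound n N v *+ 3 + 1.

(** Turns a position of the gap, known only as $0<r<n$, into the block format of [shell_sum].
    Eliminating the variable [n] spares all casts between matrix types. *)
Lemma shell_sum_at (n r : nat) (mu : {measure set BMat val n -> \bar R})
    (m : 'M[F]_n -> R[i]) (N v : int) (x : 'M[F]_n) (t0 t Bd bg : int) (ks : seq 'M[F]_n)
    (d : 'rV[F]_n) (k1 k2 : 'M[F]_n) : (0 < r < n)%N ->
  is_haar_G mu -> cuspidal val m -> 0 <= N -> 0 <= v ->
  (forall y : 'M[F]_n, y \in unitmx -> m y != 0 -> exists z : F, z != 0 /\ ovG val (z *: y) <= N) ->
  x \in unitmx -> mge (- v) x -> Delta x != 0 -> val (Delta x) <= v ->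
  1 <= t0 -> 0 <= bg -> t = t0 + bg *+ 2 ->
  cbound N v + dbound n N v *+ 2 <= Bd -> v + bg *+ 2 <= Bd ->
  (forall z : 'M[F]_n, mge (- Bd) z -> \det z = \det x ->
     forall k, mge t0 (k - 1%:M) -> m (k *m z *m invmx k) = m z) ->
  transv_seq (fun k : 'M[F]_n => GLint k) (rcongr val t) ks ->
  (forall i, d 0 i != 0) -> mge (- bg) (diag_mx d) -> mge (- bg) (invmx (diag_mx d)) ->
  (forall i j : 'I_n, (i < r)%N -> (r <= j)%N -> gap_bound n N v <= val (d 0 j) - val (d 0 i)) ->
  GLint k1 -> GLint k2 ->
  \sum_(a <- ks) \sum_(c <- ks)
     m ((a *m (k1 *m diag_mx d *m k2) *m c) *m x *m invmx (a *m (k1 *m diag_mx d *m k2) *m c)) = 0.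
Proof.
case: r => // r rn; have [s en] : exists s, n = (r.+1 + s.+1)%N by exists (n - r.+2)%N; lia.
subst n => Hmu Hcusp N0 v0 Hsupp ux hx Dx vDx t01 bg0 tE HB1 HB2 Hinv trK d0 hd hd' gap hk1 hk2.
exact: (shell_sum HF Hmu Hcusp N0 v0 Hsupp ux hx Dx vDx t01 bg0 tE HB1 HB2 Hinv trK d0 hd hd' gap hk1 hk2).
Qed.

Lemma conj_sub_bound n (k z : 'M[F]_n) t B : 1 <= t -> mge t (k - 1%:M) -> mge (- B) z ->
  mge (t - B) (k *m z *m invmx k - z).
Proof.
move=> t1 hk hz; have [uk _ hk'] := congr_GLint HF t1 hk.
have -> : k *m z *m invmx k - z = ((k - 1%:M) *m z - z *m (k - 1%:M)) *m invmx k.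
  rewrite [(k - 1%:M) *m z]mulmxBl mul1mx [z *m (k - 1%:M)]mulmxBr mulmx1 opprB addrA subrK mulmxBl.
  by rewrite mulmxK.
apply: mge0M => //; apply: (mgeB HF); first exact: mgeM.
by rewrite addrC; exact: mgeM.
Qed.

Lemma Dad_measurable n i : @measurable _ (BMat val n) (@Dad F val n i).
Proof.
apply: (mx_open_measurable HF) => y hy; have [uy _] := hy.
have [K hK] := mge_exists val (invmx y); exists (K%:Z + 1) => z /mx_ballE hz.
have hk : mge 1 (invmx y *m z - 1%:M).
  rewrite -(mulVmx uy) -mulmxBr; apply: (mgeW HF _ (mgeM HF hK hz)); lia.
have -> : z = 1%:M *m y *m (invmx y *m z) by rewrite mul1mx mulKVmx.
by apply/(Dad_GLint HF i y (GLint1 HF n)) => //; exact: (congr_GLint HF (t := 1)).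
Qed.

Lemma horner_affine (c0 c1 : nat) (z : int) : (0 < c1)%N ->
  (map_poly (fun k : nat => k%:Z) (Poly [:: c0; c1])).[z] = c0%:Z + c1%:Z * z.
Proof.
move=> c10; have E : polyseq (Poly [:: c0; c1] : {poly nat}) = [:: c0; c1].
  by apply: (@PolyK _ 0%N) => /=; rewrite -lt0n.
rewrite /map_poly horner_poly E /= !big_ord_recl big_ord0 /=.
by rewrite expr0 mulr1 expr1 addr0.
Qed.

(** The cosets $gK_t$ tile the domain and have equal measure by left invariance. Their volume need
    not be computed: it is a common factor on both sides of the theorem. *)
Lemma Aop_sum n (mu : {measure set BMat val n -> \bar R}) (m : 'M[F]_n -> R[i]) (x : 'M[F]_n)
    (i t : int) (s : seq 'M[F]_n) : is_haar_G mu -> 1 <= t ->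
  transv_seq (@Dad F val n i) (rcongr val t) s ->
  (forall g h, Dad val i g -> rcongr val t g h ->
     m (h *m x *m invmx h) = m (g *m x *m invmx g)) ->
  Aop mu i m x =
  (fine (mu [set y | mge t (y - 1%:M)]))%:C%C * \sum_(g <- s) m (g *m x *m invmx g).
Proof.
move=> [inv fin _] t1 [us sS se sc] hm.
have us' g : g \in s -> g \in unitmx by move=> /sS [].
have memA g y : g \in s -> mge t (invmx g *m y - 1%:M) -> rcongr val t g y.
  by move=> gs h; apply/(rcongrE val t y (us' g gs)).
have mK : @measurable _ (BMat val n) [set y | mge t (y - 1%:M)].
  have := coset_measurable HF t (unitmx1 F n); rewrite invmx1.
  by rewrite (_ : (fun y => _) = (fun y : 'M[F]_n => mge t (y - 1%:M))) //; apply/funext => y; rewrite mul1mx.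
have finK : mu [set y | mge t (y - 1%:M)] \is a fin_num.
  rewrite ge0_fin_numE //; apply: le_lt_trans (fin 0); apply: le_measure.
  - exact/mem_set.
  - by apply/mem_set; exact: Gi_measurable.
  - move=> y /= /(mgeW HF t1) /(congr1_unit HF) [uy vy hy _]; split=> //.
    by apply/(ovG_le HF); rewrite oppr0 vy.
apply: (@cintegral_step R _ _ mu _ s (fun g => [set y | mge t (invmx g *m y - 1%:M)]) id) => //.
- exact: Dad_measurable.
- by move=> g /us'; exact: coset_measurable.
- move=> g gs y /= /(memA _ _ gs) [k hk ->]; rewrite -[g *m k]mul1mx mulmxA.
  apply/(Dad_GLint HF i g (GLint1 HF n)); [exact: congr_GLint hk|exact: sS].
- by move=> g /us' ug; rewrite (haar_coset HF inv) // fineK.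
- move=> g h y gs hs /(memA _ _ gs) h1 /(memA _ _ hs) h2; apply: se => //.
  exact: (rcongr_trans HF t1 h1 (rcongr_sym HF t1 h2)).
- by move=> g y gs /(memA _ _ gs); apply: hm; exact: sS.
- move=> y Dy none; have [g gs hg] := sc y Dy; exfalso; apply: (none g gs) => /=.
  by apply/(rcongrE val t y (us' g gs)); exact: (rcongr_sym HF t1 hg).
Qed.

End Main.

Theorem theoremC (R : realType) (F : fieldType) (val : F -> int)
  (HF : is_local_field val) (n : nat) (hn : (0 < n)%N)
  (mu : {measure set BMat val n -> \bar R}) (Hmu : is_haar_G mu)
  (m : 'M[F]_n -> R[i])
  (Hsm : smooth val m) (Hcusp : cuspidal val m) (Hsupp : cpt_supp_mod_center val m) :
  exists beta : {poly nat},
    forall x : 'M[F]_n, Grss x ->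
      let i0 : int := (map_poly (fun k : nat => k%:Z) beta).[ovGrss val x] in
      forall i : int, i0 < i -> Aop mu i m x = Aop mu i0 m x.
Proof.
have [N1 hN1] := Hsupp; pose N : int := `|N1|%N%:Z.
have N0 : 0 <= N by [].
have HsuppN (y : 'M[F]_n) : y \in unitmx -> m y != 0 -> exists z : F, z != 0 /\ ovG val (z *: y) <= N.
  by move=> uy my; have [z [z0 hz]] := hN1 y uy my; exists z; split=> //; apply: le_trans hz _; rewrite /N; lia.
(* Expanding $n^2\,(v+3(v+6n^2(v+2N))+1)$ as an affine function of $v$. The factor $n^2$ is that of
   [Dad_gap]. *)
pose c0 := (n * n * (36 * n * n * `|N1| + 1))%N; pose c1 := (n * n * (4 + 18 * n * n))%N.
exists (Poly [:: c0; c1]) => x [ux Dx]; set v := ovGrss val x.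
rewrite horner_affine; last by rewrite /c1; nia.
move=> i0 i i0i.
have ovx : ovG val x <= v by rewrite le_max lexx.
have v0 : 0 <= v by apply: le_trans ovx; exact: ovG_ge0.
have [hx _] := (ovG_le HF x v).1 ovx.
have vDx : val (Delta x) <= v by rewrite /v /ovGrss le_max lexx orbT.
have i0E : gap_bound n N v *+ (n * n) <= i0.
  rewrite le_eqVlt; apply/orP; left; apply/eqP.
  have natE (y : int) k : y *+ k = y * k%:Z by rewrite -mulr_natr natz.
  rewrite /gap_bound /dbound /cbound /i0 /c0 /c1 !natE !(PoszM, PoszD) -/N.
  ring.
have gap0 : 0 <= gap_bound n N v.
  by rewrite /gap_bound /dbound /cbound !addr_ge0 // !mulrn_wge0 // !addr_ge0 // !mulrn_wge0 // !addr_ge0 // mulrn_wge0.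
(* From here on the constants depend on [i] as well; [i0] is already fixed. [Bd] must cover both the
   conjugates in the unipotent sums and those of [x] by elements of the domain. *)
have [bg [bg0 hbg]] := Dad_bounded HF i hn.
pose Bd := Num.max (cbound N v + dbound n N v *+ 2) (v + bg *+ 2).
have [tu htu] := uniform_level HF Bd (det_neq0 ux) Hsm.
(* [uniform_level] concerns additive perturbations. Conjugating a matrix of level [- Bd] by an
   element of $K_{t_0}$ perturbs it at level [t0 - Bd], which has to reach [tu]. *)
pose t0 := Num.max 1 (tu + Bd); pose t := t0 + bg *+ 2.
have t01 : 1 <= t0 by rewrite le_max lexx.
have t1 : 1 <= t by rewrite /t (le_trans t01) // lerDl mulrn_wge0.
have Hinv (z : 'M[F]_n) : mge val (- Bd) z -> \det z = \det x ->
    forall k, mge val t0 (k - 1%:M) -> m (k *m z *m invmx k) = m z.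
  move=> hz dz k hk; apply: (htu z hz dz); apply: (mgeW HF _ (conj_sub_bound HF t01 hk hz)).
  by rewrite lerBrDr le_max lexx orbT.
have Dad_sub (g : 'M[F]_n) : Dad val i0 g -> Dad val i g.
  move=> [ug [dg [z [z0 hz]]]]; split=> //; split=> //; exists z; split=> //.
  by apply: le_trans hz _; exact: ltW.
have Phi_inv g h : Dad val i g -> rcongr val t g h ->
     m (h *m x *m invmx h) = m (g *m x *m invmx g).
  move=> Dg [k hk ->]; have [ug _] := Dg; have [hg hg'] := hbg g Dg.
  have [uk _ _] := congr_GLint HF t1 hk.
  have hz : mge val (- Bd) (g *m x *m invmx g).
    apply: (mgeW HF _ (mgeM3 HF hg hx hg')); rewrite lerNl le_max; apply/orP; right.
    by rewrite mulr2n; lia.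
  have hc : mge val t0 (g *m k *m invmx g - 1%:M).
    have -> : g *m k *m invmx g - 1%:M = g *m (k - 1%:M) *m invmx g.
      by rewrite mulmxBr mulmx1 mulmxBl mulmxV.
    by apply: (mgeW HF _ (mgeM3 HF hg hk hg')); rewrite /t mulr2n; lia.
  rewrite -(Hinv _ hz (det_conj x ug) _ hc); congr m.
  have -> : invmx (g *m k *m invmx g) = g *m invmx k *m invmx g.
    by rewrite !invmxM ?unitmx_mul ?ug ?uk ?unitmx_inv // invmxK mulmxA.
  by rewrite invmxM // !mulmxA !mulmxKV.
have [ks trK] := GLint_transversal HF n t1.
have bnd (g : 'M[F]_n) : Dad val i g -> [/\ g \in unitmx, mge val (- bg) g & mge val (- bg) (invmx g)].
  by move=> Dg; have [] := hbg g Dg; have [ug _] := Dg; split.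
have [s0 trs0] : exists s, transv_seq (@Dad F val n i0) (rcongr val t) s.
  by apply: (rcongr_transversal HF t1 (b := bg)) => g /Dad_sub; exact: bnd.
(* The shell between the two domains. Both domains are unions of classes, so representatives of the
   smaller one and of the shell together represent the larger one, and the difference of the
   operators is the sum over the shell. *)
pose S1 : set 'M[F]_n := fun g => Dad val i g /\ ~ Dad val i0 g.
have [s1 trs1] : exists s, transv_seq S1 (rcongr val t) s.
  by apply: (rcongr_transversal HF t1 (b := bg)) => g [Dg _]; exact: bnd.
have DadU : @Dad F val n i = @Dad F val n i0 `|` S1.
  apply/seteqP; split=> g.
    by move=> Dg; have [h|h] := pselect (Dad val i0 g); [left|right].
  by move=> [/Dad_sub|[]].
have Dad_rcongr j (g h : 'M[F]_n) : rcongr val t g h -> Dad val j g -> Dad val j h.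
  move=> [k hk ->] Dg; rewrite -[g]mul1mx.
  by apply/(Dad_GLint HF j g (GLint1 HF n)) => //; exact: congr_GLint hk.
have trs : transv_seq (@Dad F val n i) (rcongr val t) (s0 ++ s1).
  rewrite DadU; apply: (transversal_cat (rcongr_refl HF t) (rcongr_sym HF t1)) => // g h Dg [_ nD] gh.
  by apply: nD; exact: Dad_rcongr gh Dg.
rewrite (Aop_sum HF Hmu t1 trs Phi_inv) (Aop_sum HF Hmu t1 trs0); last by move=> g h /Dad_sub; exact: Phi_inv.
rewrite big_cat /= mulrDr.
suff -> : \sum_(g <- s1) m (g *m x *m invmx g) = 0 by rewrite mulr0 addr0.
have hks k : k \in ks -> GLint val k by case: trK => _ h _ _; exact: h.
have ksn : (size ks)%:R != 0 :> R[i].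
  rewrite pnatr_eq0 size_eq0; apply/eqP => ks_nil.
  by case: trK => _ _ _ /(_ _ (GLint1 HF n)) [X]; rewrite ks_nil.
(* Two factors [size ks] make room for sums over [a] and [c]. The shell is stable under $K$ on both
   sides, so each two-sided translate has the same sum, and the terms can be regrouped by [g]. *)
apply: (mulfI ksn); apply: (mulfI ksn); rewrite !mulr0 !mulr_natl.
transitivity (\sum_(a <- ks) \sum_(c <- ks) \sum_(g <- s1)
    m ((a *m g *m c) *m x *m invmx (a *m g *m c))).
  have cst (V : zmodType) (y : V) : \sum_(a <- ks) y = y *+ size ks.
    by rewrite big_const_seq count_predT iter_addr_0.
  rewrite -!cst big_seq [RHS]big_seq; apply: eq_bigr => a /hks ha.
  rewrite big_seq [RHS]big_seq; apply: eq_bigr => c /hks hc.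
  have [ua _ _] := ha; have [uc _ _] := hc.
  have S1_mul (a' g c' : 'M[F]_n) : GLint val a' -> GLint val c' -> S1 g -> S1 (a' *m g *m c').
    move=> ha' hc' [h1 h2]; split; first exact/(Dad_GLint HF i g ha' hc').
    by move/(Dad_GLint HF i0 g ha' hc').
  apply/esym; apply: (transversal_reindex (rcongr_refl HF t) (rcongr_sym HF t1) (rcongr_trans HF t1) trs1
    (theta := fun g => a *m g *m c) (phi := fun g => m (g *m x *m invmx g))).
  - by move=> g; exact: S1_mul.
  - by move=> g h _ _; exact: rcongr_mul.
  - move=> g Sg; exists (invmx a *m g *m invmx c); first by apply: S1_mul => //; exact: GLintV.
    by rewrite !mulmxA mulmxV // mul1mx mulmxKV //; exact: rcongr_refl.
  - by move=> g h [Dg _] _ gh; rewrite (Phi_inv g h).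
under eq_bigr do rewrite exchange_big /=.
rewrite exchange_big /= big_seq big1 // => g gs1.
have [Dg nDg] : S1 g by case: trs1 => _ h _ _; exact: h.
have [ug hg hg'] := bnd g Dg; have [_ [dg _]] := Dg.
have [k1 [k2 [d [hk1 hk2 hd1 dmon gE]]]] := cartan HF ug hg.
have [uk1 _ _] := hk1; have [uk2 _ _] := hk2.
have d0 j : d 0 j != 0 by have [] := hd1 j.
(* Lying outside the smaller domain is used only here: it produces the gap, and with it the
   parabolic subgroup, which depends on [g]. *)
have [r rn gap] := Dad_gap HF hn gE hk1 hk2 d0 dmon dg gap0 i0E nDg.
rewrite gE; apply: (shell_sum_at HF rn Hmu Hcusp N0 v0 HsuppN ux hx Dx vDx t01 bg0 (erefl t) _ _ Hinv trK d0 _ _ gap hk1 hk2).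
- by rewrite /Bd le_max lexx.
- by rewrite /Bd le_max lexx orbT.
- by apply/(mge_GLint HF _ _ hk1 hk2); rewrite -gE.
have uD : diag_mx d \in unitmx by have [] := invmx_diag d0.
have -> : invmx (diag_mx d) = k2 *m invmx g *m k1.
  by rewrite gE !invmxM ?unitmx_mul ?uk1 ?uD // !mulmxA mulmxV // mul1mx mulmxKV.
by apply/(mge_GLint HF _ _ hk2 hk1).
Qed.
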